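(* Let $U\subseteq\mathbb C^p$ be a connected open subset and $f:U\to Z$ a holomorphic map with $f^{-1}(Z_0)\ne\emptyset$. Fix $x_0\in f^{-1}(Z_0)$ and $v_0\in\pi^{-1}(f(x_0))$. Then there is a holomorphic map $F:U\to V$ with $\pi\circ F=f$ if and only if $f_*\big(\pi_1(f^{-1}(Z_0),x_0)\big)\subseteq\pi_*\big(\pi_1(V_0,v_0)\big)$ in $\pi_1(Z_0,f(x_0))$.
   Context: $V$ is a finite-dimensional complex vector space, $G\subset GL(V)$ a finite group, $Z=V/G$ realized as $\sigma(V)\subseteq\mathbb C^m$ via a minimal system of homogeneous generators $\sigma$ of $\mathbb C[V]^G$, with quotient map $\pi=\sigma$. $V_0$ is the set of points with trivial isotropy group and $Z_0=\pi(V_0)$; $\pi:V_0\to Z_0$ is a finite étale map. Holomorphic maps into $Z$ are holomorphic maps into $\mathbb C^m$ with values in $Z$. $f^{-1}(Z_0)$ is the complement in $U$ of a proper analytic subset, hence connected. *)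

(* Defs.v *)
From HB Require Import structures.
From mathcomp Require Import all_boot all_order all_algebra.
From mathcomp Require Import all_classical all_reals all_analysis.
From mathcomp Require Import complex.
From mathcomp Require mpoly.
Import (canonicals, coercions) mpoly.
Set Implicit Arguments. Unset Strict Implicit. Unset Printing Implicit Defensive.
Import Order.TTheory GRing.Theory Num.Theory.
Import numFieldNormedType.Exports.
Local Open Scope classical_set_scope.
Local Open Scope ring_scope.
Local Open Scope complex_scope.

Definition Cplx (R : realType) : numClosedFieldType := R[i].

Section Defs.
Variable R : realType.
Local Notation C := (Cplx R).

(* G is a finite subgroup of GL_n(C), given as a finite list of matrices
   acting on row vectors v |-> v *m g. *)
Definition finite_matrix_group (n : nat) (G : seq 'M[C]_n) : Prop :=
  [/\ (1%:M : 'M[C]_n) \in G,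
      (forall g, g \in G -> g \in unitmx) &
      (forall g h, g \in G -> h \in G -> g *m h \in G)].

(* the linear forms (v *m g)_i = \sum_j v_j g_{j i} as polynomials *)
Definition mat_forms n (g : 'M[C]_n) : n.-tuple (mpoly.mpoly n C) :=
  [tuple \sum_(j < n) g j i *: @mpoly.mpolyX n C (mpoly.mnm1 j) | i < n].

Definition poly_act n (g : 'M[C]_n) (p : mpoly.mpoly n C) : mpoly.mpoly n C :=
  mpoly.comp_mpoly (mat_forms g) p.

Definition invariant n (G : seq 'M[C]_n) (p : mpoly.mpoly n C) : Prop :=
  forall g, g \in G -> poly_act g p = p.

Definition homogeneous n (p : mpoly.mpoly n C) : Prop :=
  exists d : nat, forall mo, mo \in mpoly.msupp p -> mpoly.mdeg mo = d.

Definition generated_by n m (G : seq 'M[C]_n)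
    (sigma : m.-tuple (mpoly.mpoly n C)) (S : {set 'I_m}) : Prop :=
  forall p, invariant G p ->
  exists Q : mpoly.mpoly m C,
    (forall mo, mo \in mpoly.msupp Q -> forall j, j \notin S -> mo j = 0%N) /\
    p = mpoly.comp_mpoly sigma Q.

Definition minimal_homogeneous_generators n m (G : seq 'M[C]_n)
    (sigma : m.-tuple (mpoly.mpoly n C)) : Prop :=
  [/\ forall i, homogeneous (tnth sigma i),
      forall i, invariant G (tnth sigma i),
      generated_by G sigma [set: 'I_m]%SET &
      forall S, generated_by G sigma S -> S = [set: 'I_m]%SET].

Definition quot_map n m (sigma : m.-tuple (mpoly.mpoly n C))
    (v : 'rV[C]_n) : 'rV[C]_m :=
  \row_(i < m) mpoly.meval (fun j => v 0 j) (tnth sigma i).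

Definition Zquot n m (sigma : m.-tuple (mpoly.mpoly n C)) : set 'rV[C]_m :=
  range (quot_map sigma).

Definition V0 n (G : seq 'M[C]_n) : set 'rV[C]_n :=
  [set v | forall g, g \in G -> v *m g = v -> g = 1%:M].

Definition Z0 n m (G : seq 'M[C]_n) (sigma : m.-tuple (mpoly.mpoly n C)) :=
  quot_map sigma @` V0 G.

Definition holomorphic_on p k (U : set 'rV[C]_p) (f : 'rV[C]_p -> 'rV[C]_k)
  : Prop := forall x : 'rV[C]_p, U x -> differentiable f x.

Definition unit_interval : set R := `[0, 1]%classic.

Definition loop_in k (A : set 'rV[C]_k) (a : 'rV[C]_k) (g : R -> 'rV[C]_k)
  : Prop :=
  [/\ {within unit_interval, continuous g},
      g @` unit_interval `<=` A,
      g 0 = a & g 1 = a].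

Definition loop_homotopic k (A : set 'rV[C]_k) (a : 'rV[C]_k)
    (g0 g1 : R -> 'rV[C]_k) : Prop :=
  exists H : R * R -> 'rV[C]_k,
  [/\ {within unit_interval `*` unit_interval, continuous H},
      H @` (unit_interval `*` unit_interval) `<=` A,
      (forall t, unit_interval t -> H (0, t) = g0 t /\ H (1, t) = g1 t) &
      (forall s, unit_interval s -> H (s, 0) = a /\ H (s, 1) = a)].

End Defs.

(* Main.v *)
(* If [F] lifts [f], composing loops with a translate of [F] through [v0] gives
   loops in [V0]. Conversely, pull back to [U] an invariant polynomial that does
   not vanish at [v0] but vanishes off [V0]: this is a holomorphic [phi] on [U] with
   [phi x0 <> 0] such that [f] maps [{phi <> 0}] to [Z0]. The set [{phi <> 0}] is
   connected, since the indicator function of a clopen part is holomorphic and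
   bounded, hence extends to [U]. Over it [f] is lifted by lifting paths together
   with their images: the endpoint does not depend on the path by the hypothesis
   on loops and homotopy lifting. The lift is holomorphic because invariants
   provide local coordinates at free orbits, and locally bounded because the
   coordinates of [v] are roots of a monic polynomial with coefficients in the
   invariants, so Riemann's extension theorem applies.

   Since holomorphic means complex differentiable, the one-variable theory starts
   from Goursat's lemma on rectangles. A bounded holomorphic function on
   [{phi <> 0}] satisfies Lipschitz and second order Taylor estimates that are
   uniform near each point of [U], by Cauchy's formula on complex lines; they give
   the extension in several variables. *)

Require Import Defs.
From HB Require Import structures.
From mathcomp Require Import all_boot all_order all_algebra.
From mathcomp Require Import all_classical all_reals all_analysis.
From mathcomp Require Import complex.
From mathcomp Require mpoly.
Import (canonicals, coercions) mpoly.
From mathcomp Require Import ring lra.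
Set Implicit Arguments.
Unset Strict Implicit.
Unset Printing Implicit Defensive.
Import Order.TTheory GRing.Theory Num.Theory.
Import numFieldNormedType.Exports.
Local Open Scope classical_set_scope.
Local Open Scope ring_scope.

(** * Real-valued norms *)

(** The obstacle is that lifting along paths breaks down where [f] leaves [Z0], and nothing is known
    about the shape of that locus. Enlarging it to the zeros of one function [phi] makes it
    accessible on complex lines, where zeros are isolated; a loop in [{phi <> 0}] is still a loop in
    the preimage of [Z0], so the hypothesis on loops applies to it. Path connectedness of
    [{phi <> 0}] and path lifting come out together: the points reachable by a path that is given
    along with its lift form a clopen part. That the extended lift still lies over [f] at the zeros
    of [phi] follows by density. Contours are squares rather than circles, so that all integrals run
    over segments. The constant 2 pi i of Cauchy's formula is never evaluated; a lower bound 4 for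
    its modulus is enough. The resulting constants are larger than the classical ones, but they
    depend only on a bound of the function and on a radius, which is what uniformity near the zeros
    of [phi] requires. *)

Section RealNorm.
Variable R : realType.
Local Notation C := (Cplx R).

(** The norm of a normed space over [C] takes values in [C]; its real part moves all estimates into
    the ordered field [R]. *)
Definition nr (V : normedModType C) (x : V) : R := complex.Re `|x|.

Lemma nrE (V : normedModType C) (x : V) : `|x| = ((nr x)%:C)%C.
Proof. by rewrite RRe_real // ger0_real. Qed.

Lemma ltc_nr (V : normedModType C) (x : V) (e : R) :
  (`|x| < (e%:C)%C) = (nr x < e).
Proof. by rewrite nrE ltcR. Qed.

Lemma nr_ge0 (V : normedModType C) (x : V) : 0 <= nr x.
Proof. by rewrite -lecR -nrE normr_ge0. Qed.

Lemma nr0 (V : normedModType C) : nr (0 : V) = 0.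
Proof. by rewrite /nr normr0. Qed.

Lemma nr_eq0 (V : normedModType C) (x : V) : (nr x == 0) = (x == 0).
Proof.
apply/eqP/eqP => [h|->]; last exact: nr0.
by apply/eqP; rewrite -normr_eq0 nrE h.
Qed.

Lemma nr_gt0 (V : normedModType C) (x : V) : (0 < nr x) = (x != 0).
Proof. by rewrite lt0r nr_ge0 andbT nr_eq0. Qed.

Lemma nrD (V : normedModType C) (x y : V) : nr (x + y) <= nr x + nr y.
Proof. by rewrite -lecR rmorphD /= -!nrE ler_normD. Qed.

Lemma nrN (V : normedModType C) (x : V) : nr (- x) = nr x.
Proof. by rewrite /nr normrN. Qed.

Lemma nrB (V : normedModType C) (x y : V) : nr (x - y) <= nr x + nr y.
Proof. by rewrite -(nrN y) nrD. Qed.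

Lemma nrBC (V : normedModType C) (x y : V) : nr (x - y) = nr (y - x).
Proof. by rewrite -nrN opprB. Qed.

Lemma nr_tri (V : normedModType C) (y x z : V) :
  nr (x - z) <= nr (x - y) + nr (y - z).
Proof. by apply: le_trans (nrD _ _); rewrite addrA subrK. Qed.

Lemma nrZ (V : normedModType C) (a : C) (x : V) : nr (a *: x) = nr a * nr x.
Proof. by apply: complexI; rewrite rmorphM /= -!nrE normrZ. Qed.

Lemma nrM (a b : C) : nr (a * b) = nr a * nr b.
Proof. by apply: complexI; rewrite rmorphM /= -!nrE normrM. Qed.

Lemma nr1 : nr (1 : C) = 1.
Proof. by rewrite /nr normr1. Qed.

Lemma nrX (a : C) k : nr (a ^+ k) = nr a ^+ k.
Proof. by elim: k => [|k IH]; rewrite ?expr0 ?nr1 // !exprS nrM IH. Qed.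

Lemma nrV (a : C) : nr a^-1 = (nr a)^-1.
Proof.
have [->|a0] := eqVneq a 0; first by rewrite invr0 !nr0 invr0.
have h : nr a != 0 by rewrite nr_eq0.
by apply: (mulfI h); rewrite -nrM !divff // nr1.
Qed.

Lemma nr_real (r : R) : nr ((r%:C)%C : C) = `|r|.
Proof. by rewrite /nr normc_def /= expr0n addr0 sqrtr_sqr. Qed.

Lemma nr_Re (z : C) : `|complex.Re z| <= nr z.
Proof.
rewrite /nr normc_def /= -[leLHS]sqrtr_sqr.
by rewrite ler_sqrt ?lerDl ?sqr_ge0 // addr_ge0 ?sqr_ge0.
Qed.

Lemma nr_Im (z : C) : `|complex.Im z| <= nr z.
Proof.
rewrite /nr normc_def /= -[leLHS]sqrtr_sqr.
by rewrite ler_sqrt ?lerDr ?sqr_ge0 // addr_ge0 ?sqr_ge0.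
Qed.

Lemma nr_i : nr ('i%C : C) = 1.
Proof. by rewrite /nr normc_def /= expr0n expr1n add0r sqrtr1. Qed.

Lemma nr_Complex (a b : R) : nr ((a +i* b)%C : C) <= `|a| + `|b|.
Proof.
rewrite [X in nr X]complexE /=; apply: le_trans (nrD _ _) _.
by rewrite nrM nr_i mul1r !nr_real.
Qed.

Lemma nbhs_nrP (V : normedModType C) (x : V) (P : set V) :
  nbhs x P <-> exists2 e : R, 0 < e & forall y, nr (y - x) < e -> P y.
Proof.
split=> [/nbhs_ballP[e /= e0 h]|[e e0 h]].
  have ee : e = ((complex.Re e)%:C)%C by rewrite RRe_real // gtr0_real.
  exists (complex.Re e) => [|y yx]; first by rewrite -ltcR -ee.
  by apply: h; rewrite -ball_normE /ball_ /= ee ltc_nr nrBC.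
apply/nbhs_ballP; exists (e%:C)%C => [|y]; first by rewrite /= ltcR.
by rewrite -ball_normE /ball_ /= ltc_nr nrBC => /h.
Qed.

Lemma open_nrP (V : normedModType C) (U : set V) :
  open U <-> forall x, U x -> exists2 e : R, 0 < e &
     forall y, nr (y - x) < e -> U y.
Proof.
rewrite openE; split=> h x /h; first by move=> /nbhs_nrP.
by move=> ?; apply/nbhs_nrP.
Qed.

Lemma continuous_nrP (V W : normedModType C) (f : V -> W) (x : V) :
  {for x, continuous f} <-> forall e : R, 0 < e -> exists2 d : R, 0 < d &
     forall y, nr (y - x) < d -> nr (f y - f x) < e.
Proof.
split=> [h e e0|h P /nbhs_nrP[e e0 eP]].
  have /h/nbhs_nrP : nbhs (f x) [set w | nr (w - f x) < e].
    by apply/nbhs_nrP; exists e.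
  by case=> d d0 hd; exists d.
have [d d0 hd] := h _ e0; apply/nbhs_nrP; exists d => // y /hd.
exact: eP.
Qed.

Lemma nr_coord n (v : 'rV[C]_n) j : nr (v 0 j) <= nr v.
Proof.
rewrite -lecR -!nrE /Num.norm /= mx_normE.
pose M := (\big[Num.max/(widen_itv 0%:itv : {nonneg C})]_i
      (widen_itv `|v i.1 i.2|%:itv : {nonneg C})).
exact: (le_bigmax _ (fun i : 'I_1 * 'I_n =>
  (widen_itv `|v i.1 i.2|%:itv : {nonneg C})) (0, j)).
Qed.

(** The norm is attained at an entry unless it vanishes; the latter case, which contains [n = 0],
    uses [0 <= K]. *)
Lemma nr_le_coord n (v : 'rV[C]_n) (K : R) :
  0 <= K -> (forall j, nr (v 0 j) <= K) -> nr v <= K.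
Proof.
move=> K0 h.
have [/eqP|v0] := eqVneq (mx_norm v) 0.
  by rewrite -[mx_norm v]/(`|v|) nrE => /eqP[->].
have [[i j]] := mx_norm_neq0 v0; rewrite ord1 /= -[mx_norm v]/(`|v|).
by rewrite !nrE => -[->].
Qed.

Lemma nr_lt_coord n (v : 'rV[C]_n) (K : R) :
  0 < K -> (forall j, nr (v 0 j) < K) -> nr v < K.
Proof.
move=> K0 h.
have [/eqP|v0] := eqVneq (mx_norm v) 0.
  by rewrite -[mx_norm v]/(`|v|) nrE => /eqP[->].
have [[i j]] := mx_norm_neq0 v0; rewrite ord1 /= -[mx_norm v]/(`|v|).
by rewrite !nrE => -[->].
Qed.

Lemma nr_sum (I : Type) (V : normedModType C) (s : seq I) (P : pred I)
  (F : I -> V) :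
  nr (\sum_(i <- s | P i) F i) <= \sum_(i <- s | P i) nr (F i).
Proof.
elim/big_rec2: _ => [|i y1 y2 _ h]; first by rewrite nr0.
by apply: le_trans (nrD _ _) _; rewrite lerD2l.
Qed.

Lemma nr_mulmx n k (A : 'M[C]_(n, k)) :
  exists2 K : R, 0 < K & forall v : 'rV[C]_n, nr (v *m A) <= K * nr v.
Proof.
pose S := \sum_i \sum_j nr (A i j).
have S0 : 0 <= S by do 2![apply: sumr_ge0 => ? _]; exact: nr_ge0.
(* The summand [1] keeps the constant positive, so that radii may be divided by it. *)
exists (1 + S) => [|v]; first lra.
have K0 : 0 <= (1 + S) * nr v by rewrite mulr_ge0 ?nr_ge0 //; lra.
apply: nr_le_coord => // j; rewrite mxE.
apply: le_trans (nr_sum _ _ _) _.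
apply: (@le_trans _ _ (S * nr v)); last by rewrite mulrDl mul1r lerDr nr_ge0.
rewrite /S mulr_suml; apply: ler_sum => i _; rewrite nrM mulrC.
rewrite ler_pM ?nr_ge0 ?nr_coord // (bigD1 j) //= lerDl.
by apply: sumr_ge0 => ? _; exact: nr_ge0.
Qed.

(** Reduces to completeness of [R]: real and imaginary part are 1-Lipschitz for [nr]. *)
Lemma complete_nr (u : nat -> C) :
  (forall e : R, 0 < e -> exists N, forall i j, (N <= i)%N -> (N <= j)%N ->
      nr (u i - u j) <= e) ->
  exists l : C, forall e : R, 0 < e -> exists N, forall i, (N <= i)%N ->
      nr (u i - l) <= e.
Proof.
move=> h.
have aux (f : C -> R) : (forall a b, `|f a - f b| <= nr (a - b)) ->
    exists l : R, forall e : R, 0 < e -> exists N, forall i, (N <= i)%N ->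
      `|f (u i) - l| <= e.
  move=> fN; pose w := fun n => f (u n).
  have /cauchy_exP/cauchy_cvgP : cauchy_ex (w @ \oo).
    move=> e e0; have [|N hN] := h (e / 2); first by rewrite divr_gt0.
    exists (w N); exists N => // i /= Ni; rewrite -ball_normE /ball_ /=.
    rewrite distrC; apply: le_lt_trans (fN _ _) _.
    by apply: le_lt_trans (hN _ _ Ni (leqnn _)) _; lra.
  move=> /cvg_ex[l /cvgrPdist_le wl]; exists l => e e0.
  have [N _ hN] := wl _ e0; exists N => i Ni.
  by rewrite distrC; exact: hN.
have [a ha] : exists l : R, forall e : R, 0 < e -> exists N, forall i, (N <= i)%N ->
      `|complex.Re (u i) - l| <= e.
  by apply: aux => x y; apply: le_trans (nr_Re _); case: x y => ? ? [? ?].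
have [b hb] : exists l : R, forall e : R, 0 < e -> exists N, forall i, (N <= i)%N ->
      `|complex.Im (u i) - l| <= e.
  by apply: aux => x y; apply: le_trans (nr_Im _); case: x y => ? ? [? ?].
exists (a +i* b)%C => e e0.
have [|N1 h1] := ha (e / 2); first by rewrite divr_gt0.
have [|N2 h2] := hb (e / 2); first by rewrite divr_gt0.
exists (maxn N1 N2) => i; rewrite geq_max => /andP[/h1 A /h2 B].
have := nr_Complex (complex.Re (u i) - a) (complex.Im (u i) - b).
case: (u i) A B => x y /=; lra.
Qed.

End RealNorm.

(* [lra] compares atoms up to conversion, which is slow on norms of vectors;
   abstracting the norms first is faster when they are syntactically equal. *)
Ltac nlra := first
  [ repeat match goal with
    | H : is_true (_ <= _) |- _ => match type of H with context [@nr _ _ _] => revert H end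
    | H : is_true (_ < _) |- _ => match type of H with context [@nr _ _ _] => revert H end
    | H : @eq _ _ _ |- _ => match type of H with context [@nr _ _ _] => revert H end
    end;
    repeat match goal with |- context [@nr ?R ?V ?x] => generalize (@nr R V x); intro end;
    intros; lra
  | lra ].

Section RowVectorNorm.
Variables (R : realType) (n : nat).
Implicit Types x y z : 'rV[Cplx R]_n.

Lemma nr_triv y x z : nr (x - z) <= nr (x - y) + nr (y - z).
Proof. exact: nr_tri. Qed.

Lemma nrDv x y : nr (x + y) <= nr x + nr y.
Proof. exact: nrD. Qed.

Lemma nrBv x y : nr (x - y) <= nr x + nr y.
Proof. exact: nrB. Qed.

Lemma nrBCv x y : nr (x - y) = nr (y - x).
Proof. exact: nrBC. Qed.

End RowVectorNorm.

(** * Differentials *)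

Section Differentials.
Variable R : realType.
Local Notation C := (Cplx R).

Lemma continuous_nrCP (W : normedModType C) (f : C -> W) (x : C) :
  {for x, continuous f} <-> forall e : R, 0 < e -> exists2 d : R, 0 < d &
     forall y : C, nr (y - x) < d -> nr (f y - f x) < e.
Proof. exact: continuous_nrP. Qed.

Lemma nbhs0_nr (V : normedModType C) (P : set V) :
  (\forall h \near 0, P h) <-> exists2 d : R, 0 < d & forall h, nr h < d -> P h.
Proof.
split=> [/nbhs_nrP[e e0 h]|[e e0 h]].
  by exists e => // y ye; apply: h; rewrite subr0.
by apply/nbhs_nrP; exists e => // y; rewrite subr0 => /h.
Qed.

Lemma differentiable_nr (V W : normedModType C) (f : V -> W) (x : V) :
  differentiable f x -> forall e : R, 0 < e -> exists2 d : R, 0 < d &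
    forall h, nr h < d -> nr (f (x + h) - f x - 'd f x h) <= e * nr h.
Proof.
move=> /diff_locally/eqaddoP df e e0.
have [|d d0 hd] := (iffLR (nbhs0_nr _)) (df (e%:C)%C _); first by rewrite ltcR.
exists d => // h /hd; rewrite /= !fctE /= [X in f X]addrC opprD addrA.
by rewrite !nrE -rmorphM lecR.
Qed.

(** Differentiability includes continuity of the differential, so the candidate [L] must be
    continuous; uniqueness of the differential then identifies it with [L]. *)
Lemma differentiable_of_linear (V W : normedModType C) (f : V -> W)
    (L : {linear V -> W}) (x : V) :
  continuous L -> (forall e : R, 0 < e -> exists2 d : R, 0 < d &
    forall h, nr h < d -> nr (f (x + h) - f x - L h) <= e * nr h) ->
  differentiable f x /\ 'd f x = L :> (V -> W).
Proof.
move=> cL hf.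
have fo : f \o shift x = cst (f x) + L +o_ (0 : V) id.
  apply/eqaddoP => e e0.
  have ee : e = ((complex.Re e)%:C)%C by rewrite RRe_real // gtr0_real.
  have [|d d0 hd] := hf (complex.Re e); first by rewrite -ltcR -ee.
  apply/nbhs0_nr; exists d => // h /hd.
  by rewrite /= !fctE /= [X in f X]addrC opprD addrA ee !nrE -rmorphM lecR.
have dL := diff_unique cL fo; split=> //.
by apply/diff_locallyP; rewrite dL.
Qed.

Lemma mulmx_continuous p k (A : 'M[C]_(p, k)) :
  continuous (fun v : 'rV[C]_p => v *m A).
Proof.
have [K K0 hK] := nr_mulmx A.
move=> v; apply/(@continuous_nrP _ _ _ (fun v => v *m A)) => e e0.
exists (e / K) => [|y]; first by rewrite divr_gt0.
rewrite -mulmxBl ltr_pdivlMr // mulrC; exact: le_lt_trans.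
Qed.

Lemma differentiable_mulmx p k (f : 'rV[C]_p -> 'rV[C]_k) (A : 'M[C]_(p, k)) x :
  (forall e : R, 0 < e -> exists2 d : R, 0 < d &
    forall h, nr h < d -> nr (f (x + h) - f x - h *m A) <= e * nr h) ->
  differentiable f x.
Proof.
move=> h; have cA : continuous (mulmxr A : 'rV[C]_p -> 'rV[C]_k) by exact: mulmx_continuous.
by have [] := @differentiable_of_linear _ _ f (mulmxr A) x cA h.
Qed.

Lemma linear_mulmx p (W : lmodType C) (L : {linear 'rV[C]_p -> W}) (h : 'rV[C]_p) :
  L h = \sum_j h 0 j *: L (delta_mx 0 j).
Proof.
rewrite {1}(row_sum_delta h) linear_sum.
by apply: eq_bigr => j _; rewrite linearZ.
Qed.

Lemma differentiable_lin p k (f : 'rV[C]_p -> 'rV[C]_k) x :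
  differentiable f x -> exists A : 'M[C]_(p, k),
  forall e : R, 0 < e -> exists2 d : R, 0 < d &
    forall h, nr h < d -> nr (f (x + h) - f x - h *m A) <= e * nr h.
Proof.
move=> df; exists (lin1_mx ('d f x)) => e e0.
have [d d0 hd] := differentiable_nr df e0.
exists d => // h /hd; rewrite mul_rV_lin1 //.
Qed.

Lemma differentiable_C (f : C -> C) (x d : C) :
  (forall e : R, 0 < e -> exists2 r : R, 0 < r &
    forall h : C, nr h < r -> nr (f (x + h) - f x - d * h) <= e * nr h) ->
  differentiable f x.
Proof.
move=> h.
suff cd : continuous ( *:%R d : C -> C).
  by have [] := @differentiable_of_linear C C f ( *:%R d) x cd h.
move=> y; apply/continuous_nrCP => e e0; exists (e / (nr d + 1)).
  by rewrite divr_gt0 //; have := nr_ge0 d; lra.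
move=> z; have := nr_ge0 d; have := nr_ge0 (z - y) => ? ?.
rewrite -scalerBr nrZ ltr_pdivlMr; [|lra].
move=> zy.
nra.
Qed.

Lemma differentiable_nrC (f : C -> C) (x : C) :
  differentiable f x -> exists d : C, forall e : R, 0 < e -> exists2 r : R, 0 < r &
    forall h : C, nr h < r -> nr (f (x + h) - f x - d * h) <= e * nr h.
Proof.
move=> df; exists ('d f x 1) => e e0.
have [d d0 hd] := differentiable_nr df e0.
exists d => // h /hd.
by have -> : 'd f x h = 'd f x 1 * h by rewrite -[X in 'd f x X]mulr1 linearZ /= mulrC.
Qed.

Lemma differentiable_near (V W : normedModType C) (f g : V -> W) (x : V) (r : R) :
  0 < r -> (forall y, nr (y - x) < r -> f y = g y) ->
  differentiable f x -> differentiable g x.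
Proof.
move=> r0 fg df.
have cd : continuous 'd f x by move/diff_locallyP: df => -[].
have [] := @differentiable_of_linear _ _ g ('d f x) x cd; last by [].
move=> e e0; have [d d0 hd] := differentiable_nr df e0.
exists (Num.min d r); first by rewrite lt_min d0.
move=> h; rewrite lt_min => /andP[/hd + hr].
rewrite !fg ?subrr ?nr0 //.
by rewrite addrAC subrr add0r.
Qed.

Lemma differentiable_nearC (f g : C -> C) (x : C) (r : R) :
  0 < r -> (forall y : C, nr (y - x) < r -> f y = g y) ->
  differentiable f x -> differentiable g x.
Proof. exact: differentiable_near. Qed.

Lemma differentiable_idC (z : C) : differentiable (fun w : C => w) z.
Proof. by []. Qed.

Lemma differentiable_line p (x h : 'rV[C]_p) (t : C) :
  differentiable (fun z : C => x + z *: h) t.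
Proof. by apply: differentiableD => //; apply: differentiableZl. Qed.

End Differentials.

(** * Integrals over segments and rectangles, Goursat's lemma *)

Section SegmentIntegral.
Variable R : realType.
Local Notation C := (Cplx R).
Local Notation mu := (@lebesgue_measure R).

(** Continuity relative to the segment, since an integrand need only be controlled along a side of a
    rectangle. *)
Definition cont_on (a b : R) (u : R -> C) := forall x, a <= x <= b ->
  forall e : R, 0 < e -> exists2 d : R, 0 < d &
    forall y, a <= y <= b -> `|y - x| < d -> nr (u y - u x) < e.

Definition segint (a b : R) (u : R -> C) : C :=
  ((\int[mu]_(x in `[a, b]) complex.Re (u x))
   +i* (\int[mu]_(x in `[a, b]) complex.Im (u x)))%C.

(** Any 1-Lipschitz real function [f] is allowed, so that real and imaginary part are treated at
    once. *)
Lemma cont_on_integrable (f : C -> R) a b u :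
  (forall z w, `|f z - f w| <= nr (z - w)) -> cont_on a b u ->
  mu.-integrable `[a, b] (EFin \o (fun x => f (u x))).
Proof.
move=> fN cu; apply: continuous_compact_integrable; first exact: segment_compact.
apply/subspace_continuousP => x; rewrite /= in_itv /= => xab.
apply/cvgrPdist_lt => e e0; have [d d0 hd] := cu _ xab _ e0.
rewrite /prop_near1 /within /=; apply/nbhs_ballP; exists d => // y.
rewrite -ball_normE /ball_ /= => xy; rewrite in_itv /= => yab.
rewrite distrC; apply: le_lt_trans (fN _ _) _; apply: hd => //.
by rewrite distrC.
Qed.

Lemma Re_lip (z w : C) : `|complex.Re z - complex.Re w| <= nr (z - w).
Proof. by apply: le_trans (nr_Re _); case: z w => ? ? [? ?]. Qed.

Lemma Im_lip (z w : C) : `|complex.Im z - complex.Im w| <= nr (z - w).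
Proof. by apply: le_trans (nr_Im _); case: z w => ? ? [? ?]. Qed.

Let itR a b u := @cont_on_integrable _ a b u Re_lip.
Let itI a b u := @cont_on_integrable _ a b u Im_lip.

Lemma eq_segint a b u v : (forall x, a <= x <= b -> u x = v x) -> segint a b u = segint a b v.
Proof.
by move=> uv; congr (Complex _ _); apply: eq_Rintegral => x;
  rewrite inE /= in_itv /= => /uv ->.
Qed.

Lemma segintD a b u v : cont_on a b u -> cont_on a b v ->
  segint a b (fun x => u x + v x) = segint a b u + segint a b v.
Proof.
move=> cu cv; rewrite /segint.
rewrite (_ : _ + _ = ((\int[mu]_(x in `[a, b]) complex.Re (u x) + \int[mu]_(x in `[a, b]) complex.Re (v x)) +i* (\int[mu]_(x in `[a, b]) complex.Im (u x) + \int[mu]_(x in `[a, b]) complex.Im (v x)))%C) //.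
rewrite -!RintegralD ?itR ?itI //.
by congr (Complex _ _); apply: eq_Rintegral => x _; case: (u x) (v x) => ? ? [].
Qed.

Lemma segintZ a b u (k : C) : cont_on a b u ->
  segint a b (fun x => k * u x) = k * segint a b u.
Proof.
move=> cu; rewrite /segint; case: k => p q.
rewrite (_ : _ * _ = ((p * \int[mu]_(x in `[a, b]) complex.Re (u x) - q * \int[mu]_(x in `[a, b]) complex.Im (u x)) +i* (p * \int[mu]_(x in `[a, b]) complex.Im (u x) + q * \int[mu]_(x in `[a, b]) complex.Re (u x)))%C) //.
have iZ f (k : R) : mu.-integrable `[a, b] (EFin \o f) ->
    mu.-integrable `[a, b] (EFin \o (fun x => k * f x)).
  by move=> h; apply: (@eq_integrable _ _ _ _ _ _ (fun x => k%:E * (EFin \o f) x)%E) (integrableZl _ k h).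
rewrite -!RintegralZl ?itR ?itI // -RintegralD ?iZ ?itR ?itI //.
rewrite -RintegralB ?iZ ?itR ?itI //.
by congr (Complex _ _); apply: eq_Rintegral => x _; case: (u x).
Qed.

Lemma segintN a b u : cont_on a b u -> segint a b (fun x => - u x) = - segint a b u.
Proof.
move=> cu; rewrite -mulN1r -segintZ //.
by apply: eq_segint => x _; rewrite mulN1r.
Qed.

Lemma cont_onN a b u : cont_on a b u -> cont_on a b (fun x => - u x).
Proof.
move=> cu x xab e e0; have [d d0 hd] := cu x xab e e0.
by exists d => // y yab yx; rewrite -opprD nrN; apply: hd.
Qed.

Lemma segintB a b u v : cont_on a b u -> cont_on a b v ->
  segint a b (fun x => u x - v x) = segint a b u - segint a b v.
Proof. by move=> cu cv; rewrite segintD ?segintN //; exact: cont_onN. Qed.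

Lemma segint_cst a b (k : C) : a <= b -> segint a b (fun=> k) = ((b - a)%:C)%C * k.
Proof.
move=> ab; rewrite /segint !Rintegral_cst //= lebesgue_measure_itv /=.
rewrite lte_fin; case: ltP => h /=.
  by case: k => p q; congr (Complex _ _); rewrite /=; ring.
have -> : b = a by lra.
by rewrite subrr; case: k => p q; congr (Complex _ _); rewrite /=; ring.
Qed.

Lemma segint_split a c b u : a <= c <= b -> cont_on a b u ->
  segint a b u = segint a c u + segint c b u.
Proof.
move=> /andP[ac cb] cu.
have cu' : cont_on c b u.
  move=> x /andP[cx xb] e e0; have [|d d0 hd] := cu x _ e e0.
    by rewrite xb (le_trans ac).
  by exists d => // y /andP[cy yb]; apply: hd; rewrite yb (le_trans ac).
have aux (f : C -> R) : (forall z w, `|f z - f w| <= nr (z - w)) ->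
   \int[mu]_(x in `[a, b]) f (u x) =
   \int[mu]_(x in `[a, c]) f (u x) + \int[mu]_(x in `[c, b]) f (u x).
  move=> fN; have h1 := cont_on_integrable fN cu.
  have h2 := cont_on_integrable fN cu'.
  have h3 : mu.-integrable `]c, b] (EFin \o (fun x => f (u x))).
    by apply: integrableS h2 => //; apply: subset_itvr; rewrite bnd_simp.
  rewrite -(Rintegral_itv_obnd_cbnd h3) -(@Rintegral_itvB _ _ (BLeft a) (BRight b) c) //.
    by rewrite addrC subrK.
by rewrite /segint (aux _ Re_lip) (aux _ Im_lip).
Qed.

(** The factor [2] comes from bounding real and imaginary part separately; the factors [4] and [16]
    in the bounds for rectangles and squares descend from it. *)
Lemma nr_segint a b u (M : R) : a <= b -> cont_on a b u ->
  (forall x, a <= x <= b -> nr (u x) <= M) -> nr (segint a b u) <= 2 * M * (b - a).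
Proof.
move=> ab cu uM; rewrite /segint.
have aux (f : C -> R) : f 0 = 0 -> (forall z w, `|f z - f w| <= nr (z - w)) ->
   `|\int[mu]_(x in `[a, b]) f (u x)| <= M * (b - a).
  move=> f0 fN; have h1 := cont_on_integrable fN cu.
  apply: le_trans (le_normr_Rintegral _ h1) _ => //.
  have -> : M * (b - a) = \int[mu]_(x in `[a, b]) M.
    rewrite Rintegral_cst //= lebesgue_measure_itv /= lte_fin.
    by case: ltP => //= h; have -> : b = a by [lra]; rewrite subrr mulr0.
  apply: le_Rintegral => //.
  - by have := integrable_norm h1.
  - apply: continuous_compact_integrable; first exact: segment_compact.
    by move=> ?; apply: cvg_cst.
  - move=> x; rewrite /= in_itv /= => xab; apply: le_trans (uM _ xab).
    by have := fN (u x) 0; rewrite f0 !subr0.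
apply: le_trans (nr_Complex _ _) _.
rewrite -mulrA mulr2n mulrDl mul1r.
by apply: lerD; [exact: (aux _ erefl Re_lip) | exact: (aux _ erefl Im_lip)].
Qed.

End SegmentIntegral.

(** * Bisection of rectangles *)

Section RectangleInduction.
Variable R : realType.

Lemma nested_intervals (a b : nat -> R) :
  (forall n, a n <= a n.+1 /\ b n.+1 <= b n) -> (forall n, a n <= b n) ->
  exists x, forall n, a n <= x <= b n.
Proof.
move=> mono ab.
have mono' i j : (i <= j)%N -> a i <= a j /\ b j <= b i.
  elim: j => [|j IH]; first by rewrite leqn0 => /eqP->.
  rewrite leq_eqVlt => /predU1P[->//|]; rewrite ltnS => /IH[? ?].
  by have [? ?] := mono j; split; lra.
have le_ab i j : a i <= b j.
  have [/mono'[h _]|/ltnW/mono'[_ h]] := leqP i j.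
    exact: le_trans h (ab j).
  exact: le_trans (ab i) h.
have hs : has_sup (range a).
  by split; [exists (a 0%N), 0%N | exists (b 0%N) => _ [n _ <-]].
exists (sup (range a)) => n; apply/andP; split.
  by apply: ub_le_sup; [case: hs | exists n].
by apply: sup_le_ub; [case: hs | move=> _ [i _ <-]].
Qed.

Lemma half_pow_lt (w d : R) : 0 < d -> exists n, w / 2 ^+ n < d.
Proof.
move=> d0; have [w0|w0] := leP w 0.
  by exists 0%N; rewrite expr0 divr1; exact: le_lt_trans d0.
exists (Num.truncn (w / d)).+1.
rewrite ltr_pdivrMr ?exprn_gt0 // mulrC -ltr_pdivrMr //.
apply: lt_trans (Num.Theory.truncnS_gt _) _.
by rewrite -natrX ltr_nat ltn_expl.
Qed.

Lemma half_bounds (a b : R) : a <= b -> [/\ a <= (a + b) / 2, (a + b) / 2 <= b,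
  (a + b) / 2 - a = 2^-1 * (b - a) & b - (a + b) / 2 = 2^-1 * (b - a)].
Proof. by move=> ab; split; lra. Qed.

Variables (a0 b0 c0 d0 : R) (P : R -> R -> R -> R -> Prop).
Hypotheses (ab0 : a0 <= b0) (cd0 : c0 <= d0).

Hypothesis Psplit : forall a b c d, a0 <= a -> a <= b -> b <= b0 ->
  c0 <= c -> c <= d -> d <= d0 ->
  P a ((a + b) / 2) c ((c + d) / 2) -> P ((a + b) / 2) b c ((c + d) / 2) ->
  P a ((a + b) / 2) ((c + d) / 2) d -> P ((a + b) / 2) b ((c + d) / 2) d ->
  P a b c d.

Hypothesis Ploc : forall p q, a0 <= p <= b0 -> c0 <= q <= d0 ->
  exists2 e : R, 0 < e & forall a b c d, a0 <= a -> a <= p <= b -> b <= b0 ->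
  c0 <= c -> c <= q <= d -> d <= d0 -> b - a < e -> d - c < e -> P a b c d.

(** If [P] failed, some quarter of every bad rectangle would be bad again; the nested bad rectangles
    shrink to a point [(p, q)], where [Ploc] contradicts their badness. Serves both for Goursat's
    estimate and for lifting a homotopy over the unit square. *)
Lemma rect_ind : P a0 b0 c0 d0.
Proof.
apply: contrapT => nP.
pose lo (x : R * R) := (x.1, (x.1 + x.2) / 2).
pose hi (x : R * R) := ((x.1 + x.2) / 2, x.2).
pose Q (s : (R * R) * (R * R)) := P s.1.1 s.1.2 s.2.1 s.2.2.
(* The first quarter on which [P] fails is chosen. The last one is taken without a test: by [Psplit]
   it is bad as soon as the other three are good. *)
pose next (s : (R * R) * (R * R)) :=
  if pselect (Q (lo s.1, lo s.2)) is right _ then (lo s.1, lo s.2) else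
  if pselect (Q (hi s.1, lo s.2)) is right _ then (hi s.1, lo s.2) else
  if pselect (Q (lo s.1, hi s.2)) is right _ then (lo s.1, hi s.2) else
  (hi s.1, hi s.2).
pose seq n := iter n next ((a0, b0), (c0, d0)).
have nextE s : [\/ (next s).1 = lo s.1 | (next s).1 = hi s.1] /\
               [\/ (next s).2 = lo s.2 | (next s).2 = hi s.2].
  rewrite /next; do 3 (case: pselect => _; last by split; first [by left | by right]).
  by split; right.
have inv n : [/\ a0 <= (seq n).1.1, (seq n).1.1 <= (seq n).1.2, (seq n).1.2 <= b0
  & (seq n).1.2 - (seq n).1.1 = (b0 - a0) / 2 ^+ n] /\
  [/\ c0 <= (seq n).2.1, (seq n).2.1 <= (seq n).2.2, (seq n).2.2 <= d0
  & (seq n).2.2 - (seq n).2.1 = (d0 - c0) / 2 ^+ n].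
  elim: n => [|n [[h1 h2 h3 h4] [k1 k2 k3 k4]]].
    by split; split => //=; rewrite expr0 divr1.
  rewrite /seq iterS -/(seq n) exprS invfM !(mulrCA _ 2^-1) -h4 -k4.
  have [m1 m2 m3 m4] := half_bounds h2; have [n1 n2 n3 n4] := half_bounds k2.
  by have [[]-> []->] := nextE (seq n); rewrite /lo /hi /=; split; split;
    rewrite ?(le_trans h1 m1) ?(le_trans m2 h3) ?(le_trans k1 n1) ?(le_trans n2 k3).
have nQ n : ~ Q (seq n).
  elim: n => [//|n IH]; rewrite /seq iterS -/(seq n).
  have [[h1 h2 h3 _] [k1 k2 k3 _]] := inv n.
  rewrite /next.
  case: pselect => A1 //; case: pselect => A2 //; case: pselect => A3 // A4.
  exact/IH/(Psplit h1 h2 h3 k1 k2 k3 A1 A2 A3 A4).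
have [|n|p hp] := @nested_intervals (fun n => (seq n).1.1) (fun n => (seq n).1.2).
- move=> n; have [[_ h _ _] _] := inv n; rewrite /seq iterS -/(seq n).
  by have [[]-> _] := nextE (seq n); rewrite /lo /hi /=; split; lra.
- by have [[]] := inv n.
have [|n|q hq] := @nested_intervals (fun n => (seq n).2.1) (fun n => (seq n).2.2).
- move=> n; have [_ [_ h _ _]] := inv n; rewrite /seq iterS -/(seq n).
  by have [_ []->] := nextE (seq n); rewrite /lo /hi /=; split; lra.
- by have [_ []] := inv n.
have [e e0 he] := Ploc (hp 0%N) (hq 0%N).
have [n hn] := half_pow_lt (Num.max (b0 - a0) (d0 - c0)) e0.
have [[h1 h2 h3 h4] [k1 k2 k3 k4]] := inv n.
have i0 : 0 <= (2 ^+ n)^-1 :> R by rewrite invr_ge0 exprn_ge0.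
apply: (nQ n); apply: he => //.
  by apply: le_lt_trans hn; rewrite h4 ler_wpM2r // le_max lexx.
by apply: le_lt_trans hn; rewrite k4 ler_wpM2r // le_max lexx orbT.
Qed.

End RectangleInduction.

(** * Contour integrals over rectangles and Goursat's lemma *)

Section Goursat.
Variable R : realType.
Local Notation C := (Cplx R).

Definition pt (p q : R) : C := (p +i* q)%C.

Lemma ptB p q p' q' : pt p q - pt p' q' = pt (p - p') (q - q').
Proof. by []. Qed.

Lemma ptE p q : pt p q = (p%:C)%C + 'i%C * (q%:C)%C.
Proof. exact: complexE. Qed.

Lemma nr_pt p q : nr (pt p q) <= `|p| + `|q|.
Proof. exact: nr_Complex. Qed.

Lemma nr_pt_ge p q : Num.max `|p| `|q| <= nr (pt p q).
Proof.
by rewrite ge_max (nr_Re (pt p q)) (nr_Im (pt p q)).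
Qed.

Definition onb (a b c d p q : R) : Prop :=
  (a <= p <= b /\ (q = c \/ q = d)) \/ (c <= q <= d /\ (p = a \/ p = b)).

(** Only boundary points are constrained, because the integrand may be singular inside. *)
Definition bcont (a b c d : R) (f : C -> C) :=
  forall p q, onb a b c d p q -> {for pt p q, continuous f}.

(** The counterclockwise integral of [f(z) dz]: bottom minus top, plus ['i] times right minus
    left. *)
Definition rectint (a b c d : R) (f : C -> C) : C :=
  segint a b (fun t => f (pt t c)) - segint a b (fun t => f (pt t d)) +
  'i%C * (segint c d (fun t => f (pt b t)) - segint c d (fun t => f (pt a t))).

Lemma hcont a b q (f : C -> C) :
  (forall p, a <= p <= b -> {for pt p q, continuous f}) ->
  cont_on a b (fun t => f (pt t q)).
Proof.
move=> cf x /cf/continuous_nrCP h e /h[d d0 hd].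
exists d => // y _ yx; apply: hd; rewrite ptB subrr.
by apply: le_lt_trans (nr_pt _ _) _; rewrite normr0 addr0.
Qed.

Lemma vcont c d p (f : C -> C) :
  (forall q, c <= q <= d -> {for pt p q, continuous f}) ->
  cont_on c d (fun t => f (pt p t)).
Proof.
move=> cf x /cf/continuous_nrCP h e /h[r r0 hr].
exists r => // y _ yx; apply: hr; rewrite ptB subrr.
by apply: le_lt_trans (nr_pt _ _) _; rewrite normr0 add0r.
Qed.

Lemma bcontP a b c d f : bcont a b c d f ->
  [/\ cont_on a b (fun t => f (pt t c)), cont_on a b (fun t => f (pt t d)),
      cont_on c d (fun t => f (pt a t)) & cont_on c d (fun t => f (pt b t))].
Proof.
move=> cf; split; (apply: hcont || apply: vcont) => r hr; apply: cf.
- by left; split => //; left.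
- by left; split => //; right.
- by right; split => //; left.
- by right; split => //; right.
Qed.

Lemma eq_rectint a b c d f g : a <= b -> c <= d ->
  (forall p q, onb a b c d p q -> f (pt p q) = g (pt p q)) ->
  rectint a b c d f = rectint a b c d g.
Proof.
move=> ab cd fg; rewrite /rectint; congr (_ - _ + _ * (_ - _)); apply: eq_segint => x hx;
  apply: fg.
- by left; split => //; left.
- by left; split => //; right.
- by right; split => //; right.
- by right; split => //; left.
Qed.

Lemma rectintB a b c d f g : bcont a b c d f -> bcont a b c d g ->
  rectint a b c d (fun z => f z - g z) = rectint a b c d f - rectint a b c d g.
Proof.
move=> /bcontP[? ? ? ?] /bcontP[? ? ? ?].
by rewrite /rectint !segintB //; ring.
Qed.

Lemma rectintZ a b c d k f : bcont a b c d f ->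
  rectint a b c d (fun z => k * f z) = k * rectint a b c d f.
Proof.
move=> /bcontP[? ? ? ?].
by rewrite /rectint !segintZ //; ring.
Qed.

(** On opposite sides an affine function differs by a constant, and the two constants cancel. Hence
    the first-order expansion of a function can be subtracted without changing its integral. *)
Lemma rectint_affine a b c d (k l : C) : a <= b -> c <= d ->
  rectint a b c d (fun z => k + l * z) = 0.
Proof.
move=> ab cd.
have cf z : {for z, continuous (fun z : C => k + l * z)}.
  by apply: differentiable_continuous; apply: differentiableD => //;
     apply: differentiableM.
have ch q : cont_on a b (fun t => k + l * pt t q).
  by apply: (@hcont a b q (fun z => k + l * z)) => p _; exact: cf.
have cv p : cont_on c d (fun t => k + l * pt p t).
  by apply: (@vcont c d p (fun z => k + l * z)) => q _; exact: cf.
rewrite /rectint -!segintB //.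
rewrite (@eq_segint _ a b _ (fun=> l * 'i%C * ((c - d)%:C)%C)); last first.
  by move=> x _; rewrite !ptE rmorphB /=; ring.
rewrite (@eq_segint _ c d _ (fun=> l * ((b - a)%:C)%C)); last first.
  by move=> x _; rewrite !ptE rmorphB /=; ring.
by rewrite !segint_cst // !rmorphB /=; ring.
Qed.

Lemma nr_rectint a b c d f M : a <= b -> c <= d -> bcont a b c d f ->
  (forall p q, onb a b c d p q -> nr (f (pt p q)) <= M) ->
  nr (rectint a b c d f) <= 4 * M * ((b - a) + (d - c)).
Proof.
move=> ab cd /bcontP[c1 c2 c3 c4] fM; rewrite /rectint.
apply: le_trans (nrD _ _) _; rewrite nrM nr_i mul1r.
apply: le_trans (lerD (nrB _ _) (nrB _ _)) _.
have A1 : nr (segint a b (fun t => f (pt t c))) <= 2 * M * (b - a).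
  by apply: nr_segint => // x hx; apply: fM; left; split => //; left.
have A2 : nr (segint a b (fun t => f (pt t d))) <= 2 * M * (b - a).
  by apply: nr_segint => // x hx; apply: fM; left; split => //; right.
have A3 : nr (segint c d (fun t => f (pt b t))) <= 2 * M * (d - c).
  by apply: nr_segint => // x hx; apply: fM; right; split => //; right.
have A4 : nr (segint c d (fun t => f (pt a t))) <= 2 * M * (d - c).
  by apply: nr_segint => // x hx; apply: fM; right; split => //; left.
lra.
Qed.

Lemma rectint_hsplit a e b c d f : a <= e <= b ->
  (forall p, a <= p <= b -> {for pt p c, continuous f}) ->
  (forall p, a <= p <= b -> {for pt p d, continuous f}) ->
  rectint a b c d f = rectint a e c d f + rectint e b c d f.
Proof.
move=> aeb cc cd; rewrite /rectint (segint_split aeb (hcont cc)) (segint_split aeb (hcont cd)).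
ring.
Qed.

Lemma rectint_vsplit a b c e d f : c <= e <= d ->
  (forall q, c <= q <= d -> {for pt a q, continuous f}) ->
  (forall q, c <= q <= d -> {for pt b q, continuous f}) ->
  rectint a b c d f = rectint a b c e f + rectint a b e d f.
Proof.
move=> ced ca cb; rewrite /rectint (segint_split ced (vcont ca)) (segint_split ced (vcont cb)).
ring.
Qed.

Lemma onb_in a b c d p q : a <= b -> c <= d -> onb a b c d p q ->
  a <= p <= b /\ c <= q <= d.
Proof. by move=> ab cd [[-> [->|->]]|[-> [->|->]]]; rewrite lexx ?ab ?cd. Qed.

(** The quantity [(b - a) ^+ 2 + (d - c) ^+ 2] is divided by four under bisection, so a bound
    proportional to it passes from the four quarters to the rectangle. Near a point the bound holds
    because [f] differs from its first-order expansion by a small multiple of the distance. *)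
Lemma goursat a b c d f : a <= b -> c <= d ->
  (forall p q, a <= p <= b -> c <= q <= d -> differentiable f (pt p q)) ->
  rectint a b c d f = 0.
Proof.
move=> ab cd df.
have cf p q : a <= p <= b -> c <= q <= d -> {for pt p q, continuous f}.
  by move=> ? ?; apply: differentiable_continuous; apply: df.
suff h (e : R) : 0 < e -> nr (rectint a b c d f) <= e * ((b - a) ^+ 2 + (d - c) ^+ 2).
  apply/eqP; rewrite -nr_eq0 eq_le nr_ge0 andbT; apply/ler_addgt0Pl => e e0.
  rewrite addr0; set S := (b - a) ^+ 2 + (d - c) ^+ 2.
  have S0 : 0 <= S by rewrite addr_ge0 ?sqr_ge0.
  apply: le_trans (h (e / (S + 1)) _) _; first by rewrite divr_gt0 //; lra.
  by rewrite -/S mulrAC ler_pdivrMr ?ler_wpM2l ?(ltW e0) //; lra.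
move=> e0.
apply: (@rect_ind _ a b c d (fun a b c d =>
  nr (rectint a b c d f) <= e * ((b - a) ^+ 2 + (d - c) ^+ 2))) => //.
- move=> a' b' c' d' aa ab' bb cc cd' dd.
  have [g1 g2 _ _] := half_bounds ab'; set g := (a' + b') / 2 in g1 g2 *.
  have [h1 h2 _ _] := half_bounds cd'; set h := (c' + d') / 2 in h1 h2 *.
  move=> i1 i2 i3 i4.
  have cf' p q : a' <= p <= b' -> c' <= q <= d' -> {for pt p q, continuous f}.
    move=> /andP[? ?] /andP[? ?]; apply: cf; apply/andP; split.
    - by rewrite (le_trans aa).
    - by rewrite (le_trans _ bb).
    - by rewrite (le_trans cc).
    - by rewrite (le_trans _ dd).
  have gg : a' <= g <= b' by rewrite g1.
  rewrite (@rectint_hsplit a' g); last 3 first.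
  + by rewrite g1.
  + by move=> p hp; apply: cf'; rewrite // ?lexx ?ab' ?cd'.
  + by move=> p hp; apply: cf'; rewrite // ?lexx ?ab' ?cd'.
  rewrite (@rectint_vsplit a' g c' h); last 3 first.
  + by rewrite h1.
  + by move=> p hp; apply: cf'; rewrite // ?lexx ?ab' ?cd'.
  + by move=> p hp; apply: cf'; rewrite // ?lexx ?ab' ?cd'.
  rewrite (@rectint_vsplit g b' c' h); last 3 first.
  + by rewrite h1.
  + by move=> p hp; apply: cf'; rewrite // ?lexx ?ab' ?cd'.
  + by move=> p hp; apply: cf'; rewrite // ?lexx ?ab' ?cd'.
  apply: le_trans (nrD _ _) _.
  apply: le_trans (lerD (nrD _ _) (nrD _ _)) _.
  apply: le_trans (lerD (lerD i1 i3) (lerD i2 i4)) _.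
  rewrite le_eqVlt; apply/orP; left; apply/eqP; rewrite /g /h; by field.
- move=> p q hp hq.
  have [k hk] := differentiable_nrC (df _ _ hp hq).
  (* With width [w] and height [h] the integral is at most [4 * (e / 8 * (w + h)) * (w + h)], and
     [(w + h) ^+ 2 <= 2 * (w ^+ 2 + h ^+ 2)]. *)
  have [|r r0 hr] := hk (e / 8); first by rewrite divr_gt0.
  exists (r / 2) => [|a' b' c' d' a1 /andP[a2 a3] a4 c1 /andP[c2 c3] c4 b1 d1].
    by rewrite divr_gt0.
  have ab' : a' <= b' by lra.
  have cd' : c' <= d' by lra.
  have bf : bcont a' b' c' d' f.
    move=> s t /(onb_in ab' cd')[/andP[s1 s2] /andP[t1 t2]].
    by apply: cf; apply/andP; split; rewrite ?(le_trans a1) ?(le_trans c1) ?(le_trans s2) ?(le_trans t2).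
  pose L := fun z : C => (f (pt p q) - k * pt p q) + k * z.
  have bL : bcont a' b' c' d' L.
    move=> s t _; apply: differentiable_continuous.
    by apply: differentiableD => //; apply: differentiableM.
  have -> : rectint a' b' c' d' f = rectint a' b' c' d' (fun z => f z - L z).
    by rewrite rectintB // rectint_affine // subr0.
  have w0 : 0 <= b' - a' by lra.
  have h0 : 0 <= d' - c' by lra.
  have bfL : bcont a' b' c' d' (fun z => f z - L z).
    by move=> s t st; apply: continuousB; [apply: bf|apply: bL].
  apply: le_trans (@nr_rectint _ _ _ _ _ (e / 8 * ((b' - a') + (d' - c'))) ab' cd' bfL _) _.
    move=> s t st.
    have [s1 s2] : `|s - p| <= b' - a' /\ `|t - q| <= d' - c'.
      by have [? ?] := onb_in ab' cd' st; rewrite !ler_norml; split; lra.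
    have nst : nr (pt s t - pt p q) <= (b' - a') + (d' - c').
      by rewrite ptB; apply: le_trans (nr_pt _ _) _; apply: lerD.
    have /hr : nr (pt s t - pt p q) < r by lra.
    rewrite [pt p q + _]addrC subrK => hst.
    have -> : f (pt s t) - L (pt s t) = f (pt s t) - f (pt p q) - k * (pt s t - pt p q).
      by rewrite /L; ring.
    by apply: le_trans hst _; rewrite ler_pM2l ?divr_gt0.
  have := sqr_ge0 ((b' - a') - (d' - c')); move: w0 h0.
  set w := b' - a'; set h := d' - c' => w0 h0 sq.
  have : (w + h) ^+ 2 <= 2 * (w ^+ 2 + h ^+ 2).
    rewrite -subr_ge0; apply: le_trans sq _; rewrite le_eqVlt; apply/orP; left.
    by apply/eqP; ring.
  move=> /(ler_wpM2l (ltW e0)); lra.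
Qed.

End Goursat.

(** * Goursat's lemma with one exceptional point *)

Section Punctured.
Variable R : realType.
Local Notation C := (Cplx R).

(** The frame between the rectangles is cut into a left and a right strip of full height and a
    bottom and a top strip over the inner base; Goursat's lemma applies to each of the four. *)
Lemma rectint_frame a a' b' b c c' d' d (f : C -> C) :
  a <= a' -> a' <= b' -> b' <= b -> c <= c' -> c' <= d' -> d' <= d ->
  (forall p q, a <= p <= b -> c <= q <= d -> ~~ ((a' < p < b') && (c' < q < d')) ->
    differentiable f (pt p q)) ->
  rectint a b c d f = rectint a' b' c' d' f.
Proof.
move=> a1 a2 a3 c1 c2 c3 df.
have a4 := le_trans a1 a2; have a5 := le_trans a2 a3.
have c4 := le_trans c1 c2; have c5 := le_trans c2 c3.
have dl p q : a <= p <= a' -> c <= q <= d -> differentiable f (pt p q).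
  move=> /andP[p1 p2] hq; apply: df; rewrite ?p1 ?(le_trans p2) //.
  by rewrite [a' < p]ltNge p2.
have dr p q : b' <= p <= b -> c <= q <= d -> differentiable f (pt p q).
  move=> /andP[p1 p2] hq; apply: df; rewrite ?p2 ?andbT ?(le_trans a4) //.
  by rewrite [p < b']ltNge p1 andbF.
have db p q : a' <= p <= b' -> c <= q <= c' -> differentiable f (pt p q).
  move=> /andP[p1 p2] /andP[q1 q2]; apply: df.
  - by rewrite (le_trans a1) //= (le_trans p2).
  - by rewrite q1 (le_trans q2).
  by rewrite [c' < q]ltNge q2 andbF.
have dt p q : a' <= p <= b' -> d' <= q <= d -> differentiable f (pt p q).
  move=> /andP[p1 p2] /andP[q1 q2]; apply: df.
  - by rewrite (le_trans a1) //= (le_trans p2).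
  - by rewrite q2 (le_trans c4).
  by rewrite [q < d']ltNge q1 !andbF.
have cd : c <= d := le_trans c4 c3.
have dh p q : a <= p <= b -> q = c \/ q = d -> {for pt p q, continuous f}.
  move=> hp hq; apply: differentiable_continuous; apply: df => //.
    by case: hq => ->; rewrite lexx cd.
  by case: hq => ->; rewrite negb_and [in X in _ || X]negb_and -!leNgt ?c1 ?c3 ?orbT.
rewrite (@rectint_hsplit _ a a' b c d f); last 3 first.
- by rewrite a1 (le_trans a2).
- by move=> p hp; apply: dh => //; left.
- by move=> p hp; apply: dh => //; right.
rewrite (@goursat _ a a' c d f a1 cd dl) add0r.
rewrite (@rectint_hsplit _ a' b' b c d f); last 3 first.
- by rewrite a2.
- by move=> p /andP[p1 p2]; apply: dh; [rewrite p2 (le_trans a1)|left].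
- by move=> p /andP[p1 p2]; apply: dh; [rewrite p2 (le_trans a1)|right].
rewrite (@goursat _ b' b c d f a3 cd dr) addr0.
have cv q : c <= q <= d -> {for pt a' q, continuous f} /\ {for pt b' q, continuous f}.
  by move=> hq; split; apply: differentiable_continuous; [apply: dl|apply: dr];
     rewrite ?lexx ?a1 ?a3.
rewrite (@rectint_vsplit _ a' b' c c' d f); last 3 first.
- by rewrite c1.
- by move=> q /cv[].
- by move=> q /cv[].
rewrite (@goursat _ a' b' c c' f a2 c1 db) add0r.
rewrite (@rectint_vsplit _ a' b' c' d' d f); last 3 first.
- by rewrite c2.
- by move=> q /andP[q1 q2]; case: (cv q) => //; rewrite q2 (le_trans c1).
- by move=> q /andP[q1 q2]; case: (cv q) => //; rewrite q2 (le_trans c1).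
by rewrite (@goursat _ a' b' d' d f a2 c3 dt) addr0.
Qed.

Definition bounded_near (f : C -> C) (z : C) : Prop :=
  exists M : R, exists2 r : R, 0 < r &
    forall w : C, w != z -> nr (w - z) < r -> nr (f w) <= M.

(** The integral equals the one over a square of half-side [e] around the exceptional point, whose
    perimeter is proportional to [e] while [f] stays bounded. *)
Lemma goursat_punctured a b c d p0 q0 (f : C -> C) :
  a < p0 < b -> c < q0 < d -> bounded_near f (pt p0 q0) ->
  (forall p q, a <= p <= b -> c <= q <= d -> pt p q != pt p0 q0 ->
    differentiable f (pt p q)) ->
  rectint a b c d f = 0.
Proof.
move=> /andP[ap pb] /andP[cq qd] [M [r r0 hM]] df.
(* The small square must fit inside the rectangle, and its boundary, within [2 * e] of the centre,
   inside the ball of radius [r]; hence [r / 3]. *)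
pose D := Num.min (Num.min (p0 - a) (b - p0)) (Num.min (Num.min (q0 - c) (d - q0)) (r / 3)).
have D0 : 0 < D by rewrite !lt_min !subr_gt0 ap pb cq qd divr_gt0.
suff h (e : R) : 0 < e -> e <= D -> nr (rectint a b c d f) <= e * (16 * `|M|).
  apply/eqP; rewrite -nr_eq0 eq_le nr_ge0 andbT; apply/ler_addgt0Pl => e e0.
  rewrite addr0.
  have M1 : 0 < 16 * `|M| + 1 by rewrite ltr_pwDr // mulr_ge0.
  apply: le_trans (h (Num.min D (e / (16 * `|M| + 1))) _ _) _.
  - by rewrite lt_min D0 divr_gt0.
  - by rewrite ge_min lexx.
  apply: (@le_trans _ _ (e / (16 * `|M| + 1) * (16 * `|M|))).
    by rewrite ler_wpM2r ?mulr_ge0 // ge_min lexx orbT.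
  by rewrite mulrAC ler_pdivrMr // ler_wpM2l ?(ltW e0) // lerDl.
move=> e0; rewrite !le_min => /andP[/andP[e1 e2] /andP[/andP[e3 e4] e5]].
have E1 : a <= p0 - e by lra.
have E2 : p0 - e <= p0 + e by lra.
have E3 : p0 + e <= b by lra.
have E4 : c <= q0 - e by lra.
have E5 : q0 - e <= q0 + e by lra.
have E6 : q0 + e <= d by lra.
have ne p q : ~~ ((p0 - e < p < p0 + e) && (q0 - e < q < q0 + e)) -> pt p q != pt p0 q0.
  by apply: contra => /eqP[-> ->]; rewrite !ltrBlDr !ltrDl e0.
rewrite (@rectint_frame a (p0 - e) (p0 + e) b c (q0 - e) (q0 + e) d) //; last first.
  by move=> p q hp hq /ne; apply: df.
have onb_ne p q : onb (p0 - e) (p0 + e) (q0 - e) (q0 + e) p q -> pt p q != pt p0 q0.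
  by move=> h; apply: ne; case: h => [[_ [->|->]]|[_ [->|->]]]; rewrite !ltxx ?andbF.
have onb_in p q : onb (p0 - e) (p0 + e) (q0 - e) (q0 + e) p q ->
    `|p - p0| <= e /\ `|q - q0| <= e.
  rewrite /onb -!ler_distl.
  have ee : `|e| = e by rewrite gtr0_norm.
  have E x : `|x - e - x| <= e by rewrite addrAC subrr add0r normrN ee.
  have E' x : `|x + e - x| <= e by rewrite addrAC subrr add0r ee.
  by case=> [[? [->|->]]|[? [->|->]]].
have bc : bcont (p0 - e) (p0 + e) (q0 - e) (q0 + e) f.
  move=> p q h; have [] := onb_in _ _ h; rewrite !ler_distl => /andP[h1 h2] /andP[h3 h4].
  apply: differentiable_continuous; apply: df; last exact: onb_ne.
    by rewrite (le_trans E1) //= (le_trans h2).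
  by rewrite (le_trans E4) //= (le_trans h4).
apply: le_trans (@nr_rectint _ _ _ _ _ _ `|M| E2 E5 bc _) _.
  move=> p q h; apply: le_trans (ler_norm M); apply: hM; first exact: onb_ne.
  have [h1 h2] := onb_in _ _ h.
  by rewrite ptB; apply: le_lt_trans (nr_pt _ _) _; lra.
rewrite le_eqVlt; apply/orP; left; apply/eqP; ring.
Qed.

End Punctured.

(** * Cauchy's formula and removable singularities *)

Section CauchySquare.
Variable R : realType.
Local Notation C := (Cplx R).

Definition sqint (r : R) (f : C -> C) : C := rectint (- r) r (- r) r f.

Definition sqb (r : R) (z : C) : Prop :=
  onb (- r) r (- r) r (complex.Re z) (complex.Im z).

Lemma ptK (z : C) : pt (complex.Re z) (complex.Im z) = z.
Proof. by case: z. Qed.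

Lemma sqb_ge r (z : C) : 0 <= r -> sqb r z -> r <= nr z.
Proof.
move=> r0; rewrite -[in nr z](ptK z) => h; apply: le_trans (nr_pt_ge _ _).
by case: h => [[_ [->|->]]|[_ [->|->]]]; rewrite ?normrN (ger0_norm r0) le_max lexx ?orbT.
Qed.

Lemma sqb_le r (z : C) : 0 <= r -> sqb r z -> nr z <= 2 * r.
Proof.
move=> r0; rewrite -[in nr z](ptK z) => h; apply: le_trans (nr_pt _ _) _.
rewrite mulr2n mulrDl mul1r; move: h; rewrite /sqb /onb -!ler_norml.
by case=> [[h [->|->]]|[h [->|->]]]; rewrite ?normrN (ger0_norm r0) lerD.
Qed.

Lemma bcont_sqb r (f : C -> C) :
  (forall z, sqb r z -> {for z, continuous f}) -> bcont (- r) r (- r) r f.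
Proof. by move=> h p q pq; apply: h. Qed.

Lemma nr_sqint r (f : C -> C) M : 0 <= r -> (forall z, sqb r z -> {for z, continuous f}) ->
  (forall z, sqb r z -> nr (f z) <= M) -> nr (sqint r f) <= 16 * M * r.
Proof.
move=> r0 cf fM.
have rr : - r <= r by lra.
apply: le_trans (nr_rectint rr rr (bcont_sqb cf) (M := M) _) _.
  by move=> p q pq; apply: fM.
rewrite le_eqVlt; apply/orP; left; apply/eqP; ring.
Qed.

Lemma eq_sqint r f g : 0 <= r -> (forall z, sqb r z -> f z = g z) -> sqint r f = sqint r g.
Proof. by move=> r0 fg; apply: eq_rectint; try lra; move=> p q pq; apply: fg. Qed.

Lemma sqintB r (f g : C -> C) : (forall z, sqb r z -> {for z, continuous f}) ->
  (forall z, sqb r z -> {for z, continuous g}) ->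
  sqint r (fun z => f z - g z) = sqint r f - sqint r g.
Proof. by move=> /bcont_sqb cf /bcont_sqb cg; exact: rectintB. Qed.

Lemma sqintZ r (k : C) (f : C -> C) : (forall z, sqb r z -> {for z, continuous f}) ->
  sqint r (fun z => k * f z) = k * sqint r f.
Proof. by move=> /bcont_sqb cf; exact: rectintZ. Qed.

Lemma differentiable_subC (a : C) z : differentiable (fun w : C => w - a) z.
Proof. by apply: differentiableB. Qed.

Lemma differentiable_invsub (a : C) z : z != a ->
  differentiable (fun w : C => (w - a)^-1) z.
Proof.
by move=> za; apply: differentiableV; rewrite ?subr_eq0 //; exact: differentiable_subC.
Qed.

Lemma sqb_neq r (a z : C) : 0 < r -> nr a < r -> sqb r z -> z != a.
Proof.
move=> r0 ar /(sqb_ge (ltW r0)) h; apply/eqP => E; subst z.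
by have := le_lt_trans h ar; rewrite ltxx.
Qed.

Lemma in_square r (a : C) : nr a < r ->
  - r < complex.Re a < r /\ - r < complex.Im a < r.
Proof.
move=> ar; rewrite -!ltr_norml; split; apply: le_lt_trans ar.
  exact: nr_Re.
exact: nr_Im.
Qed.

Lemma in_square_nr (r p q : R) : - r <= p <= r -> - r <= q <= r -> nr (pt p q) <= 2 * r.
Proof.
by rewrite -!ler_norml => *; apply: le_trans (nr_pt _ _) _; lra.
Qed.

Lemma segint_lower (a b : R) (u : R -> C) (k : R) : a <= b -> cont_on a b u ->
  (forall x, a <= x <= b -> k <= complex.Re (u x)) ->
  k * (b - a) <= complex.Re (segint a b u).
Proof.
move=> ab cu h.
have -> : k * (b - a) = (\int[@lebesgue_measure R]_(x in `[a, b]) k)%R.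
  rewrite Rintegral_cst //= lebesgue_measure_itv /= lte_fin.
  by case: ltP => //= h'; have -> : b = a by [lra]; rewrite subrr mulr0.
apply: le_Rintegral => //.
- apply: continuous_compact_integrable; first exact: segment_compact.
  by move=> ?; apply: cvg_cst.
exact: (cont_on_integrable (@Re_lip R) cu).
Qed.

(** For [nr a < r] this is the constant 2 pi i of Cauchy's formula, left unevaluated. *)
Definition cauchyc (r : R) (a : C) := sqint r (fun z => (z - a)^-1).

(** Opposite sides combine to real multiples of [1 / (t ^+ 2 + r ^+ 2)], and the whole integral is
    ['i * 4 * r] times the integral of that function. As the integrand is at least
    [1 / (2 * r ^+ 2)] on an interval of length [2 * r], the modulus is at least [4]. *)
Lemma nr_cauchyc0 r : 0 < r -> 4 <= nr (cauchyc r 0).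
Proof.
move=> r0; rewrite /cauchyc /sqint /rectint.
have rr : - r <= r by lra.
have cf p q : onb (- r) r (- r) r p q -> {for pt p q, continuous (fun z : C => (z - 0)^-1)}.
  move=> h; apply: differentiable_continuous; apply: differentiable_invsub.
  by apply: (@sqb_neq r) => //; rewrite nr0.
have [c1 c2 c3 c4] := bcontP cf.
rewrite -!segintB //.
have den t : t ^+ 2 + r ^+ 2 != 0 :> R.
  by rewrite gt_eqF // ltr_wpDl ?sqr_ge0 // exprn_gt0.
pose u (t : R) : C := (((t ^+ 2 + r ^+ 2)^-1)%:C)%C.
have invpt p q : p ^+ 2 + q ^+ 2 != 0 ->
    (pt p q - 0)^-1 = pt (p / (p ^+ 2 + q ^+ 2)) (- q / (p ^+ 2 + q ^+ 2)).
  by move=> pq; rewrite subr0 mulNr.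
have cu : cont_on (- r) r u.
  (* Up to a factor, [u] is the difference of the integrands on the two vertical sides, from which
     it inherits continuity. *)
  have c5 x : - r <= x <= r -> u x = ((2 * r)^-1%:C)%C * ((pt r x - 0)^-1 - (pt (- r) x - 0)^-1).
    move=> _; rewrite !invpt ?sqrrN ?[r ^+ 2 + _]addrC ?den //.
    rewrite ptB -[RHS]/(_ * _)%C /u.
    apply/eqP; rewrite eq_complex /=; apply/andP; split; apply/eqP; field; rewrite ?den ?(gt_eqF r0) //.
  move=> x hx e e0.
  have [d d0 hd] := c4 _ hx _ (mulr_gt0 e0 r0).
  have [d' d0' hd'] := c3 _ hx _ (mulr_gt0 e0 r0).
  exists (Num.min d d'); first by rewrite lt_min d0.
  move=> y hy; rewrite lt_min => /andP[/(hd _ hy) A1 /(hd' _ hy) A2].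
  rewrite !c5 // -mulrBr nrM nr_real ger0_norm ?invr_ge0 ?mulr_ge0 ?(ltW r0) //.
  rewrite mulrC ltr_pdivrMr ?mulr_gt0 //.
  rewrite (_ : _ - _ = ((pt r y - 0)^-1 - (pt r x - 0)^-1) - ((pt (- r) y - 0)^-1 - (pt (- r) x - 0)^-1)); last by ring.
  by apply: le_lt_trans (nrB _ _) _; lra.
rewrite (@eq_segint _ _ _ _ (fun t => ('i%C * ((2 * r)%:C)%C) * u t)); last first.
  move=> x _; rewrite !invpt ?sqrrN ?den // ptB.
  by apply/eqP; rewrite eq_complex /=; apply/andP; split; apply/eqP; field; rewrite ?den.
rewrite (@eq_segint _ _ _ (fun x => _ - (pt (- r) x - 0)^-1) (fun t => ((2 * r)%:C)%C * u t)); last first.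
  move=> x _; rewrite !invpt ?sqrrN ?[r ^+ 2 + _]addrC ?den // ptB.
  by apply/eqP; rewrite eq_complex /=; apply/andP; split; apply/eqP; field; rewrite ?den.
rewrite !segintZ //.
rewrite (_ : _ + _ = 'i%C * (((4 * r)%:C)%C * segint (- r) r u)); last first.
  have -> : ((4 * r)%:C)%C = ((2 * r)%:C)%C + ((2 * r)%:C)%C :> C.
    by rewrite -rmorphD; congr (_%:C)%C; ring.
  ring.
rewrite nrM nr_i mul1r nrM nr_real ger0_norm; last by lra.
have : (2 * r ^+ 2)^-1 * (r - - r) <= complex.Re (segint (- r) r u).
  apply: segint_lower => // x hx /=.
  rewrite lef_pV2 ?posrE ?mulr_gt0 ?exprn_gt0 //.
    have : `|x| <= r by rewrite ler_norml.
    move=> /(@lerXn2r _ 2 `|x| r) ; rewrite !nnegrE normr_ge0 (ltW r0) real_normK ?num_real //.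
    move=> /(_ isT isT); lra.
  by rewrite lt_neqAle eq_sym den addr_ge0 ?sqr_ge0.
have -> : (2 * r ^+ 2)^-1 * (r - - r) = r^-1 by field; rewrite gt_eqF.
move=> h; have : r^-1 <= nr (segint (- r) r u).
  by apply: le_trans h (le_trans (ler_norm _) (nr_Re _)).
move=> /(ler_wpM2l (ltW r0)); rewrite divff ?gt_eqF //; lra.
Qed.

End CauchySquare.

(** * Cauchy's formula on squares, Taylor estimates and removable singularities *)

Section CauchyFormula.
Variable R : realType.
Local Notation C := (Cplx R).

Lemma continuousZC (V : normedModType C) (f : V -> C) (k : C) (x : V) :
  {for x, continuous f} -> {for x, continuous (fun z => k * f z)}.
Proof.
move=> cf; apply: (@continuousM C V (cst k) f x _ cf).
exact: cst_continuous.
Qed.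

Lemma nr_le0 (z : C) (K : R) :
  (forall e : R, 0 < e -> nr z <= e * K) -> z = 0.
Proof.
move=> h; apply/eqP; rewrite -nr_eq0 eq_le nr_ge0 andbT; apply/ler_addgt0Pl => e e0.
rewrite addr0.
have K1 : 0 < `|K| + 1 by rewrite ltr_pwDr.
apply: le_trans (h (e / (`|K| + 1)) _) _; first by rewrite divr_gt0.
rewrite mulrAC ler_pdivrMr // ler_wpM2l ?(ltW e0) //.
by apply: le_trans (ler_norm K) _; rewrite lerDl.
Qed.

Lemma sqint_frame r s (f : C -> C) : 0 < r -> r <= s ->
  (forall z, r <= nr z -> differentiable f z) -> sqint s f = sqint r f.
Proof.
move=> r0 rs df; apply: rectint_frame; try lra.
move=> p q _ _ h; apply: df; apply: le_trans (nr_pt_ge _ _).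
rewrite le_max; move: h; apply: contraR.
by rewrite negb_or -!ltNge !ltr_norml => /andP[-> ->].
Qed.

(** The difference of the two kernels is [a / (z * (z - a))], which decays quadratically while the
    side of a square grows linearly. Its integral does not depend on the size of the square, hence
    vanishes. *)
Lemma cauchyc_const r (a : C) : 0 < r -> nr a < r -> cauchyc r a = cauchyc r 0.
Proof.
move=> r0 ar; apply/eqP; rewrite -subr_eq0; apply/eqP.
have a0 := nr_ge0 a.
have ne (z : C) s : s <= nr z -> nr a < s -> z != a.
  by move=> h1 h2; apply/eqP => E; subst z; have := lt_le_trans h2 h1; rewrite ltxx.
have ne0 (z : C) s : 0 < s -> s <= nr z -> z != 0.
  by move=> h1 h2; rewrite -nr_eq0 gt_eqF // (lt_le_trans h1).
have dinv s z : 0 < s -> nr a < s -> s <= nr z ->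
   differentiable (fun z : C => (z - a)^-1) z /\ differentiable (fun z : C => (z - 0)^-1) z.
  move=> s0 as_ sz; split; apply: differentiable_invsub; first exact: ne sz as_.
  exact: ne0 sz.
pose k (z : C) := (z - a)^-1 - (z - 0)^-1.
have cinv s z : 0 < s -> nr a < s -> s <= nr z ->
   {for z, continuous (fun z : C => (z - a)^-1)} /\ {for z, continuous (fun z : C => (z - 0)^-1)}.
  by move=> s0 as_ /(dinv s z s0 as_)[? ?]; split; apply: differentiable_continuous.
have Ek s : 0 < s -> nr a < s -> sqint s k = cauchyc s a - cauchyc s 0.
  move=> s0 as_.
  apply: (@sqintB R s (fun z => (z - a)^-1) (fun z => (z - 0)^-1)) => z hz.
    exact: (proj1 (cinv s z s0 as_ (sqb_ge (ltW s0) hz))).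
  exact: (proj2 (cinv s z s0 as_ (sqb_ge (ltW s0) hz))).
rewrite -Ek //.
apply: (@nr_le0 _ (32 * nr a)) => e e0.
(* [2 * r] ensures [nr (z - a) >= s / 2] on the boundary; [e^-1] turns the bound
   [s^-1 * (32 * nr a)] into one with factor [e]. *)
pose s := Num.max (2 * r) e^-1.
have s1 : 2 * r <= s by rewrite le_max lexx.
have s2 : e^-1 <= s by rewrite le_max lexx orbT.
have s0 : 0 < s by lra.
rewrite -(@sqint_frame r s k r0); first 1 last.
- lra.
- by move=> z rz; have [k1 k2] := dinv r z r0 ar rz; exact: (differentiableB k1 k2).
apply: le_trans (@nr_sqint _ s k (nr a * (2 / s ^+ 2)) (ltW s0) _ _) _.
- move=> z /(sqb_ge (ltW s0)) sz; have as_ : nr a < s by lra.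
  have [k1 k2] := cinv s z s0 as_ sz; exact: (continuousB k1 k2).
- move=> z /(sqb_ge (ltW s0)) sz.
  have za : z != a by apply: ne sz _; lra.
  have z0 : z != 0 by apply: ne0 sz.
  have -> : k z = a / (z * (z - a)).
    by rewrite /k subr0; field; rewrite subr_eq0 za z0.
  rewrite nrM nrV nrM ler_wpM2l //.
  have h1 : s / 2 <= nr (z - a).
    have := nr_tri a z 0; rewrite !subr0 => h2; lra.
  rewrite -[2 / _]invrK invf_div lef_pV2 ?posrE ?mulr_gt0 ?divr_gt0 ?exprn_gt0 ?nr_gt0 ?subr_eq0 //.
  by rewrite expr2 -mulrA ler_pM ?divr_ge0 ?(ltW s0).
have -> : 16 * (nr a * (2 / s ^+ 2)) * s = s^-1 * (32 * nr a).
  by field; rewrite gt_eqF.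
apply: ler_wpM2r; first by rewrite mulr_ge0.
by rewrite -[e]invrK lef_pV2 ?posrE ?invr_gt0.
Qed.

Lemma cauchyc_neq0 (r : R) : 0 < r -> cauchyc r 0 != 0.
Proof. by move=> /nr_cauchyc0 h; rewrite -nr_gt0; apply: lt_le_trans h. Qed.

Lemma quotient_bounded_near (f : C -> C) (a : C) : differentiable f a ->
  bounded_near (fun z => (f z - f a) / (z - a)) a.
Proof.
move=> /differentiable_nrC[d hd]; have [r r0 hr] := hd 1 ltr01.
exists (nr d + 1), r => // w wa /hr; rewrite mul1r [a + _]addrC subrK => h.
have wa0 : 0 < nr (w - a) by rewrite nr_gt0 subr_eq0.
rewrite nrM nrV ler_pdivrMr // mulrDl mul1r -nrM.
rewrite -[f w - f a](subrK (d * (w - a))) addrC.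
by apply: le_trans (nrD _ _) _; rewrite lerD2l.
Qed.

Lemma sqint_quotient r (h : C -> C) (a : C) : 0 < r -> nr a < r ->
  (forall z, sqb r z -> {for z, continuous h}) ->
  sqint r (fun z => (h z - h a) / (z - a)) = 0 ->
  h a = (cauchyc r 0)^-1 * sqint r (fun z => h z / (z - a)).
Proof.
move=> r0 ar ch E.
have ci z : sqb r z -> {for z, continuous (fun w : C => (w - a)^-1)}.
  by move=> /(sqb_neq r0 ar) za; apply: differentiable_continuous; apply: differentiable_invsub.
apply: (mulfI (cauchyc_neq0 r0)); rewrite mulVKf ?cauchyc_neq0 //.
rewrite -(cauchyc_const r0 ar) mulrC /cauchyc -sqintZ; last exact: ci.
apply/esym/eqP; rewrite -subr_eq0 -sqintB.
- by apply/eqP; rewrite -[RHS]E; apply: eq_sqint; [exact: ltW | move=> z _; rewrite mulrBl].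
- by move=> z hz; apply: continuousM; [exact: ch | exact: ci].
by move=> z hz; apply: continuousZC; exact: ci.
Qed.

Lemma differentiable_quotient (f : C -> C) (c a z : C) : z != a ->
  differentiable f z -> differentiable (fun z => (f z - c) / (z - a)) z.
Proof.
move=> za df; apply: differentiableM; last exact: differentiable_invsub.
by apply: differentiableB.
Qed.

Lemma sqb_square r (z : C) : 0 < r -> sqb r z -> nr z <= 2 * r /\ r <= nr z.
Proof. by move=> r0 h; split; [apply: sqb_le (ltW r0) h | apply: sqb_ge (ltW r0) h]. Qed.

(** The difference quotient of [h] at [a] is bounded near [a], so the punctured form of Goursat's
    lemma makes its integral vanish. The square of half-side [r] lies in the disc of radius
    [2 * r]. *)
Lemma cauchy_formula r (h : C -> C) (a : C) : 0 < r -> nr a < r ->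
  (forall z, nr z <= 2 * r -> differentiable h z) ->
  h a = (cauchyc r 0)^-1 * sqint r (fun z => h z / (z - a)).
Proof.
move=> r0 ar dh.
apply: sqint_quotient => //.
  by move=> z /(sqb_square r0)[z1 z2]; apply: differentiable_continuous; apply: dh.
have [i1 i2] := in_square ar.
apply: (goursat_punctured i1 i2).
  by rewrite ptK; apply: quotient_bounded_near; apply: dh => //; lra.
move=> p q hp hq; rewrite !ptK => na; apply: differentiable_quotient => //.
by apply: dh => //; apply: in_square_nr.
Qed.

(* [z ^+ 2 * h z] is differentiable at [0], so Cauchy's formula applies to it. *)
Lemma cauchy_formula_punctured r (h : C -> C) (a : C) : 0 < r -> nr a < r -> a != 0 ->
  bounded_near h 0 ->
  (forall z, nr z <= 2 * r -> z != 0 -> differentiable h z) ->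
  h a = (cauchyc r 0)^-1 * sqint r (fun z => h z / (z - a)).
Proof.
move=> r0 ar a0 [M [s s0 hM]] dh.
have z0 : nr (0 : C) < r by rewrite nr0.
have ne z : sqb r z -> z != 0 := sqb_neq r0 z0.
have dhb z : sqb r z -> differentiable h z.
  by move=> hz; apply: dh (ne z hz); case: (sqb_square r0 hz).
pose k z := z * z * h z.
have did z : differentiable (fun z : C => z) z := differentiable_idC z.
have dk z : nr z <= 2 * r -> differentiable k z.
  move=> zr; have [->|nz] := eqVneq z 0; last first.
    by apply: differentiableM (dh z zr nz); apply: differentiableM; exact: did.
  apply: (@differentiable_C _ _ _ 0) => e e0.
  have M1 : 0 < `|M| + 1 by rewrite ltr_pwDr.
  exists (Num.min s (e / (`|M| + 1))); first by rewrite lt_min s0 divr_gt0.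
  move=> t; rewrite lt_min ltr_pdivlMr // => /andP[ts te].
  rewrite add0r mul0r subr0 /k !mul0r subr0 !nrM.
  have [->|t0] := eqVneq t 0; first by rewrite nr0 !mul0r mulr0.
  rewrite -mulrA mulrC ler_wpM2r ?nr_ge0 //.
  apply: le_trans (ltW te); apply: ler_wpM2l; first exact: nr_ge0.
  apply: (@le_trans _ _ M); first by apply: hM => //; rewrite subr0.
  by apply: le_trans (ler_norm M) _; rewrite lerDl.
have dI z : sqb r z -> differentiable (fun w => h w / (w - a)) z.
  move=> hz; apply: differentiableM (dhb z hz) _; apply: differentiable_invsub.
  exact: sqb_neq hz.
have dN z : nr z <= 2 * r -> z != 0 -> differentiable (fun w => - (w + a) * h w) z.
  move=> zr nz; apply: differentiableM (dh z zr nz); apply: differentiableN.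
  by apply: differentiableD; [exact: did | exact: differentiable_cst].
(* Since [z ^+ 2 = a ^+ 2 + (z - a) * (z + a)], Cauchy's formula for [k] differs from [a ^+ 2] times
   the one for [h] by this integral, whose integrand is bounded near [0]. *)
have S0 : sqint r (fun w => - (w + a) * h w) = 0.
  have [j1 j2] := in_square z0.
  apply: (goursat_punctured j1 j2); rewrite ptK.
    exists ((s + nr a) * M), s => // w w0 ws; rewrite nrM nrN.
    have Mw := hM w w0 ws; rewrite subr0 in ws.
    apply: ler_pM; rewrite ?nr_ge0 //.
    by apply: le_trans (nrD _ _) _; rewrite lerD2r ltW.
  by move=> p q hp hq nz; apply: dN => //; exact: in_square_nr.
have := cauchy_formula r0 ar dk; rewrite /k.
rewrite (@eq_sqint _ r _ (fun z => a * a * (h z / (z - a)) - - (z + a) * h z) (ltW r0)); last first.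
  move=> z hz; field; rewrite subr_eq0; exact: sqb_neq hz.
rewrite sqintB; first 1 last.
- by move=> z hz; apply: continuousZC; apply: differentiable_continuous; exact: dI.
- move=> z hz; apply: differentiable_continuous; apply: dN; last exact: ne.
  by case: (sqb_square r0 hz).
rewrite S0 subr0 sqintZ; last first.
  by move=> z hz; apply: differentiable_continuous; exact: dI.
by rewrite mulrCA; apply: mulfI; rewrite mulf_neq0.
Qed.

(* Second-order Taylor expansion of the Cauchy kernel at [a]. *)
Lemma cauchy_kernel_taylor r (h : C -> C) (a : C) M (k : R) : 0 < r -> 0 < k ->
  (forall z, sqb r z -> {for z, continuous h}) ->
  (forall z, sqb r z -> nr (h z) <= M) ->
  (forall z, sqb r z -> 2 * k <= nr (z - a)) ->
  forall t : C, nr t <= k ->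
  nr (sqint r (fun z => h z / (z - (a + t))) - sqint r (fun z => h z / (z - a))
      - t * sqint r (fun z => h z / (z - a) ^+ 2)) <= 16 * (M * (nr t ^+ 2 / (4 * k ^+ 3))) * r.
Proof.
move=> r0 k0 ch hM ka t tk.
have za z : sqb r z -> z - a != 0.
  by move=> /ka h1; rewrite -nr_gt0; lra.
have zt z : sqb r z -> k <= nr (z - (a + t)).
  move=> /ka h1; have := nr_tri (a + t) z a; rewrite [a + t - a]addrAC subrr add0r; lra.
have zt0 z : sqb r z -> z - (a + t) != 0.
  by move=> /zt h1; rewrite -nr_gt0; lra.
have cI b z : z - b != 0 -> {for z, continuous (fun w : C => (w - b)^-1)}.
  by move=> zb; apply: differentiable_continuous; apply: differentiable_invsub; rewrite -subr_eq0.
have c1 z : sqb r z -> {for z, continuous (fun z => h z / (z - (a + t)))}.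
  by move=> hz; apply: continuousM; [exact: ch|apply: cI; exact: zt0].
have c2 z : sqb r z -> {for z, continuous (fun z => h z / (z - a))}.
  by move=> hz; apply: continuousM; [exact: ch|apply: cI; exact: za].
have c3 z : sqb r z -> {for z, continuous (fun z => h z / (z - a) ^+ 2)}.
  move=> hz; apply: continuousM; first exact: ch.
  apply: differentiable_continuous; apply: differentiableV; last by rewrite expf_neq0 ?za.
  have h2 : differentiable (fun w : C => (w - a) * (w - a)) z.
    by apply: differentiableM; exact: differentiable_subC.
  exact: h2.
have c4 z : sqb r z -> {for z, continuous (fun z => t * (h z / (z - a) ^+ 2))}.
  by move=> hz; apply: continuousZC; exact: c3.
have c12 z : sqb r z -> {for z, continuous (fun z => h z / (z - (a + t)) - h z / (z - a))}.
  by move=> hz; apply: continuousB; [exact: c1|exact: c2].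
rewrite -sqintZ; last exact: c3.
rewrite -sqintB; [|exact: c1|exact: c2].
rewrite -sqintB; [|exact: c12|exact: c4].
apply: nr_sqint; first exact: ltW.
  by move=> z hz; apply: continuousB; [exact: c12|exact: c4].
move=> z hz.
(* The exact remainder of the expansion; on the boundary its denominator is at least
   [k * (2 * k) ^+ 2 = 4 * k ^+ 3]. *)
rewrite (_ : _ - _ = h z * (t ^+ 2 / ((z - (a + t)) * (z - a) ^+ 2))); last first.
  by field; rewrite za //=; have := zt0 z hz; rewrite opprD addrA.
rewrite nrM; apply: ler_pM; rewrite ?nr_ge0 ?hM //.
rewrite nrM nrX nrV nrM nrX ler_wpM2l ?exprn_ge0 ?nr_ge0 //.
have q1 := ka z hz; have q2 := zt z hz.
rewrite lef_pV2 ?posrE; last 2 first.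
- by rewrite mulr_gt0 ?exprn_gt0 //; lra.
- by rewrite mulr_gt0 ?exprn_gt0.
rewrite (_ : 4 * k ^+ 3 = k * (2 * k) ^+ 2); last by ring.
by apply: ler_pM => //; rewrite ?exprn_ge0 ?(ltW k0) ?ler_pXn2r ?nnegrE ?mulr_ge0 ?nr_ge0 ?(ltW k0).
Qed.

(** Only the values of [h] on the boundary enter, so the Cauchy integral is holomorphic inside even
    if [h] is singular there; this produces the extension at a removable singularity. *)
Lemma differentiable_cauchy r (h : C -> C) (a : C) M : 0 < r -> nr a < r ->
  (forall z, sqb r z -> {for z, continuous h}) ->
  (forall z, sqb r z -> nr (h z) <= M) ->
  differentiable (fun a => (cauchyc r 0)^-1 * sqint r (fun z => h z / (z - a))) a.
Proof.
move=> r0 ar ch hM.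
pose k := (r - nr a) / 2.
have k0 : 0 < k by rewrite divr_gt0 ?subr_gt0.
have ka z : sqb r z -> 2 * k <= nr (z - a).
  move=> /(sqb_ge (ltW r0)) rz; rewrite /k mulrC divfK //.
  have := nr_tri a z 0; rewrite !subr0; lra.
apply: differentiableM; first exact: differentiable_cst.
apply: (@differentiable_C _ _ _ (sqint r (fun z => h z / (z - a) ^+ 2))) => e e0.
pose K := 16 * (`|M| / (4 * k ^+ 3)) * r + 1.
have K0 : 0 < K.
  have h1 : 0 <= `|M| / (4 * k ^+ 3).
    by rewrite divr_ge0 // mulr_ge0 // exprn_ge0 // ltW.
  by rewrite /K; apply: ltr_wpDl => //; rewrite mulr_ge0 ?(ltW r0) // mulr_ge0.
exists (Num.min k (e / K)); first by rewrite lt_min k0 divr_gt0.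
move=> t; rewrite lt_min => /andP[tk te].
rewrite [X in _ - X]mulrC.
have hM' z : sqb r z -> nr (h z) <= `|M|.
  by move=> /hM h1; apply: le_trans h1 (ler_norm _).
apply: le_trans (cauchy_kernel_taylor r0 k0 ch hM' ka (ltW tk)) _.
have -> : 16 * (`|M| * (nr t ^+ 2 / (4 * k ^+ 3))) * r = (K - 1) * nr t * nr t.
  by rewrite /K; field; rewrite gt_eqF.
rewrite ler_wpM2r ?nr_ge0 //; move: te; rewrite ltr_pdivlMr //.
have := nr_ge0 t; nra.
Qed.

(** The missing value is that of the Cauchy integral [H] at [0]; elsewhere near [0] the punctured
    Cauchy formula shows that [H] agrees with [h]. *)
Theorem removable_singularity (h : C -> C) (s M : R) :
  (forall z, z != 0 -> nr z < s -> differentiable h z) ->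
  (forall z, z != 0 -> nr z < s -> nr (h z) <= M) ->
  exists v, forall z, nr z < s -> differentiable (fun w => if w == 0 then v else h w) z.
Proof.
move=> dh hM; have [s0|s0] := ltP 0 s; last first.
  by exists 0 => z zs; have := lt_le_trans zs s0; rewrite ltNge nr_ge0.
pose r := s / 4.
have r0 : 0 < r by rewrite divr_gt0.
have rs : 2 * r < s by rewrite /r; lra.
have bh : bounded_near h 0.
  by exists M, s => // w w0; rewrite subr0; exact: hM.
pose H a := (cauchyc r 0)^-1 * sqint r (fun z => h z / (z - a)).
have sqz z : sqb r z -> z != 0 /\ nr z < s.
  move=> /(sqb_square r0)[z1 z2]; split; last by lra.
  by rewrite -nr_gt0; lra.
exists (H 0) => z zs; have [->|z0] := eqVneq z 0; last first.
  apply: (@differentiable_nearC _ h _ _ (nr z)); [by rewrite nr_gt0| |exact: dh].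
  move=> y yz; case: eqP => // y0; move: yz; rewrite y0 sub0r nrN.
  by rewrite ltxx.
apply: (@differentiable_nearC _ H _ _ r r0).
  move=> y; rewrite subr0 => yr; case: eqVneq => [->//|y0].
  rewrite /H -(cauchy_formula_punctured r0 yr y0 bh) // => w wr w0.
  by apply: dh; [exact: w0 | apply: le_lt_trans wr _].
apply: (@differentiable_cauchy _ _ _ M r0); first by rewrite nr0.
  by move=> w /sqz[? ?]; apply: differentiable_continuous; apply: dh.
by move=> w /sqz[? ?]; apply: hM.
Qed.

(** The kernels at [t] and [0] differ by [t / (z * (z - t))]. In the constant, [8 = 16 * 2 / 4]:
    [16] from the integral bound, [2] from [nr (z - t) >= r / 2], and [4] from the bound on
    [cauchyc]. *)
Lemma holo_lipschitz (g : C -> C) (r M : R) (t : C) : 0 < r -> nr t <= r / 2 ->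
  (forall z, nr z <= 2 * r -> differentiable g z) ->
  (forall z, nr z <= 2 * r -> nr (g z) <= M) ->
  nr (g t - g 0) <= 8 * M / r * nr t.
Proof.
move=> r0 tr dg gM.
have tr' : nr t < r by lra.
have z0 : nr (0 : C) < r by rewrite nr0.
have cg z : sqb r z -> {for z, continuous g}.
  by move=> /(sqb_square r0)[z1 _]; apply: differentiable_continuous; apply: dg.
have cI b z : nr b < r -> sqb r z -> {for z, continuous (fun w : C => (w - b)^-1)}.
  by move=> br /(sqb_neq r0 br) zb; apply: differentiable_continuous; apply: differentiable_invsub.
have cgI b z : nr b < r -> sqb r z -> {for z, continuous (fun w : C => g w / (w - b))}.
  by move=> br hz; apply: continuousM; [exact: cg|exact: cI].
rewrite (cauchy_formula r0 tr' dg) (cauchy_formula r0 z0 dg) -mulrBr nrM nrV.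
rewrite -sqintB; [|by move=> z; apply: cgI..].
have c4 := nr_cauchyc0 r0.
rewrite mulrC ler_pdivrMr; last by apply: lt_le_trans c4.
apply: le_trans (@nr_sqint _ r _ (M * (nr t * (2 / r ^+ 2))) (ltW r0) _ _) _.
- by move=> z hz; apply: continuousB; apply: cgI.
- move=> z hz; have [z1 z2] := sqb_square r0 hz.
  have q1 := sqb_neq r0 tr' hz; have q2 := sqb_neq r0 z0 hz.
  rewrite (_ : _ - _ = g z * (t / (z * (z - t)))); last first.
    by rewrite subr0; field; rewrite subr_eq0 q1 q2.
  rewrite nrM; apply: ler_pM; rewrite ?nr_ge0 ?gM //.
  rewrite nrM nrV nrM ler_wpM2l ?nr_ge0 //.
  have h1 : r / 2 <= nr (z - t).
    have := nr_tri t z 0; rewrite !subr0 => h2; lra.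
  rewrite -[2 / _]invrK invf_div lef_pV2 ?posrE ?mulr_gt0 ?divr_gt0 ?exprn_gt0 ?nr_gt0 ?subr_eq0 //.
  by rewrite expr2 -mulrA ler_pM ?divr_ge0 ?(ltW r0).
have M0 : 0 <= M by apply: le_trans (gM 0 _); rewrite ?nr_ge0 // nr0; lra.
rewrite (_ : 16 * _ * r = 8 * M / r * nr t * 4); last by field; rewrite gt_eqF.
by rewrite ler_wpM2l // !mulr_ge0 ?invr_ge0 ?nr_ge0 ?(ltW r0).
Qed.

(** The Taylor estimate of the kernel at [0] proves the inequality for the derivative [D] given by
    Cauchy's integral. Any [d] with the first-order property equals [D], by comparison at small real
    arguments; leaving [d] free lets it come from a derivative in several variables. *)
Lemma holo_quadratic (g : C -> C) (r M : R) (d t : C) : 0 < r -> nr t <= r / 2 ->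
  (forall z, nr z <= 2 * r -> differentiable g z) ->
  (forall z, nr z <= 2 * r -> nr (g z) <= M) ->
  (forall e : R, 0 < e -> exists2 s : R, 0 < s &
    forall h : C, nr h < s -> nr (g h - g 0 - d * h) <= e * nr h) ->
  nr (g t - g 0 - d * t) <= 8 * M / r ^+ 2 * nr t ^+ 2.
Proof.
move=> r0 tr dg gM hd.
have z0 : nr (0 : C) < r by rewrite nr0.
have cg z : sqb r z -> {for z, continuous g}.
  by move=> /(sqb_square r0)[z1 _]; apply: differentiable_continuous; apply: dg.
have gM' z : sqb r z -> nr (g z) <= M by move=> /(sqb_square r0)[z1 _]; exact: gM.
have k0 : 0 < r / 2 by rewrite divr_gt0.
have ka z : sqb r z -> 2 * (r / 2) <= nr (z - 0).
  by move=> /(sqb_square r0)[_ z2]; rewrite subr0; lra.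
have M0 : 0 <= M by apply: le_trans (gM 0 _); rewrite ?nr_ge0 // nr0; lra.
pose D := (cauchyc r 0)^-1 * sqint r (fun z => g z / (z - 0) ^+ 2).
have c4 := nr_cauchyc0 r0.
have key (u : C) : nr u <= r / 2 -> nr (g u - g 0 - D * u) <= 8 * M / r ^+ 2 * nr u ^+ 2.
  move=> ur.
  have ur' : nr u < r by lra.
  have := cauchy_kernel_taylor r0 k0 cg gM' ka ur; rewrite add0r.
  rewrite {1}(cauchy_formula r0 ur' dg) {1}(cauchy_formula r0 z0 dg) /D.
  set S1 := sqint r _; set S2 := sqint r _; set S3 := sqint r _; set ci := cauchyc r 0 => hh.
  rewrite (_ : _ - _ - _ = ci^-1 * (S1 - S2 - u * S3)); last by ring.
  rewrite nrM nrV.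
  rewrite mulrC ler_pdivrMr; last by apply: lt_le_trans c4.
  apply: le_trans hh _.
  rewrite (_ : 16 * _ * r = 8 * M / r ^+ 2 * nr u ^+ 2 * 4); last by field; rewrite gt_eqF.
  by rewrite ler_wpM2l // !mulr_ge0 ?invr_ge0 ?exprn_ge0 ?nr_ge0 ?(ltW r0).
suff -> : d = D by exact: key.
apply/eqP; rewrite -subr_eq0; apply/eqP; apply: (@nr_le0 _ (1 + 8 * M / r ^+ 2)) => e e0.
have [s s0 hs] := hd e e0.
pose u := Num.min e (Num.min (s / 2) (r / 2)).
have u0 : 0 < u by rewrite !lt_min e0 !divr_gt0.
have ue : u <= e by rewrite ge_min lexx.
have us : u < s.
  by apply: (@le_lt_trans _ _ (s / 2)); [rewrite !ge_min lexx ?orbT | lra].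
have ur : u <= r / 2 by rewrite !ge_min lexx ?orbT.
have nu : nr ((u%:C)%C : C) = u by rewrite nr_real gtr0_norm.
have k1 := hs (u%:C)%C; have k2 := key (u%:C)%C; rewrite nu in k1 k2.
move/(_ us): k1 => k1; move/(_ ur): k2 => k2.
have : nr ((d - D) * (u%:C)%C) <= e * u + 8 * M / r ^+ 2 * u ^+ 2.
  rewrite (_ : _ * _ = (g (u%:C)%C - g 0 - D * (u%:C)%C) - (g (u%:C)%C - g 0 - d * (u%:C)%C)); last by ring.
  by apply: le_trans (nrB _ _) _; rewrite addrC; apply: lerD.
rewrite nrM nu expr2 mulrA -mulrDl ler_pM2r // => h; apply: le_trans h _.
rewrite mulrDr mulr1 lerD2l mulrC; apply: ler_wpM2r => //.
by rewrite divr_ge0 ?mulr_ge0 ?(ltW r0).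
Qed.

End CauchyFormula.

(** * Isolated zeros *)

Section IsolatedZeros.
Variable R : realType.
Local Notation C := (Cplx R).

(** Considers the supremum of the [t] with [P] on [[0, t]]. Used for the identity principle along
    segments and for uniqueness of lifts. *)
Lemma real_induction (P : R -> Prop) : P 0 ->
  (forall t, 0 <= t <= 1 -> P t -> exists2 e : R, 0 < e & forall u, `|u - t| < e -> P u) ->
  (forall t, 0 < t <= 1 -> (forall u, 0 <= u < t -> P u) -> P t) -> P 1.
Proof.
move=> P0 Po Pc.
pose E := [set t : R | 0 <= t <= 1 /\ forall u, 0 <= u <= t -> P u].
have E0 : E 0.
  split; first by rewrite lexx ler01.
  by move=> u h; have -> : u = 0 by [apply/eqP; rewrite eq_le andbC].
have hs : has_sup E by split; [exists 0 | exists 1 => t [/andP[]]].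
pose T := sup E.
have T0 : 0 <= T by apply: ub_le_sup E0; case: hs.
have T1 : T <= 1 by apply: sup_le_ub; [case: hs | move=> t [/andP[]]].
have PT u : 0 <= u < T -> P u.
  move=> /andP[u0 uT]; have [|t [t01 Pt] tu] := sup_adherent (eps := T - u) _ hs.
    by rewrite subr_gt0.
  apply: Pt; rewrite u0 /=; apply: ltW; move: tu; rewrite -/T opprB addrCA subrr addr0 //.
have PTT : P T.
  have [T00|T00] := ltP 0 T; first by apply: Pc => //; rewrite T00.
  by have -> : T = 0 by apply/eqP; rewrite eq_le T00.
have [|e e0 he] := Po T _ PTT; first by rewrite T0.
have [T2|T2] := ltP T 1; last by have <- : T = 1 by apply/eqP; rewrite eq_le T1.
have : E (Num.min 1 (T + e / 2)).
  split; first by rewrite ge_min lexx le_min ler01 addr_ge0 // divr_ge0 // ltW.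
  move=> u /andP[u0]; rewrite le_min => /andP[u1 uT].
  have [/(conj u0)/andP uT'|uT'] := ltP u T; first exact: PT.
  by apply: he; rewrite ger0_norm ?subr_ge0 //; lra.
move=> /(ub_le_sup (proj2 hs)); rewrite -/T ge_min => /orP[|]; first by rewrite leNgt T2.
lra.
Qed.

Lemma differentiable_shift (f : C -> C) (a z : C) : differentiable f (a + z) ->
  differentiable (fun w => f (a + w)) z.
Proof.
move=> df; apply: (@differentiable_comp _ _ _ _ (fun w => a + w) f); last exact: df.
by apply: differentiableD; [exact: differentiable_cst | exact: differentiable_idC].
Qed.

Lemma differentiable_bounded (f : C -> C) (z : C) : differentiable f z ->
  exists M, exists2 r : R, 0 < r & forall w : C, nr (w - z) < r -> nr (f w) <= M.
Proof.
move=> /differentiable_continuous /continuous_nrCP /(_ 1 ltr01)[d d0 hd].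
exists (nr (f z) + 1), d => // w /hd h.
by rewrite -[f w](subrK (f z)) addrC; apply: le_trans (nrD _ _) _; rewrite lerD2l ltW.
Qed.

Lemma removable_bounded_near (h : C -> C) (s : R) :
  (forall z, z != 0 -> nr z < s -> differentiable h z) -> bounded_near h 0 ->
  exists v, forall z, nr z < s -> differentiable (fun w => if w == 0 then v else h w) z.
Proof.
move=> dh [M [r r0 hM]].
have [|z z0|v hv] := @removable_singularity _ h (Num.min s r) M.
- by move=> z z0; rewrite lt_min => /andP[? _]; apply: dh.
- by rewrite lt_min => /andP[_ zr]; apply: hM; rewrite ?subr0.
exists v => z zs; have [z0|z0] := eqVneq z 0.
  have [s0|s0] := ltP 0 s; last first.
    by have := lt_le_trans zs s0; rewrite ltNge nr_ge0.
  by apply: hv; rewrite z0 nr0 lt_min s0.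
apply: (@differentiable_nearC _ h _ _ (nr z)); [by rewrite nr_gt0| |exact: dh].
move=> y yz; case: eqP => // y0; move: yz; rewrite y0 sub0r nrN.
by rewrite ltxx.
Qed.

(** A maximum principle with constant [8]. That the constant does not depend on [g] is what counts:
    it is applied to all quotients of [f] by powers of [z]. *)
Lemma cauchy_bound r (g : C -> C) (K : R) (t : C) : 0 < r -> nr t <= r / 2 ->
  (forall z, nr z <= 2 * r -> differentiable g z) ->
  (forall z, sqb r z -> nr (g z) <= K) -> nr (g t) <= 8 * K.
Proof.
move=> r0 tr dg gK.
have tr' : nr t < r by lra.
have cg z : sqb r z -> {for z, continuous g}.
  by move=> /(sqb_square r0)[z1 _]; apply: differentiable_continuous; apply: dg.
have K0 : 0 <= K.
  apply: le_trans (gK (pt r r) _); first exact: nr_ge0.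
  by left; split; [rewrite /= lexx andbT; lra | right].
rewrite (cauchy_formula r0 tr' dg) nrM nrV mulrC.
have c4 := nr_cauchyc0 r0.
rewrite ler_pdivrMr; last by apply: lt_le_trans c4.
apply: le_trans (@nr_sqint _ r _ (K * (2 / r)) (ltW r0) _ _) _.
- move=> z hz; apply: continuousM; first exact: cg.
  apply: differentiable_continuous; apply: differentiable_invsub; exact: sqb_neq hz.
- move=> z hz; have [z1 z2] := sqb_square r0 hz.
  rewrite nrM nrV; apply: ler_pM; rewrite ?invr_ge0 ?nr_ge0 ?gK //.
  have h1 : r / 2 <= nr (z - t) by have := nr_tri t z 0; rewrite !subr0; lra.
  rewrite -[2 / _]invrK invf_div lef_pV2 ?posrE ?divr_gt0 //.
  by apply: lt_le_trans h1; rewrite divr_gt0.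
rewrite (_ : 16 * _ * r = 8 * K * 4); last by field; rewrite gt_eqF.
by rewrite ler_wpM2l // mulr_ge0.
Qed.

(** Zeros accumulating at [0] allow division by [z] arbitrarily often: each quotient has the same
    nonzero zeros, so it vanishes at [0] by continuity. With [f z = z ^+ k * g z], the bound
    [M / r ^+ k] for [g] on the square yields [nr (f t) <= 8 * M / 2 ^+ k] when [nr t < r / 2], for
    every [k]. *)
Lemma zero_infinite_order (f : C -> C) (s : R) : 0 < s ->
  (forall z, nr z < s -> differentiable f z) ->
  (forall e : R, 0 < e -> exists z : C, [/\ z != 0, nr z < e & f z = 0]) ->
  exists2 r : R, 0 < r & forall z : C, nr z < r -> f z = 0.
Proof.
move=> s0 df acc.
have fac k : exists g : C -> C, (forall z, nr z < s -> differentiable g z) /\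
    (forall z, nr z < s -> f z = z ^+ k * g z).
  elim: k => [|k [g [dg fg]]].
    by exists f; split => // z _; rewrite expr0 mul1r.
  have g0 : g 0 = 0.
    apply/eqP; apply: contraT; rewrite -nr_gt0 => gn0.
    have [|d d0 hd] := (iffLR (continuous_nrCP g 0)) _ _ gn0.
      by apply: differentiable_continuous; apply: dg; rewrite nr0.
    have [|z [z0 + fz]] := acc (Num.min d s); first by rewrite lt_min d0.
    rewrite lt_min => /andP[zd zs].
    have /eqP := fz; rewrite fg // mulf_eq0 expf_eq0 (negPf z0) andbF /= => /eqP gz.
    by have := hd z; rewrite subr0 gz sub0r nrN ltxx => /(_ zd).
  have bq := quotient_bounded_near (dg 0 (eq_ind_r (fun x => x < s) s0 (nr0 _))).
  have [|v hv] := @removable_bounded_near (fun z => (g z - g 0) / (z - 0)) s _ bq.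
    by move=> z z0 zs; apply: differentiable_quotient => //; apply: dg.
  exists (fun w => if w == 0 then v else (g w - g 0) / (w - 0)); split; first exact: hv.
  move=> z zs; case: eqVneq => [->|z0]; first by rewrite fg ?nr0 // g0 exprS !(mulr0, mul0r).
  by rewrite fg // g0 !subr0 exprSr; field.
have [M [r1 r10 hM]] := differentiable_bounded (df 0 (eq_ind_r (fun x => x < s) s0 (nr0 _))).
pose r := Num.min s r1 / 4.
have r0 : 0 < r by rewrite divr_gt0 // lt_min s0.
have rs : 2 * r < s.
  have : Num.min s r1 <= s by rewrite ge_min lexx.
  by rewrite /r; lra.
have rr1 : 2 * r < r1.
  have : Num.min s r1 <= r1 by rewrite ge_min lexx orbT.
  by rewrite /r; lra.
exists (r / 2) => [|t tr]; first by rewrite divr_gt0.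
have M0 : 0 <= M by apply: le_trans (hM 0 _); rewrite ?nr_ge0 // subrr nr0.
have bnd k : nr (f t) <= 8 * M / 2 ^+ k.
  have [g [dg fg]] := fac k.
  have gK z : sqb r z -> nr (g z) <= M / r ^+ k.
    move=> /(sqb_square r0)[z1 z2].
    rewrite ler_pdivlMr ?exprn_gt0 //.
    have zs : nr z < s by lra.
    apply: (@le_trans _ _ (nr (f z))); last by apply: hM; rewrite subr0; lra.
    rewrite fg // nrM nrX mulrC ler_wpM2r ?nr_ge0 //.
    by rewrite lerXn2r ?nnegrE ?nr_ge0 // ltW.
  have dg' z : nr z <= 2 * r -> differentiable g z by move=> zr; apply: dg; lra.
  have gt := cauchy_bound r0 (ltW tr) dg' gK.
  rewrite fg; last by lra.
  rewrite nrM nrX.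
  have h1 : nr t ^+ k <= (r / 2) ^+ k.
    by apply: lerXn2r; rewrite ?nnegrE ?nr_ge0 ?(ltW tr) //; lra.
  apply: le_trans (ler_pM _ _ h1 gt) _; rewrite ?exprn_ge0 ?nr_ge0 //.
  rewrite expr_div_n le_eqVlt; apply/orP; left; apply/eqP.
  have p2 : 2 ^+ k != 0 :> R by rewrite expf_neq0.
  have pr : r ^+ k != 0 by rewrite expf_neq0 ?gt_eqF.
  by move: p2 pr; set x := 2 ^+ k; set y := r ^+ k => p2 pr; field; rewrite p2 pr.
apply/eqP; rewrite -nr_eq0 eq_le nr_ge0 andbT leNgt; apply/negP => f0.
by have [k] := half_pow_lt (8 * M) f0; rewrite ltNge bnd.
Qed.

Lemma zero_infinite_order_at (f : C -> C) (a : C) (s : R) : 0 < s ->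
  (forall z, nr (z - a) < s -> differentiable f z) ->
  (forall e : R, 0 < e -> exists z : C, [/\ z != a, nr (z - a) < e & f z = 0]) ->
  exists2 r : R, 0 < r & forall z : C, nr (z - a) < r -> f z = 0.
Proof.
move=> s0 df acc.
have [|z zs|e e0|r r0 hr] := @zero_infinite_order (fun w => f (a + w)) s.
- by [].
- by apply: differentiable_shift; apply: df; rewrite addrAC subrr add0r.
- have [z [z1 z2 z3]] := acc e e0; exists (z - a); split => //.
    by rewrite subr_eq0.
  by rewrite [a + _]addrC subrK.
by exists r => // z /hr; rewrite [a + _]addrC subrK.
Qed.

(** Vanishing near a point is an open condition along the segment. It is also closed: at a limit
    point the earlier points of the segment are accumulating zeros. *)
Lemma identity_segment (f : C -> C) :
  (forall t : R, 0 <= t <= 1 -> exists2 s : R, 0 < s &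
     forall z : C, nr (z - ((t%:C)%C : C)) < s -> differentiable f z) ->
  (exists2 r : R, 0 < r & forall z : C, nr z < r -> f z = 0) -> f 1 = 0.
Proof.
move=> df f0.
pose P t := exists2 r : R, 0 < r & forall z : C, nr (z - ((t%:C)%C : C)) < r -> f z = 0.
suff [r r0 hr] : P 1 by apply: hr; rewrite subrr nr0.
have nrRB (t u : R) : nr ((t%:C)%C - (u%:C)%C : C) = `|t - u|.
  by rewrite -rmorphB nr_real.
apply: real_induction.
- by have [r r0 hr] := f0; exists r => // z; rewrite subr0; exact: hr.
- move=> t _ [r r0 hr]; exists (r / 2) => [|u ut]; first by rewrite divr_gt0.
  exists (r / 2) => [|z zu]; first by rewrite divr_gt0.
  by apply: hr; apply: le_lt_trans (nr_tri ((u%:C)%C : C) _ _) _; rewrite nrRB; lra.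
- move=> t /andP[t0 t1] hu.
  have [|s s0 ds] := df t; first by rewrite (ltW t0).
  apply: (zero_infinite_order_at s0 ds) => e e0.
  pose u := Num.max 0 (t - e / 2).
  have ut : u < t by rewrite gt_max t0; lra.
  have u0 : 0 <= u by rewrite le_max lexx.
  have ue : t - e / 2 <= u by rewrite le_max lexx orbT.
  exists (u%:C)%C; split.
  + by apply/eqP => /complexI E; rewrite E ltxx in ut.
  + by rewrite nrRB ler0_norm ?subr_le0 ?(ltW ut) //; lra.
  + by have [|r r0 hr] := hu u; [rewrite u0 | apply: hr; rewrite subrr nr0].
Qed.

(** Otherwise [phi] vanishes near [a], and the identity principle along the segment from [a] to [0]
    contradicts [phi 0 != 0]. *)
Lemma isolated_zero (phi : C -> C) (s : R) (a : C) :
  (forall z, nr z < s -> differentiable phi z) -> phi 0 != 0 -> nr a < s ->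
  exists2 r : R, 0 < r & forall z : C, z != a -> nr (z - a) < r -> phi z != 0.
Proof.
move=> dphi phi0 as_; apply: contrapT => nh.
have sa0 : 0 < s - nr a by rewrite subr_gt0.
have ball z : nr (z - a) < s - nr a -> nr z < s.
  by move=> h; have := nr_tri a z 0; rewrite !subr0; lra.
have [||r r0 hr] := @zero_infinite_order_at phi a (s - nr a) sa0.
- by move=> z /ball; exact: dphi.
- move=> e e0; apply: contrapT => nz; apply: nh; exists e => // z za ze.
  by apply/eqP => pz; apply: nz; exists z.
suff : phi 0 = 0 by move/eqP; rewrite (negPf phi0).
have := @identity_segment (fun t => phi (a + t * (- a))).
rewrite mul1r subrr; apply.
- move=> t /andP[t0 t1].
  pose K := nr a + 1.
  have K0 : 0 < K by rewrite ltr_wpDl ?nr_ge0.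
  exists ((s - nr a) / K) => [|z]; first by rewrite divr_gt0.
  rewrite ltr_pdivlMr; [|exact: K0] => zt.
  have hz : differentiable phi (a + z * - a).
    apply: dphi.
    rewrite (_ : a + z * - a = ((1 - t)%:C)%C * a - (z - (t%:C)%C) * a); last first.
      by rewrite rmorphB rmorph1 /=; ring.
    apply: le_lt_trans (nrB _ _) _; rewrite !nrM nr_real ger0_norm ?subr_ge0 //.
    have q1 := nr_ge0 a; have q2 := nr_ge0 (z - (t%:C)%C).
    rewrite /K in zt; nra.
  apply: (@differentiable_comp _ _ _ _ (fun w : C => a + w * - a) phi); last exact: hz.
  apply: differentiableD; first exact: differentiable_cst.
  by apply: differentiableM; [exact: differentiable_idC|exact: differentiable_cst].
- exists (r / (nr a + 1)) => [|z]; first by rewrite divr_gt0 // ltr_wpDl ?nr_ge0.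
  rewrite ltr_pdivlMr ?ltr_wpDl ?nr_ge0 // => zr; apply: hr.
  rewrite addrAC subrr add0r nrM nrN; have := nr_ge0 a; have := nr_ge0 z; nra.
Qed.

(** Zeros of [phi] are isolated, so each is a removable singularity of [g]. Keeping the same bound
    [M] is essential for estimates uniform over all complex lines. *)
Lemma holo_extension (phi g : C -> C) (s M : R) :
  (forall z, nr z < s -> differentiable phi z) -> phi 0 != 0 ->
  (forall z, nr z < s -> phi z != 0 -> differentiable g z) ->
  (forall z, nr z < s -> phi z != 0 -> nr (g z) <= M) ->
  exists G : C -> C, [/\ forall z, nr z < s -> differentiable G z,
     forall z, nr z < s -> nr (G z) <= M & forall z, phi z != 0 -> G z = g z].
Proof.
move=> dphi phi0 dg gM.
(* [P a v]: filling in [v] at [a] makes [g] differentiable there. By [Pex] such a value exists at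
   every zero of [phi] in the disc, so the default [0] of [xget] does not occur there. *)
pose P a v := forall z, z = a -> differentiable (fun w => if w == a then v else g w) z.
pose G z := if phi z != 0 then g z else xget 0 [set v | P z v].
have Gg z : phi z != 0 -> G z = g z by rewrite /G => ->.
have Pex a : nr a < s -> phi a = 0 -> exists v, P a v.
  move=> as_ pa; have [r r0 hr] := isolated_zero dphi phi0 as_.
  have sa0 : 0 < s - nr a by rewrite subr_gt0.
  have ball z : nr (z - a) < s - nr a -> nr z < s.
    by move=> h; have := nr_tri a z 0; rewrite !subr0; lra.
  pose q := Num.min r (s - nr a).
  have q0 : 0 < q by rewrite lt_min r0.
  have hq z : z != 0 -> nr z < q -> phi (a + z) != 0 /\ nr (a + z) < s.
    have e1 : a + z - a = z by rewrite addrAC subrr add0r.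
    move=> z0; rewrite lt_min => /andP[zr zs]; split; last by apply: ball; rewrite e1.
    by apply: hr; rewrite ?e1 // -subr_eq0 e1.
  have [||v hv] := @removable_singularity _ (fun w => g (a + w)) q M.
  - by move=> z z0 /(hq z z0)[? ?]; apply: differentiable_shift; apply: dg.
  - by move=> z z0 /(hq z z0)[? ?]; apply: gM.
  exists v => z ->.
  have h0 : differentiable (fun w => if w == 0 then v else g (a + w)) (- a + a).
    by rewrite addNr; apply: hv; rewrite nr0.
  have := differentiable_shift h0.
  apply: (@differentiable_nearC _ _ _ _ 1 ltr01) => y _.
  by rewrite addrC subr_eq0 [a + _]addrC subrK.
have dG z : nr z < s -> differentiable G z.
  move=> zs; have [pz|pz] := eqVneq (phi z) 0; last first.
    have [||d d0 hd] := (iffLR (continuous_nrCP phi z)) _ (nr (phi z)).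
    + exact: differentiable_continuous (dphi z zs).
    + by rewrite nr_gt0.
    apply: (@differentiable_nearC _ g _ _ d d0); last exact: dg.
    move=> y /hd hy; rewrite Gg //; apply/eqP => py; move: hy.
    by rewrite py sub0r nrN ltxx.
  have [r r0 hr] := isolated_zero dphi phi0 zs.
  have [v0 Pv0] := Pex z zs pz.
  have : P z (xget 0 [set v | P z v]) by apply: (xgetPex 0); exists v0.
  move=> /(_ z erefl); apply: (@differentiable_nearC _ _ _ _ r r0) => y yr.
  case: eqVneq => [->|yz]; first by rewrite /G pz eqxx.
  by rewrite Gg // hr.
exists G; split => // z zs.
have [pz|pz] := eqVneq (phi z) 0; last by rewrite Gg //; apply: gM.
have [r r0 hr] := isolated_zero dphi phi0 zs.
(* If [G z] exceeded [M], so would [G] at a nearby point [y] that is not a zero of [phi], where [G]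
   agrees with [g]. *)
rewrite leNgt; apply/negP => GM.
have [||d d0 hd] := (iffLR (continuous_nrCP G z)) _ (nr (G z) - M).
- exact: differentiable_continuous (dG z zs).
- by rewrite subr_gt0.
pose e := Num.min (Num.min r d) (s - nr z).
have e0 : 0 < e by rewrite !lt_min r0 d0 subr_gt0.
have er : e <= r by rewrite !ge_min lexx.
have ed : e <= d by rewrite !ge_min lexx orbT.
have es : e <= s - nr z by rewrite !ge_min lexx !orbT.
pose y := z + ((e / 2)%:C)%C.
have yz : nr (y - z) = e / 2.
  by rewrite /y addrAC subrr add0r nr_real gtr0_norm // divr_gt0.
have yz0 : y != z by rewrite -subr_eq0 -nr_gt0 yz divr_gt0.
have py : phi y != 0 by apply: hr => //; rewrite yz; lra.
have ys : nr y < s by have := nr_tri z y 0; rewrite !subr0 yz; lra.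
have := hd y; rewrite yz => /(_ _)/lt_trans h.
have : nr (G y) <= M by rewrite Gg //; apply: gM.
have := nr_tri (G y) (G z) 0; rewrite !subr0 [nr (G z - _)]nrBC.
have := hd y; rewrite yz; lra.
Qed.

End IsolatedZeros.

(** * Several complex variables *)

Section SeveralVariables.
Variable R : realType.
Local Notation C := (Cplx R).

(** The derivative is kept as an explicit matrix because limits of derivatives are taken
    entrywise. *)
Definition hasd p n (g : 'rV[C]_p -> 'rV[C]_n) (y : 'rV[C]_p) (A : 'M[C]_(p, n)) :=
  forall e : R, 0 < e -> exists2 d : R, 0 < d &
    forall h : 'rV[C]_p, nr h < d -> nr (g (y + h) - g y - h *m A) <= e * nr h.

Lemma differentiable_on_line p (W : normedModType C) (f : 'rV[C]_p -> W)
  (y h : 'rV[C]_p) (z : C) : differentiable f (y + z *: h) ->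
  differentiable (fun w : C => f (y + w *: h)) z.
Proof.
move=> df; apply: (@differentiable_comp _ _ _ _ (fun w : C => y + w *: h) f); last exact: df.
exact: differentiable_line.
Qed.

Lemma differentiable_entry p n (g : 'rV[C]_p -> 'rV[C]_n) j y :
  differentiable g y -> differentiable (fun y => g y 0 j) y.
Proof.
move=> dg; apply: (@differentiable_comp _ _ _ _ g (fun v : 'rV[C]_n => v 0 j)); first exact: dg.
exact: differentiable_coord.
Qed.

(** On the complex line through [y] and [y + h], parametrized so that these points are [0] and [1],
    [g] extends across the zeros of [phi] with the same bound, and the estimates in one variable
    apply. The constants do not involve the distance from [y] to the zeros of [phi]. *)
Lemma ball_estimates p n (x : 'rV[C]_p) (rho M : R) (phi : 'rV[C]_p -> C)
  (g : 'rV[C]_p -> 'rV[C]_n) (y h : 'rV[C]_p) :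
  (forall y : 'rV[C]_p, nr (y - x) < rho -> differentiable phi y) ->
  (forall y : 'rV[C]_p, nr (y - x) < rho -> phi y != 0 -> differentiable g y) ->
  (forall y : 'rV[C]_p, nr (y - x) < rho -> phi y != 0 -> nr (g y) <= M) ->
  nr (y - x) < rho / 4 -> nr h <= rho / 8 -> phi y != 0 -> phi (y + h) != 0 ->
  nr (g (y + h) - g y) <= 32 * M / rho * nr h /\
  forall A, hasd g y A ->
    nr (g (y + h) - g y - h *m A) <= 128 * M / rho ^+ 2 * nr h ^+ 2.
Proof.
move=> dphi dg gM yx hr py pyh.
have rho0 : 0 < rho by have := nr_ge0 (y - x); nlra.
have [->|h0] := eqVneq h 0.
  rewrite addr0 subrr !nr0 mulr0; split => // A _.
  by rewrite mul0mx subrr nr0 expr0n mulr0.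
have nh0 : 0 < nr h by rewrite nr_gt0.
(* Parameters of modulus below [3 * r] move [y] by less than [3 * rho / 4], hence stay in the ball
   around [x]; and [nr h <= rho / 8] gives [1 <= r / 2]. *)
pose r := rho / (4 * nr h).
have r0 : 0 < r by rewrite divr_gt0 // mulr_gt0.
have rh : r * nr h = rho / 4 by rewrite /r; field; rewrite gt_eqF.
have inb (z : C) : nr z < 3 * r -> nr (y + z *: h - x) < rho.
  move=> zr; rewrite addrAC; apply: le_lt_trans (nrD _ _) _; rewrite nrZ.
  have : nr z * nr h < 3 * r * nr h by rewrite ltr_pM2r.
  nlra.
have in2 (z : C) : nr z <= 2 * r -> nr z < 3 * r by move=> ?; nlra.
have r2 : nr (1 : C) <= r / 2.
  by rewrite nr1 /r ler_pdivlMr // ler_pdivlMr ?mulr_gt0 //; nlra.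
have Mge0 : 0 <= M by apply: le_trans (gM y _ py); rewrite ?nr_ge0 //; nlra.
have ext j : exists G : C -> C, [/\ forall z, nr z < 3 * r -> differentiable G z,
     forall z, nr z < 3 * r -> nr (G z) <= M &
     forall z, phi (y + z *: h) != 0 -> G z = g (y + z *: h) 0 j].
  apply: (@holo_extension _ (fun z => phi (y + z *: h)) (fun z => g (y + z *: h) 0 j)).
  - move=> z /inb zr; apply: (@differentiable_on_line _ C phi); exact: dphi.
  - by rewrite scale0r addr0.
  - move=> z /inb zr pz.
    apply: (@differentiable_on_line _ C (fun y => g y 0 j)).
    by apply: differentiable_entry; apply: dg.
  - by move=> z /inb zr pz; apply: le_trans (nr_coord _ _) _; apply: gM.
split.
  apply: nr_le_coord => [|j].
    by rewrite mulr_ge0 ?nr_ge0 // divr_ge0 ?mulr_ge0 // ltW.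
  have [G [dG GM Gg]] := ext j.
  have := holo_lipschitz r0 r2 (fun z hz => dG z (in2 z hz)) (fun z hz => GM z (in2 z hz)).
  rewrite !Gg ?scale0r ?addr0 ?scale1r // nr1 mulr1 !mxE => hh.
  apply: le_trans hh _; rewrite le_eqVlt; apply/orP; left; apply/eqP.
  by rewrite /r; field; rewrite !gt_eqF.
move=> A hA; apply: nr_le_coord => [|j].
  by rewrite mulr_ge0 ?exprn_ge0 ?nr_ge0 // divr_ge0 ?mulr_ge0 ?exprn_ge0 // ltW.
have [G [dG GM Gg]] := ext j.
have := @holo_quadratic _ G r M ((h *m A) 0 j) 1 r0 r2 (fun z hz => dG z (in2 z hz)) (fun z hz => GM z (in2 z hz)).
rewrite !Gg ?scale0r ?addr0 ?scale1r // nr1 expr1n !mulr1.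
have E : 8 * M / r ^+ 2 = 128 * M / rho ^+ 2 * nr h ^+ 2.
  by rewrite /r; field; rewrite !gt_eqF.
rewrite E => hh.
rewrite [X in nr X]mxE [in X in _ + X]mxE [X in X + _]mxE [in X in _ + X + _]mxE; apply: hh => e e0.
have [d d0 hd] := hA _ (divr_gt0 e0 nh0).
have cphi : differentiable (fun z : C => phi (y + z *: h)) 0.
  apply: (@differentiable_on_line _ C phi); apply: dphi; apply: inb.
  by rewrite nr0 mulr_gt0.
have [|d2 d20 hd2] := (iffLR (continuous_nrCP _ 0)) (differentiable_continuous cphi) (nr (phi y)).
  by rewrite nr_gt0.
exists (Num.min d2 (d / nr h)); first by rewrite lt_min d20 divr_gt0.
move=> t; rewrite lt_min => /andP[t2]; rewrite ltr_pdivlMr // => td.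
have pt0 : phi (y + t *: h) != 0.
  apply/eqP => pt0; have := hd2 t; rewrite subr0 pt0 scale0r addr0 sub0r nrN ltxx.
  by move=> /(_ t2).
rewrite Gg //.
have := hd (t *: h); rewrite nrZ => /(_ td).
rewrite [e / nr h * _]mulrC -mulrA [nr h * _]mulrC divfK ?gt_eqF // [nr t * e]mulrC => hh2.
apply: le_trans hh2; apply: le_trans (nr_coord _ j).
by rewrite -scalemxAl !mxE [_ * t]mulrC.
Qed.

Lemma le_of_eps (a b K : R) : (forall e, 0 < e -> e <= 1 -> a <= b + e * K) -> a <= b.
Proof.
move=> h; apply/ler_addgt0Pl => e e0.
have K1 : 0 < `|K| + 1 by rewrite ltr_pwDr.
pose u := Num.min 1 (e / (`|K| + 1)).
have up : 0 < u by rewrite lt_min ltr01 divr_gt0.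
have u1 : u <= 1 by rewrite ge_min lexx.
apply: le_trans (h u up u1) _; rewrite addrC lerD2r.
have u0 : 0 <= u by rewrite le_min ler01 divr_ge0 // ltW.
have ue : u * (`|K| + 1) <= e by rewrite -ler_pdivlMr // ge_min lexx orbT.
by have := ler_norm K; nra.
Qed.

Lemma complete_mx p n (u : nat -> 'M[C]_(p, n)) :
  (forall e : R, 0 < e -> exists N, forall i j, (N <= i)%N -> (N <= j)%N ->
      forall k l, nr (u i k l - u j k l) <= e) ->
  exists L : 'M[C]_(p, n), forall e : R, 0 < e -> exists N, forall i, (N <= i)%N ->
      forall k l, nr (u i k l - L k l) <= e.
Proof.
move=> h.
have ent k l : exists v : C, forall e : R, 0 < e -> exists N, forall i, (N <= i)%N ->
      nr (u i k l - v) <= e.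
  apply: (@complete_nr _ (fun i => u i k l)) => e /h[N hN].
  by exists N => i j iN jN; exact: hN.
pose P (kl : 'I_p * 'I_n) (v : C) := forall e : R, 0 < e -> exists N, forall i, (N <= i)%N ->
      nr (u i kl.1 kl.2 - v) <= e.
have [F hF] : exists F, forall kl, P kl (F kl).
  by apply: fin_all_exists => -[k l]; exact: ent.
exists (\matrix_(k, l) F (k, l)) => e e0.
have [N hN] := fin_all_exists (fun kl => hF kl e e0).
exists (\max_kl N kl) => i iN k l; rewrite mxE.
apply: (hN (k, l)); apply: leq_trans iN.
exact: (leq_bigmax (k, l)).
Qed.

Lemma nr_mulmx_entries p n (A : 'M[C]_(p, n)) (K : R) (v : 'rV[C]_p) :
  0 <= K -> (forall i j, nr (A i j) <= K) -> nr (v *m A) <= p%:R * K * nr v.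
Proof.
move=> K0 hA; apply: nr_le_coord => [|j]; first by rewrite !mulr_ge0 ?nr_ge0.
rewrite mxE; apply: le_trans (nr_sum _ _ _) _.
apply: (@le_trans _ _ (\sum_(i < p) K * nr v)).
  by apply: ler_sum => i _; rewrite nrM mulrC ler_pM ?nr_ge0 ?nr_coord.
by rewrite sumr_const card_ord -[X in X <= _]mulr_natl mulrA.
Qed.

Lemma connected_clopen (V : normedModType C) (U W : set V) : connected U ->
  W `<=` U -> W !=set0 -> 
  (forall x, W x -> exists2 e : R, 0 < e & forall y, U y -> nr (y - x) < e -> W y) ->
  (forall x, U x -> ~ W x -> exists2 e : R, 0 < e & forall y, U y -> nr (y - x) < e -> ~ W y) ->
  W = U.
Proof.
move=> cU WU W0 Wo Wc; apply: cU => //.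
- exists [set y | exists x, W x /\ exists2 e : R, 0 < e &
     nr (y - x) < e /\ forall z, U z -> nr (z - x) < e -> W z].
    apply/open_nrP => y [x [Wx [e e0 [yx he]]]].
    exists (e - nr (y - x)); first by rewrite subr_gt0.
    move=> z zy; exists x; split => //; exists e => //; split => //.
    by have := nr_tri y z x; nlra.
  apply/seteqP; split=> [y Wy|y [Uy [x [Wx [e e0 [yx he]]]]]].
    split; first exact: WU.
    by have [e e0 he] := Wo y Wy; exists y; split => //; exists e => //; rewrite subrr nr0.
  exact: he.
- pose O := [set y | exists x, (U x /\ ~ W x) /\ exists2 e : R, 0 < e &
     nr (y - x) < e /\ forall z, U z -> nr (z - x) < e -> ~ W z].
  exists (~` O).
    apply: open_closedC; apply/open_nrP => y [x [Wx [e e0 [yx he]]]].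
    exists (e - nr (y - x)); first by rewrite subr_gt0.
    move=> z zy; exists x; split => //; exists e => //; split => //.
    by have := nr_tri y z x; nlra.
  apply/seteqP; split=> [y Wy|y [Uy nO]].
    split; first exact: WU.
    by move=> [x [Wx [e e0 [yx he]]]]; apply: (he y) => //; exact: WU.
  apply: contrapT => nWy; apply: nO.
  by have [e e0 he] := Wc y Uy nWy; exists y; split => //; exists e => //; rewrite subrr nr0.
Qed.

(** The identity principle along the line from [y] to [z]: by convexity the segment stays in the
    ball. *)
Lemma identity_ball p (x y z : 'rV[C]_p) (rho e : R) (phi : 'rV[C]_p -> C) :
  (forall y : 'rV[C]_p, nr (y - x) < rho -> differentiable phi y) ->
  nr (y - x) < rho -> nr (z - x) < rho -> 0 < e ->
  (forall w : 'rV[C]_p, nr (w - y) < e -> phi w = 0) -> phi z = 0.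
Proof.
move=> dphi yr zr e0 hy.
have K0 : 0 < nr (z - y) + 1 by rewrite ltr_wpDl ?nr_ge0.
have := @identity_segment _ (fun t => phi (y + t *: (z - y))).
rewrite scale1r [y + (z - y)]addrC subrK; apply.
- move=> t /andP[t0 t1].
  pose mu := Num.max (nr (y - x)) (nr (z - x)).
  have mr : mu < rho by rewrite gt_max yr.
  exists ((rho - mu) / (nr (z - y) + 1)); first by rewrite divr_gt0 // subr_gt0.
  move=> w; rewrite ltr_pdivlMr; [|exact: K0] => wt.
  apply: (@differentiable_on_line _ C phi); apply: dphi.
  rewrite (_ : _ - x = ((1 - t)%:C)%C *: (y - x) + (t%:C)%C *: (z - x) + (w - (t%:C)%C) *: (z - y)); last first.
    apply/rowP => i; rewrite !mxE rmorphB rmorph1 /=; ring.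
  apply: le_lt_trans (nrD _ _) _.
  apply: le_lt_trans (lerD (nrD _ _) (lexx _)) _.
  rewrite !nrZ !nr_real (ger0_norm t0) ger0_norm ?subr_ge0 //.
  have m1 : nr (y - x) <= mu by rewrite le_max lexx.
  have m2 : nr (z - x) <= mu by rewrite le_max lexx orbT.
  have q1 := nr_ge0 (z - y); have q2 := nr_ge0 (w - ((t%:C)%C : C)).
  have s1 : (1 - t) * nr (y - x) <= (1 - t) * mu by rewrite ler_wpM2l // subr_ge0.
  have s2 : t * nr (z - x) <= t * mu by rewrite ler_wpM2l.
  apply: le_lt_trans (lerD (lerD s1 s2) (lexx _)) _.
  rewrite -mulrDl subrK mul1r -ltrBrDl; apply: le_lt_trans wt.
  by rewrite ler_wpM2l // lerDl.
- exists (e / (nr (z - y) + 1)) => [|w]; first by rewrite divr_gt0.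
  rewrite ltr_pdivlMr; [|exact: K0] => wt; apply: hy.
  rewrite addrAC subrr add0r nrZ; have := nr_ge0 w; nlra.
Qed.

(** The points near which [phi] vanishes identically form a clopen part of [U], the complement being
    open by [identity_ball]; it misses [x0]. *)
Lemma identity_dense p (U : set 'rV[C]_p) (phi : 'rV[C]_p -> C) (x0 : 'rV[C]_p) :
  open U -> connected U -> (forall x, U x -> differentiable phi x) ->
  U x0 -> phi x0 != 0 ->
  forall (x : 'rV[C]_p) (e : R), U x -> 0 < e -> exists y : 'rV[C]_p, [/\ U y, nr (y - x) < e & phi y != 0].
Proof.
move=> oU cU dphi Ux0 px0 x e Ux e0; apply: contrapT => nh.
pose W := [set y | U y /\ exists2 r : R, 0 < r & forall z : 'rV[C]_p, nr (z - y) < r -> phi z = 0].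
suff E : W = U.
  have [_ [r r0 hr]] : W x0 by rewrite E.
  by move: px0; rewrite hr ?subrr ?nr0 ?eqxx.
apply: connected_clopen => //.
- by move=> y [].
- have [r r0 hr] := (iffLR (open_nrP U)) oU x Ux.
  exists x; split => //; exists (Num.min e r); first by rewrite lt_min e0.
  move=> z; rewrite lt_min => /andP[ze zr]; apply/eqP; apply: contrapT => /negP pz.
  by apply: nh; exists z; split => //; apply: hr.
- move=> y [Uy [r r0 hr]]; exists (r / 2); first by rewrite divr_gt0.
  move=> z Uz zy; split => //; exists (r / 2); first by rewrite divr_gt0.
  by move=> w wz; apply: hr; have := nr_tri z w y; nlra.
- move=> y Uy nWy; have [r r0 hr] := (iffLR (open_nrP U)) oU y Uy.
  exists r => // z Uz zy [_ [s s0 hs]]; apply: nWy; split => //.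
  exists r => // w wy.
  apply: (@identity_ball _ y z w r s phi) => // v vy.
  by apply: dphi; apply: hr.
Qed.

End SeveralVariables.

(** * Extension of locally bounded maps across the zeros of a holomorphic function *)

Section Extension.
Variable R : realType.
Local Notation C := (Cplx R).

Definition limit_along p n (D : set 'rV[C]_p) (g : 'rV[C]_p -> 'rV[C]_n)
    (z : 'rV[C]_p) (v : 'rV[C]_n) :=
  forall e : R, 0 < e -> exists2 d : R, 0 < d &
    forall y : 'rV[C]_p, D y -> nr (y - z) < d -> nr (g y - v) <= e.

Lemma half_pow_le (w e : R) (i N : nat) : 0 <= w -> w / 2 ^+ N < e -> (N <= i)%N ->
  w / 2 ^+ i < e.
Proof.
move=> w0 h Ni; apply: le_lt_trans h; apply: ler_wpM2l => //.
by rewrite lef_pV2 ?posrE ?exprn_gt0 // ler_weXn2l // ler1n.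
Qed.

Section AtPoint.
Variables (p n : nat) (D : set 'rV[C]_p) (g : 'rV[C]_p -> 'rV[C]_n).
Variables (x : 'rV[C]_p) (r K1 K2 : R).
Hypotheses (r0 : 0 < r) (K10 : 0 <= K1) (K20 : 0 <= K2).
Hypothesis Dd : forall z : 'rV[C]_p, nr (z - x) < r -> forall e : R, 0 < e ->
  exists y : 'rV[C]_p, D y /\ nr (y - z) < e.
Hypothesis E1 : forall y y' : 'rV[C]_p, D y -> D y' -> nr (y - x) < r -> nr (y' - x) < r ->
  nr (g y' - g y) <= K1 * nr (y' - y).
Hypothesis E2 : forall (y y' : 'rV[C]_p) A, D y -> D y' -> nr (y - x) < r -> nr (y' - x) < r ->
  hasd g y A -> nr (g y' - g y - (y' - y) *m A) <= K2 * nr (y' - y) ^+ 2.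
Hypothesis Dg : forall y : 'rV[C]_p, D y -> nr (y - x) < r -> exists A, hasd g y A.

Lemma seq_to_x (s : R) : 0 < s -> exists u : nat -> 'rV[C]_p, forall k,
  [/\ D (u k), nr (u k - x) < s & nr (u k - x) < 1 / 2 ^+ k].
Proof.
move=> s0.
have h k : exists y : 'rV[C]_p, [/\ D y, nr (y - x) < s & nr (y - x) < 1 / 2 ^+ k].
  have [||y [Dy]] := Dd (z := x) _ (e := Num.min s (1 / 2 ^+ k)).
  - by rewrite subrr nr0.
  - by rewrite lt_min s0 divr_gt0 // exprn_gt0.
  by rewrite lt_min => /andP[? ?]; exists y.
have [u hu] := choice h; exists u; exact: hu.
Qed.

Lemma limit_exists : exists v, limit_along D g x v.
Proof.
have [u hu] := seq_to_x r0.
have [|v hv] := @complete_mx R 1 n (fun k => g (u k)).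
  move=> e e0; have K2p : 0 < 2 * K1 + 1 by rewrite ltr_wpDl // mulr_ge0.
  have [N hN] := half_pow_lt 1 (divr_gt0 e0 K2p).
  exists N => i j Ni Nj k l.
  have iN := half_pow_le ler01 hN Ni; have jN := half_pow_le ler01 hN Nj.
  rewrite ord1; have [D1 q1 q2] := hu i; have [D2 q3 q4] := hu j.
  have -> : g (u i) 0 l - g (u j) 0 l = (g (u i) - g (u j)) 0 l by rewrite !mxE.
  apply: le_trans (nr_coord _ _) _; apply: le_trans (E1 D2 D1 q3 q1) _.
  have : nr (u i - u j) <= nr (u i - x) + nr (u j - x).
    by rewrite [nr (u j - x)]nrBCv; exact: nr_triv.
  have w1 : nr (u i - x) <= e / (2 * K1 + 1) by apply: ltW; apply: lt_trans q2 iN.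
  have w2 : nr (u j - x) <= e / (2 * K1 + 1) by apply: ltW; apply: lt_trans q4 jN.
  move=> tri; apply: le_trans (ler_wpM2l K10 tri) _.
  apply: le_trans (ler_wpM2l K10 (lerD w1 w2)) _.
  rewrite -mulrDl mulrA ler_pdivrMr // (_ : K1 * (e + e) = e * (2 * K1)); last by ring.
  by rewrite ler_pM2l // lerDl.
exists v => e e0; exists (Num.min r (e / (K1 + 1))).
  by rewrite lt_min r0 divr_gt0 // ltr_wpDl.
move=> y Dy; rewrite lt_min => /andP[yr ye].
apply: (@le_trans _ _ (K1 * nr (y - x))); last first.
  move: ye; rewrite ltr_pdivlMr ?ltr_wpDl // => ye.
  have := nr_ge0 (y - x); nra.
apply: (@le_of_eps _ _ _ (K1 + 1)) => t t0 _.
have [N1 h1] := hv t t0; have [N2 h2] := half_pow_lt 1 t0.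
pose k := maxn N1 N2; have [D1 q1 q2] := hu k.
have w1 : nr (g (u k) - v) <= t.
  by apply: nr_le_coord => [|j]; [exact: ltW | rewrite !mxE; apply: h1; exact: leq_maxl].
have w2 : nr (u k - x) < t.
  by apply: lt_trans q2 (half_pow_le ler01 h2 _); exact: leq_maxr.
have w3 := E1 D1 Dy q1 yr.
have w4 := nr_triv x y (u k); rewrite [nr (x - u k)]nrBCv in w4.
apply: le_trans (nr_triv (g (u k)) _ _) _.
have := ler_wpM2l K10 w4; have := ler_wpM2l K10 (ltW w2); nlra.
Qed.

Variable F : 'rV[C]_p -> 'rV[C]_n.
Hypothesis HF : forall z : 'rV[C]_p, nr (z - x) < r -> limit_along D g z (F z).

Lemma approx (z : 'rV[C]_p) (e : R) : nr (z - x) < r -> 0 < e ->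
  exists y : 'rV[C]_p, [/\ D y, nr (y - x) < r, nr (y - z) < e & nr (g y - F z) <= e].
Proof.
move=> zr e0; have [d d0 hd] := HF zr e0.
have rz : 0 < r - nr (z - x) by rewrite subr_gt0.
have [|y [Dy]] := Dd zr (e := Num.min (Num.min d e) (r - nr (z - x))).
  by rewrite !lt_min d0 e0.
rewrite !lt_min => /andP[/andP[yd ye] yr]; exists y; split => //; last exact: hd.
by have := nr_triv z y x; nlra.
Qed.

Lemma ext_lip1 (z y : 'rV[C]_p) : nr (z - x) < r -> D y -> nr (y - x) < r ->
  nr (F z - g y) <= K1 * nr (z - y).
Proof.
move=> zr Dy yr; apply: (@le_of_eps _ _ _ (1 + K1)) => e e0 _.
have [y' [D' r' z' g']] := approx zr e0.
have w1 := E1 Dy D' yr r'.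
have w2 := nr_triv z y' y.
apply: le_trans (nr_triv (g y') _ _) _; rewrite [nr (F z - _)]nrBCv.
have := ler_wpM2l K10 w2; have := ler_wpM2l K10 (ltW z'); nlra.
Qed.

Lemma ext_lip (z z' : 'rV[C]_p) : nr (z - x) < r -> nr (z' - x) < r ->
  nr (F z - F z') <= K1 * nr (z - z').
Proof.
move=> zr zr'; apply: (@le_of_eps _ _ _ (1 + K1)) => e e0 _.
have [y' [D' r' y'z g']] := approx zr' e0.
have w1 := ext_lip1 zr D' r'.
have w2 := nr_triv z' z y'; rewrite [nr (z' - y')]nrBCv in w2.
apply: le_trans (nr_triv (g y') _ _) _.
have := ler_wpM2l K10 w2; have := ler_wpM2l K10 (ltW y'z); nlra.
Qed.

Lemma ext_quad (z y : 'rV[C]_p) A : nr (z - x) < r -> D y -> nr (y - x) < r -> hasd g y A ->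
  nr (F z - g y - (z - y) *m A) <= K2 * nr (z - y) ^+ 2.
Proof.
move=> zr Dy yr hA; have [KA KA0 hKA] := nr_mulmx A.
apply: (@le_of_eps _ _ _ (1 + K2 * (2 * nr (z - y) + 1) + KA)) => e e0 e1.
have [y' [D' r' z' g']] := approx zr e0.
have w1 := E2 Dy D' yr r' hA.
have w2 := nr_triv z y' y.
rewrite (_ : F z - g y - _ = (F z - g y') + (g y' - g y - (y' - y) *m A) + (y' - z) *m A); last first.
  rewrite !mulmxBl; move: (_ *m _) (_ *m _) (_ *m _) => B1 B2 B3.
  by apply/rowP => i; rewrite !mxE; ring.
apply: le_trans (nrDv _ _) _; apply: le_trans (lerD (nrDv _ _) (hKA _)) _.
rewrite [nr (F z - _)]nrBCv.
have w3 : nr (y' - y) ^+ 2 <= nr (z - y) ^+ 2 + e * (2 * nr (z - y) + 1).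
  apply: (@le_trans _ _ ((nr (z - y) + e) ^+ 2)).
    by apply: lerXn2r; rewrite ?nnegrE ?addr_ge0 ?nr_ge0 ?(ltW e0) //; nlra.
  have : e * e <= e by rewrite ler_piMr // ltW.
  by rewrite sqrrD !expr2; nlra.
have := ler_wpM2l K20 w3; have := ler_wpM2l (ltW KA0) (ltW z'); nlra.
Qed.

Lemma nr_delta (i : 'I_p) : nr (delta_mx 0 i : 'rV[C]_p) <= 1.
Proof.
apply: nr_le_coord => // j; rewrite mxE eqxx /=.
by case: eqP => _; rewrite ?nr1 ?nr0.
Qed.

(** The quadratic expansions at [y] and [y'] in the direction of the [i]-th basis vector, scaled by
    [t], express [t * (A i j - A' i j)] through differences of values. Fixing a small [t] and then
    bringing [y] and [y'] together makes the right-hand side small, so derivatives have the Cauchy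
    property. *)
Lemma deriv_entries (y y' : 'rV[C]_p) A A' (t : R) i j : D y -> D y' ->
  nr (y - x) < r / 2 -> nr (y' - x) < r / 2 -> hasd g y A -> hasd g y' A' ->
  0 < t -> t <= r / 2 ->
  nr (A i j - A' i j) <= 2 * K1 * nr (y - y') / t + 2 * K2 * t.
Proof.
move=> Dy Dy' yr yr' hA hA' t0 tr.
pose tc : C := (t%:C)%C.
have ntc : nr tc = t by rewrite /tc nr_real gtr0_norm.
pose v : 'rV[C]_p := tc *: delta_mx 0 i.
have nv : nr v <= t.
  by rewrite /v nrZ ntc -[leRHS]mulr1 ler_wpM2l ?(ltW t0) // nr_delta.
have zr (w : 'rV[C]_p) : nr (w - x) < r / 2 -> nr (w + v - x) < r.
  by move=> wr; rewrite addrAC; apply: le_lt_trans (nrDv _ _) _; nlra.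
have r2 (w : 'rV[C]_p) : nr (w - x) < r / 2 -> nr (w - x) < r by move=> ?; nlra.
have q (w : 'rV[C]_p) A0 : D w -> nr (w - x) < r / 2 -> hasd g w A0 ->
    nr (F (w + v) - g w - v *m A0) <= K2 * t ^+ 2.
  move=> Dw wr hw; have := ext_quad (zr w wr) Dw (r2 w wr) hw.
  have -> : w + v - w = v by rewrite addrAC subrr add0r.
  move=> h; apply: le_trans h _.
  by rewrite ler_wpM2l //; apply: lerXn2r; rewrite ?nnegrE ?nr_ge0 // ltW.
have q1 := q _ _ Dy yr hA; have q2 := q _ _ Dy' yr' hA'.
have q3 := ext_lip (zr y yr) (zr y' yr').
have q4 := E1 Dy' Dy (r2 _ yr') (r2 _ yr).
have e3 : y + v - (y' + v) = y - y' by apply/rowP => k; rewrite !mxE; ring.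
rewrite e3 in q3.
rewrite -(ler_pM2l t0) -{1}ntc -nrM.
have -> : tc * (A i j - A' i j) = (v *m A - v *m A') 0 j.
  by rewrite /v -!scalemxAl -!rowE !mxE mulrBr.
apply: le_trans (nr_coord _ _) _.
rewrite (_ : v *m A - v *m A' = (F (y' + v) - g y' - v *m A') - (F (y + v) - g y - v *m A)
   + ((F (y + v) - F (y' + v)) - (g y - g y'))); last first.
  by apply/rowP => k; rewrite !mxE; ring.
apply: le_trans (nrDv _ _) _; apply: le_trans (lerD (nrBv _ _) (nrBv _ _)) _.
rewrite mulrDr [t * (_ / t)]mulrC divfK ?gt_eqF // [t * _]mulrC -[2 * K2 * t * t]mulrA -expr2; nlra.
Qed.

(** The derivatives at points [u k] of [D] tending to [x] converge entrywise to some [A]. The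
    quadratic estimates centred at [u k] pass to the limit and show that [A] is the derivative of
    [F] at [x]. *)
Lemma ext_differentiable : differentiable F x.
Proof.
have r20 : 0 < r / 2 by rewrite divr_gt0.
have [u hu] := seq_to_x r20.
have ur k : nr (u k - x) < r by have [_ + _] := hu k; nlra.
have [B hB] : exists B : nat -> 'M[C]_(p, n), forall k, hasd g (u k) (B k).
  have [k|B hB] := @choice _ _ (fun k A => hasd g (u k) A); last by exists B.
  by have [Dk _ _] := hu k; exact: Dg Dk (ur k).
have [|A hA] := @complete_mx R p n B.
  move=> e e0.
  (* [t] makes the term [2 * K2 * t] at most [e / 2]; only afterwards is [s] chosen, relative to
     [t], to do the same for the term divided by [t]. *)
  pose t := Num.min (r / 2) (e / (2 * (2 * K2 + 1))).
  have k2 : 0 < 2 * (2 * K2 + 1) by rewrite mulr_gt0 // ltr_wpDl // mulr_ge0.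
  have t0 : 0 < t by rewrite lt_min r20 divr_gt0.
  have te : 2 * K2 * t <= e / 2.
    have : t <= e / (2 * (2 * K2 + 1)) by rewrite ge_min lexx orbT.
    rewrite ler_pdivlMr // => h; nra.
  have tr : t <= r / 2 by rewrite ge_min lexx.
  pose s := e * t / (8 * (K1 + 1)).
  have k1 : 0 < 8 * (K1 + 1) by rewrite mulr_gt0 // ltr_wpDl.
  have s0 : 0 < s by rewrite divr_gt0 // mulr_gt0.
  have [N hN] := half_pow_lt 1 s0.
  exists N => a b aN bN i j.
  have [Da ra wa] := hu a; have [Db rb wb] := hu b.
  apply: le_trans (deriv_entries i j Da Db ra rb (hB a) (hB b) t0 tr) _.
  have sa := lt_trans wa (half_pow_le ler01 hN aN).
  have sb := lt_trans wb (half_pow_le ler01 hN bN).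
  have tri := nr_triv x (u a) (u b); rewrite [nr (x - _)]nrBCv in tri.
  suff : 2 * K1 * nr (u a - u b) / t <= e / 2 by nlra.
  rewrite ler_pdivrMr //.
  have hs : nr (u a - u b) <= 2 * s by nlra.
  apply: le_trans (ler_wpM2l _ hs) _; first by rewrite mulr_ge0.
  have -> : 2 * K1 * (2 * s) = (e * t / 2) * (K1 / (K1 + 1)).
    by rewrite /s; field; rewrite gt_eqF // ltr_wpDl.
  rewrite [e / 2 * t]mulrAC -[leRHS]mulr1 ler_wpM2l //.
    by rewrite divr_ge0 // mulr_ge0 // ltW.
  by rewrite ler_pdivrMr ?ltr_wpDl // mul1r lerDl.
pose KA := \sum_i \sum_j nr (A i j).
have KA0 : 0 <= KA by do 2![apply: sumr_ge0 => ? _]; exact: nr_ge0.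
have hKA i j : nr (A i j) <= KA.
  rewrite /KA (bigD1 i) //= (bigD1 j) //= -addrA lerDl addr_ge0 //.
    by apply: sumr_ge0 => ? _; exact: nr_ge0.
  by do 2![apply: sumr_ge0 => ? _]; exact: nr_ge0.
have xr : nr (x - x) < r by rewrite subrr nr0.
have main (h : 'rV[C]_p) : nr h < r -> nr (F (x + h) - F x - h *m A) <= K2 * nr h ^+ 2.
  move=> hr.
  have zr : nr (x + h - x) < r by rewrite addrAC subrr add0r.
  apply: (@le_of_eps _ _ _ (K2 * (2 * nr h + 1) + K1 + p%:R * nr h + p%:R * (KA + 1))) => e e0 e1.
  have [N1 h1] := hA e e0; have [N2 h2] := half_pow_lt 1 e0.
  pose k := maxn N1 N2; have [Dk rk wk] := hu k.
  have ek : nr (u k - x) < e.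
    by apply: lt_trans wk (half_pow_le ler01 h2 _); exact: leq_maxr.
  have q1 := ext_quad zr Dk (ur k) (hB k).
  have q2 := ext_lip1 xr Dk (ur k).
  have q3 : nr (h *m (B k - A)) <= p%:R * e * nr h.
    apply: nr_mulmx_entries => [|i j]; first exact: ltW.
    by rewrite !mxE; apply: h1; exact: leq_maxl.
  have q4 : nr ((x - u k) *m B k) <= p%:R * (KA + 1) * nr (x - u k).
    apply: nr_mulmx_entries => [|i j]; first by rewrite addr_ge0.
    rewrite -[B k i j](subrK (A i j)) addrC; apply: le_trans (nrD _ _) _.
    by apply: lerD => //; apply: le_trans e1; apply: h1; exact: leq_maxl.
  rewrite [nr (x - u k)]nrBCv in q2 q4.
  rewrite (_ : F (x + h) - F x - h *m A = (F (x + h) - g (u k) - (x + h - u k) *m B k)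
     - (F x - g (u k)) + h *m (B k - A) + (x - u k) *m B k); last first.
    rewrite !mulmxBl mulmxDl mulmxBr.
    move: (x *m _) (h *m _) (u k *m _) (h *m _) => B1 B2 B3 B4.
    by apply/rowP => i; rewrite !mxE; ring.
  apply: le_trans (nrDv _ _) _; apply: le_trans (lerD (nrDv _ _) (lexx _)) _.
  apply: le_trans (lerD (lerD (nrBv _ _) (lexx _)) (lexx _)) _.
  have w3 : nr (x + h - u k) ^+ 2 <= nr h ^+ 2 + e * (2 * nr h + 1).
    apply: (@le_trans _ _ ((nr h + e) ^+ 2)).
      apply: lerXn2r; rewrite ?nnegrE ?addr_ge0 ?nr_ge0 ?(ltW e0) //.
      have -> : x + h - u k = h + (x - u k) by rewrite [x + h]addrC addrA.
      apply: le_trans (nrDv _ _) _; rewrite [nr (x - _)]nrBCv; nlra.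
    have : e * e <= e by rewrite ler_piMr // ltW.
    by rewrite sqrrD !expr2; nlra.
  have w4 := ler_wpM2l K20 w3.
  have w5 := ler_wpM2l K10 (ltW ek).
  have pK : 0 <= p%:R * (KA + 1) by rewrite mulr_ge0 // addr_ge0.
  have w6 := ler_wpM2l pK (ltW ek).
  nlra.
apply: (@differentiable_mulmx _ _ _ _ A) => e e0.
exists (Num.min r (e / (K2 + 1))).
  by rewrite lt_min r0 divr_gt0 // ltr_wpDl.
move=> h; rewrite lt_min => /andP[/main hr].
rewrite ltr_pdivlMr ?ltr_wpDl // => he; apply: le_trans hr _.
rewrite expr2 mulrA ler_wpM2r ?nr_ge0 //; have := nr_ge0 h; nra.
Qed.

End AtPoint.

Lemma limit_along_in p n (D : set 'rV[C]_p) (g : 'rV[C]_p -> 'rV[C]_n)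
    (z : 'rV[C]_p) (v : 'rV[C]_n) :
  D z -> limit_along D g z v -> v = g z.
Proof.
move=> Dz hv; apply/eqP; rewrite eq_sym -subr_eq0 -nr_eq0 eq_le nr_ge0 andbT.
apply/ler_addgt0Pl => e e0; rewrite addr0; have [d d0 hd] := hv e e0.
by apply: hd => //; rewrite subrr nr0.
Qed.

(** The extension is the limit along [{phi <> 0}], which exists by the Lipschitz estimate;
    holomorphy at the new points comes from the quadratic one. *)
Theorem riemann_extension p n (U : set 'rV[C]_p) (phi : 'rV[C]_p -> C)
  (g : 'rV[C]_p -> 'rV[C]_n) :
  open U -> (forall x, U x -> differentiable phi x) ->
  (forall (x : 'rV[C]_p) (e : R), U x -> 0 < e -> exists y : 'rV[C]_p, [/\ U y, nr (y - x) < e & phi y != 0]) ->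
  (forall x, U x -> phi x != 0 -> differentiable g x) ->
  (forall x, U x -> exists M, exists2 s : R, 0 < s & forall y : 'rV[C]_p, U y -> phi y != 0 ->
     nr (y - x) < s -> nr (g y) <= M) ->
  exists F, (forall x, U x -> differentiable F x) /\
    (forall x, U x -> phi x != 0 -> F x = g x).
Proof.
move=> oU dphi dns dg bg.
pose D := [set y | U y /\ phi y != 0].
have loc x : U x -> exists r K1 K2, [/\ 0 < r, 0 <= K1 & 0 <= K2] /\
  [/\ forall z : 'rV[C]_p, nr (z - x) < r -> U z,
   forall y y' : 'rV[C]_p, D y -> D y' -> nr (y - x) < r -> nr (y' - x) < r ->
     nr (g y' - g y) <= K1 * nr (y' - y) &
   forall (y y' : 'rV[C]_p) A, D y -> D y' -> nr (y - x) < r -> nr (y' - x) < r ->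
     hasd g y A -> nr (g y' - g y - (y' - y) *m A) <= K2 * nr (y' - y) ^+ 2].
  move=> Ux; have [M [s s0 hM]] := bg x Ux.
  have [t t0 ht] := (iffLR (open_nrP U)) oU x Ux.
  pose rho := Num.min s t.
  have rho0 : 0 < rho by rewrite lt_min s0.
  have rs : rho <= s by rewrite ge_min lexx.
  have rt : rho <= t by rewrite ge_min lexx orbT.
  have inU (y : 'rV[C]_p) : nr (y - x) < rho -> U y by move=> h; apply: ht; nlra.
  have hphi (y : 'rV[C]_p) : nr (y - x) < rho -> differentiable phi y by move=> /inU; exact: dphi.
  have hg (y : 'rV[C]_p) : nr (y - x) < rho -> phi y != 0 -> differentiable g y by move=> /inU; exact: dg.
  have hb (y : 'rV[C]_p) : nr (y - x) < rho -> phi y != 0 -> nr (g y) <= `|M|.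
    move=> yr py; apply: le_trans (ler_norm M); apply: hM => //; first exact: inU.
    nlra.
  (* Two points of the ball of radius [rho / 16] are at distance at most [rho / 8], as
     [ball_estimates] requires. *)
  exists (rho / 16), (32 * `|M| / rho), (128 * `|M| / rho ^+ 2); split.
    split; first by rewrite divr_gt0.
      by rewrite divr_ge0 ?mulr_ge0 // ltW.
    by rewrite divr_ge0 ?mulr_ge0 ?exprn_ge0 // ltW.
  have est (y y' : 'rV[C]_p) : D y -> D y' -> nr (y - x) < rho / 16 -> nr (y' - x) < rho / 16 ->
     nr (g y' - g y) <= 32 * `|M| / rho * nr (y' - y) /\
     forall A, hasd g y A -> nr (g y' - g y - (y' - y) *m A) <= 128 * `|M| / rho ^+ 2 * nr (y' - y) ^+ 2.
    move=> [_ py] [_ py'] yr yr'.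
    have y4 : nr (y - x) < rho / 4 by nlra.
    have h8 : nr (y' - y) <= rho / 8.
      by have := nr_triv x y' y; rewrite [nr (x - y)]nrBCv; nlra.
    have := ball_estimates hphi hg hb y4 h8 py.
    by rewrite [y + (y' - y)]addrC subrK => /(_ py').
  split.
  - by move=> z zr; apply: inU; nlra.
  - by move=> y y' Dy Dy' yr yr'; case: (est y y' Dy Dy' yr yr').
  - by move=> y y' A Dy Dy' yr yr'; case: (est y y' Dy Dy' yr yr') => _; apply.
have Dd (x : 'rV[C]_p) r : (forall z : 'rV[C]_p, nr (z - x) < r -> U z) -> forall z : 'rV[C]_p, nr (z - x) < r ->
    forall e : R, 0 < e -> exists y : 'rV[C]_p, D y /\ nr (y - z) < e.
  by move=> inU z /inU Uz e e0; have [y [? ? ?]] := dns z e Uz e0; exists y.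
have Dg y : D y -> exists A, hasd g y A.
  by move=> [Uy py]; have [A hA] := differentiable_lin (dg y Uy py); exists A.
pose F z := xget 0 [set v | limit_along D g z v].
have HF z : U z -> limit_along D g z (F z).
  move=> Uz; have [r [K1 [K2 [[r0 K10 K20] [inU E1 E2]]]]] := loc z Uz.
  by have [v hv] := limit_exists r0 K10 (Dd _ _ inU) E1; apply: (xgetPex 0); exists v.
exists F; split => x Ux; last by move=> px; apply: (@limit_along_in _ _ D); [|exact: HF].
have [r [K1 [K2 [[r0 K10 K20] [inU E1 E2]]]]] := loc x Ux.
apply: (@ext_differentiable _ _ D g x r K1 K2 r0 K10 K20 (Dd _ _ inU) E1 E2).
  by move=> y /Dg.
by move=> z /inU; exact: HF.
Qed.

End Extension.

(** * Connectedness of the complement of the zeros *)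

Section Complement.
Variable R : realType.
Local Notation C := (Cplx R).

Lemma complement_clopen p (U W : set 'rV[C]_p) (phi : 'rV[C]_p -> C) (x0 : 'rV[C]_p) :
  open U -> connected U -> (forall x, U x -> differentiable phi x) ->
  (forall x, W x -> U x /\ phi x != 0) -> W x0 ->
  (forall x, W x -> exists2 e : R, 0 < e &
     forall y : 'rV[C]_p, nr (y - x) < e -> W y) ->
  (forall x, U x -> phi x != 0 -> ~ W x -> exists2 e : R, 0 < e &
     forall y : 'rV[C]_p, nr (y - x) < e -> ~ W y) ->
  forall x, U x -> phi x != 0 -> W x.
Proof.
move=> oU cU dphi WU W0 Wo Wc.
have [Ux0 px0] := WU _ W0.
have dns := identity_dense oU cU dphi Ux0 px0.
(* The indicator function of [W], as a row vector of length one to fit the extension theorem. *)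
pose g (x : 'rV[C]_p) : 'rV[C]_1 := const_mx (if pselect (W x) then 1 else 0).
have g1 x : W x -> g x = const_mx 1 by rewrite /g; case: pselect.
have g0 x : ~ W x -> g x = const_mx 0 by rewrite /g; case: pselect.
have n1 : nr (const_mx 1 : 'rV[C]_1) = 1.
  apply/eqP; rewrite eq_le; apply/andP; split.
    by apply: nr_le_coord => // j; rewrite mxE nr1.
  by have := nr_coord (const_mx 1 : 'rV[C]_1) 0; rewrite mxE nr1.
have [F [dF Fg]] : exists F, (forall x, U x -> differentiable F x) /\
    (forall x, U x -> phi x != 0 -> F x = g x).
  apply: riemann_extension oU dphi dns _ _.
    move=> x Ux px; case: (pselect (W x)) => Wx.
      have [e e0 he] := Wo x Wx.
      apply: (@differentiable_near _ _ _ (fun _ : 'rV[C]_p => const_mx 1 : 'rV[C]_1) _ _ e e0).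
        by move=> y /he /g1 ->.
      exact: differentiable_cst.
    have [e e0 he] := Wc x Ux px Wx.
    apply: (@differentiable_near _ _ _ (fun _ : 'rV[C]_p => const_mx 0 : 'rV[C]_1) _ _ e e0).
      by move=> y /he /g0 ->.
    exact: differentiable_cst.
  move=> x _; exists 1, 1 => // y _ _ _; case: (pselect (W y)) => [/g1|/g0] ->.
    by rewrite n1.
  by rewrite (_ : const_mx 0 = 0) ?nr0 //; apply/rowP => i; rewrite !mxE.
have cF x : U x -> forall e : R, 0 < e -> exists2 d : R, 0 < d &
     forall y : 'rV[C]_p, nr (y - x) < d -> nr (F y - F x) < e.
  by move=> /dF /differentiable_continuous /continuous_nrP.
(* A positive distance of [F x] from both values would persist nearby, but points with [phi <> 0],
   where [F] is the indicator, are dense. *)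
have dich x : U x -> F x = const_mx 0 \/ F x = const_mx 1.
  move=> Ux; pose m := Num.min (nr (F x - const_mx 0)) (nr (F x - const_mx 1)).
  have [m0|m0] := ltP 0 m.
    have [d d0 hd] := cF x Ux m m0.
    have [y [Uy yx py]] := dns x d Ux d0.
    have := hd y yx; rewrite Fg //; case: (pselect (W y)) => [/g1|/g0] ->;
      by rewrite nrBC lt_min ltxx ?andbF.
  move: m0; rewrite /m ge_min => /orP[h|h]; [left|right]; apply/eqP;
    by rewrite -subr_eq0 -nr_eq0 eq_le h nr_ge0.
have ne : (const_mx 0 : 'rV[C]_1) <> const_mx 1.
  by move=> /rowP/(_ 0); rewrite !mxE => /eqP; rewrite eq_sym oner_eq0.
have d01 : nr ((const_mx 1 : 'rV[C]_1) - const_mx 0) = 1.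
  by rewrite (_ : const_mx 0 = 0) ?subr0 //; apply/rowP => i; rewrite !mxE.
have E : [set x | U x /\ F x = const_mx 1] = U.
  apply: connected_clopen => //.
  - by move=> x [].
  - by exists x0; split => //; rewrite Fg // g1.
  - move=> x [Ux Fx]; have [d d0 hd] := cF x Ux 1 ltr01.
    exists d => // y Uy /hd; rewrite Fx; case: (dich y Uy) => [->|//].
    by rewrite nrBC d01 ltxx.
  - move=> x Ux nx; have [d d0 hd] := cF x Ux 1 ltr01.
    exists d => // y Uy /hd h [_ Fy]; apply: nx; split => //.
    by case: (dich x Ux) => // Fx; move: h; rewrite Fx Fy d01 ltxx.
move=> x Ux px; apply: contrapT => nWx.
have [_] : [set x | U x /\ F x = const_mx 1] x by rewrite E.
by rewrite Fg // g0 // => /ne.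
Qed.

End Complement.

(** * Invariants of a finite group *)

Section Invariants.
Variable R : realType.
Local Notation C := (Cplx R).

Definition ev n (p : mpoly.mpoly n C) (v : 'rV[C]_n) : C :=
  mpoly.meval (fun j => v 0 j) p.

Lemma ev_act n (g : 'M[C]_n) (p : mpoly.mpoly n C) v :
  ev (poly_act g p) v = ev p (v *m g).
Proof.
rewrite /ev /poly_act mpoly.comp_mpoly_meval; apply: mpoly.meval_eq => i.
rewrite tnth_mktuple raddf_sum mxE; apply: eq_bigr => j _.
by rewrite /= mpoly.mevalZ mpoly.mevalXU mulrC.
Qed.

Lemma ev_comp n m (sigma : m.-tuple (mpoly.mpoly n C)) (Q : mpoly.mpoly m C) v :
  ev (mpoly.comp_mpoly sigma Q) v = ev Q (quot_map sigma v).
Proof.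
rewrite /ev mpoly.comp_mpoly_meval; apply: mpoly.meval_eq => i.
by rewrite mxE.
Qed.

Lemma poly_act_form n (g : 'M[C]_n) (c : 'I_n -> C) :
  poly_act g (\sum_j c j *: mpoly.mpolyX C (mpoly.mnm1 j)) =
  \sum_k (\sum_j g k j * c j) *: mpoly.mpolyX C (mpoly.mnm1 k).
Proof.
rewrite /poly_act raddf_sum /=.
under eq_bigr => j _ do rewrite mpoly.comp_mpolyZ mpoly.comp_mpolyXU
  -tnth_nth tnth_mktuple scaler_sumr.
rewrite exchange_big /=; apply: eq_bigr => k _; rewrite scaler_suml.
by apply: eq_bigr => j _; rewrite scalerA mulrC.
Qed.

Lemma poly_actMX n (g h : 'M[C]_n) m :
  poly_act g (poly_act h (mpoly.mpolyX C m)) = poly_act (g *m h) (mpoly.mpolyX C m).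
Proof.
have E (k : 'M[C]_n) : poly_act k (mpoly.mpolyX C m) = \prod_(i < n) tnth (mat_forms k) i ^+ m i.
  exact: mpoly.comp_mpolyX.
rewrite (E h) (E (g *m h)) /poly_act rmorph_prod; apply: eq_bigr => i _.
rewrite rmorphXn; congr (_ ^+ _); rewrite !tnth_mktuple.
etransitivity; first exact: poly_act_form.
by apply: eq_bigr => k _; rewrite mxE.
Qed.

(** [poly_act g p] is [v |-> p (v *m g)], so substitutions compose in the order of the matrix
    product. By linearity monomials suffice. *)
Lemma poly_actM n (g h : 'M[C]_n) p : poly_act g (poly_act h p) = poly_act (g *m h) p.
Proof.
have E (k : 'M[C]_n) : poly_act k p = \sum_(m <- mpoly.msupp p) mpoly.mcoeff m p *:
    poly_act k (mpoly.mpolyX C m).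
  exact: mpoly.comp_mpolyEX.
have Z (c : C) q : poly_act g (c *: q) = c *: poly_act g q by exact: mpoly.comp_mpolyZ.
have S (F : _ -> mpoly.mpoly n C) s : poly_act g (\sum_(m <- s) F m) = \sum_(m <- s) poly_act g (F m).
  exact: raddf_sum.
by rewrite (E h) (E (g *m h)) S; apply: eq_bigr => m _; rewrite Z poly_actMX.
Qed.

Section Group.
Variables (n : nat) (G : seq 'M[C]_n).
Hypothesis fG : finite_matrix_group G.

Lemma group_unit g : g \in G -> g \in unitmx.
Proof. by case: fG => _ h _; exact: h. Qed.

(** [undup] makes each group element count once; left translation is injective, hence a
    permutation. *)
Lemma perm_mull g : g \in G -> perm_eq [seq g *m h | h <- undup G] (undup G).
Proof.
move=> gG; have ug := group_unit gG.
have ui : uniq [seq g *m h | h <- undup G].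
  rewrite map_inj_uniq ?undup_uniq // => h1 h2 /(congr1 (mulmx (invmx g))).
  by rewrite !mulKmx.
apply: uniq_perm => //; first exact: undup_uniq.
have [|| _ //] := uniq_min_size (s2 := undup G) ui.
  move=> x /mapP[h hG ->]; move: hG; rewrite !mem_undup => hG.
  by case: fG => _ _; apply.
by rewrite size_map.
Qed.

(** Inverses are not part of the definition of the group: they come from finiteness, since
    translation by [g] reaches the identity. *)
Lemma group_inv g : g \in G -> exists2 h, h \in G & g *m h = 1%:M.
Proof.
move=> /perm_mull/perm_mem/(_ 1%:M); rewrite mem_undup.
case: fG => -> _ _ /mapP[h]; rewrite mem_undup => hG ->.
by exists h.
Qed.

Lemma group_inv' g : g \in G -> exists h, [/\ h \in G, g *m h = 1%:M & h *m g = 1%:M].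
Proof.
move=> gG; have [h hG gh] := group_inv gG; exists h; split => //.
exact: mulmx1C.
Qed.

Lemma big_mull (T : Type) (idx : T) (op : Monoid.com_law idx) (F : 'M[C]_n -> T) g :
  g \in G -> \big[op/idx]_(h <- undup G) F (g *m h) = \big[op/idx]_(h <- undup G) F h.
Proof. by move=> gG; rewrite -[RHS](perm_big _ (perm_mull gG)) big_map. Qed.

Lemma prod_invariant (p : mpoly.mpoly n C) : Defs.invariant G (\prod_(h <- undup G) poly_act h p).
Proof.
move=> g gG; transitivity (\prod_(h <- undup G) poly_act g (poly_act h p)).
  exact: rmorph_prod.
transitivity (\prod_(h <- undup G) poly_act (g *m h) p).
  by apply: eq_bigr => h _; exact: poly_actM.
exact: (big_mull _ (fun h => poly_act h p) gG).
Qed.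

Lemma sum_invariant (p : mpoly.mpoly n C) : Defs.invariant G (\sum_(h <- undup G) poly_act h p).
Proof.
move=> g gG; transitivity (\sum_(h <- undup G) poly_act g (poly_act h p)).
  exact: raddf_sum.
transitivity (\sum_(h <- undup G) poly_act (g *m h) p).
  by apply: eq_bigr => h _; exact: poly_actM.
exact: (big_mull _ (fun h => poly_act h p) gG).
Qed.

(** The isotropy groups of [v] and [v *m g] are conjugate. *)
Lemma V0_act v g : V0 G v -> g \in G -> V0 G (v *m g).
Proof.
move=> v0 gG h hG vh; have [k [kG gk kg]] := group_inv' gG.
have : g *m h *m k = 1%:M.
  apply: v0; first by case: fG => _ _ m; exact: m (m _ _ gG hG) kG.
  by rewrite !mulmxA vh -mulmxA gk mulmx1.
move=> /(congr1 (fun M => k *m M *m g)).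
by rewrite !mulmxA kg mul1mx -mulmxA kg !mulmx1 kg.
Qed.

End Group.

(** The form is sought on the moment curve with entries [t ^+ i]: pairing a nonzero vector with it
    gives a nonzero polynomial in [t], and the product of these polynomials has a non-root. *)
Lemma generic_form n (s : seq 'rV[C]_n) : 0 \notin s ->
  exists c : 'cV[C]_n, forall v, v \in s -> (v *m c) 0 0 != 0.
Proof.
move=> s0; pose P (v : 'rV[C]_n) : {poly C} := \sum_i (v 0 i) *: 'X^i.
have P0 v : v \in s -> P v != 0.
  move=> vs; apply: contraNneq s0 => Pv; suff <- : v = 0 by [].
  apply/rowP => i; rewrite mxE; have := congr1 (fun q : {poly C} => q`_i) Pv.
  rewrite coef0 /P coef_sum (bigD1 i) //= coefZ coefXn eqxx mulr1 big1 ?addr0 // => j ji.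
  by rewrite coefZ coefXn (_ : (i == j :> nat) = false) ?mulr0 //; apply/negbTE; rewrite eq_sym.
pose Q := \prod_(v <- s) P v.
have Q0 : Q != 0 by rewrite prodf_seq_neq0; apply/allP => v /P0.
have [t Qt] : exists t, Q.[t] != 0.
  apply: contrapT => h.
  pose l := [seq (i%:R : C) | i <- iota 0 (size Q)].
  have lr : all (root Q) l.
    by apply/allP => x _; apply/eqP; apply: contrapT => /eqP ?; apply: h; exists x.
  have lu : uniq l.
    by rewrite map_inj_uniq ?iota_uniq // => i j /eqP; rewrite eqr_nat => /eqP.
  by have := max_poly_roots Q0 lr lu; rewrite size_map size_iota ltnn.
exists (\col_i t ^+ i) => v vs.
move: Qt; rewrite horner_prod prodf_seq_neq0 => /allP/(_ v vs) /=.
rewrite /P horner_sum mxE; congr (_ != _); apply: eq_bigr => i _.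
by rewrite mxE hornerZ hornerXn.
Qed.

End Invariants.

(** * Invariants separating orbits and detecting free orbits *)

Section InvariantTools.
Variable R : realType.
Local Notation C := (Cplx R).

Definition lin n (c : 'cV[C]_n) : mpoly.mpoly n C :=
  \sum_j c j 0 *: mpoly.mpolyX C (mpoly.mnm1 j).

Lemma ev_lin n (c : 'cV[C]_n) v : ev (lin c) v = (v *m c) 0 0.
Proof.
rewrite mxE /ev; transitivity (\sum_j mpoly.meval (fun j => v 0 j) (c j 0 *: mpoly.mpolyX C (mpoly.mnm1 j))).
  exact: raddf_sum.
by apply: eq_bigr => j _; rewrite mpoly.mevalZ mpoly.mevalXU mulrC.
Qed.

Lemma ev_C n (k : C) (v : 'rV[C]_n) : ev (mpoly.mpolyC n k) v = k.
Proof. exact: mpoly.mevalC. Qed.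

Lemma evB n (p q : mpoly.mpoly n C) v : ev (p - q) v = ev p v - ev q v.
Proof. exact: mpoly.mevalB. Qed.

Lemma evM n (p q : mpoly.mpoly n C) v : ev (p * q) v = ev p v * ev q v.
Proof. exact: mpoly.mevalM. Qed.

Lemma evZ n k (p : mpoly.mpoly n C) v : ev (k *: p) v = k * ev p v.
Proof. exact: mpoly.mevalZ. Qed.

Lemma ev_prod n (I : Type) (s : seq I) (P : pred I) (F : I -> mpoly.mpoly n C) v :
  ev (\prod_(i <- s | P i) F i) v = \prod_(i <- s | P i) ev (F i) v.
Proof. exact: rmorph_prod. Qed.

Lemma ev_sum n (I : Type) (s : seq I) (P : pred I) (F : I -> mpoly.mpoly n C) v :
  ev (\sum_(i <- s | P i) F i) v = \sum_(i <- s | P i) ev (F i) v.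
Proof. exact: raddf_sum. Qed.

Lemma map_XsubC (A B : nzRingType) (f : {rmorphism A -> B}) (c : A) :
  map_poly f ('X - c%:P) = 'X - (f c)%:P.
Proof. by rewrite rmorphB /= map_polyX map_polyC. Qed.

Lemma prod_XsubC_coef (A : comNzRingType) (I : Type) (s : seq I) (F : I -> A) (T : A) :
  \prod_(i <- s) (T - F i) = T ^+ size s +
     \sum_(k < size s) (\prod_(i <- s) ('X - (F i)%:P))`_k * T ^+ k.
Proof.
set P := \prod_(i <- s) ('X - (F i)%:P).
have sP : size P = (size s).+1 by rewrite size_prod_XsubC.
transitivity P.[T].
  by rewrite horner_prod; apply: eq_bigr => i _; rewrite hornerXsubC.
rewrite horner_coef sP big_ord_recr /= addrC; congr (_ + _).
have /monicP : P \is monic by exact: monic_prod_XsubC.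
by rewrite /lead_coef sP /= => ->; rewrite mul1r.
Qed.

Section Generators.
Variables (n m : nat) (G : seq 'M[C]_n) (sigma : m.-tuple (mpoly.mpoly n C)).
Hypothesis fG : finite_matrix_group G.
Hypothesis gen : forall p, Defs.invariant G p ->
  exists Q : mpoly.mpoly m C, p = mpoly.comp_mpoly sigma Q.
Hypothesis inv : forall i, Defs.invariant G (tnth sigma i).
Local Notation pi := (quot_map sigma).

Lemma group1 : 1%:M \in undup G.
Proof. by rewrite mem_undup; case: fG. Qed.

Lemma quot_act v g : g \in G -> pi (v *m g) = pi v.
Proof.
move=> gG; apply/rowP => i; rewrite !mxE -!/(ev _ _) -ev_act.
by rewrite (inv i gG).
Qed.

Lemma descends p : Defs.invariant G p -> exists Q : mpoly.mpoly m C,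
  forall v, ev p v = ev Q (pi v).
Proof. by move=> /gen[Q ->]; exists Q => v; exact: ev_comp. Qed.

Lemma ev_norm (p : mpoly.mpoly n C) v :
  ev (\prod_(h <- undup G) poly_act h p) v = \prod_(h <- undup G) ev p (v *m h).
Proof. by rewrite ev_prod; apply: eq_bigr => h _; exact: ev_act. Qed.

(** If [w] were not on the orbit of [v], some affine form would vanish at [w] but nowhere on that
    orbit; the product of its translates is an invariant separating [v] from [w]. *)
Lemma separate_orbits v w : pi v = pi w -> exists2 g, g \in G & w = v *m g.
Proof.
move=> vw; apply: contrapT => nh.
have [|c hc] := @generic_form _ _ [seq v *m g - w | g <- G].
  apply/negP => /mapP[g gG /esym/eqP]; rewrite subr_eq0 => /eqP E.
  by apply: nh; exists g.
pose p := lin c - mpoly.mpolyC n ((w *m c) 0 0).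
have evp u : ev p u = ((u - w) *m c) 0 0.
  by rewrite evB ev_lin ev_C mulmxBl !mxE.
have [Q hQ] := descends (prod_invariant fG p).
have : ev Q (pi v) = ev Q (pi w) by rewrite vw.
rewrite -!hQ !ev_norm => /eqP; rewrite [X in _ == X](bigD1_seq _ group1) ?undup_uniq //=.
rewrite evp mulmx1 subrr mul0mx mxE mul0r prodf_seq_eq0 => /hasP[g].
by rewrite mem_undup => gG; rewrite /= evp (negPf (hc _ _)) //; apply/mapP; exists g.
Qed.

Lemma V0_fiber v w : V0 G v -> pi v = pi w -> V0 G w.
Proof. by move=> v0 /separate_orbits[g gG ->]; exact: V0_act. Qed.

(** Nonvanishing of the forms [u |-> (u *m g - u) *m c] at [u], for all [g] other than the identity,
    forces trivial isotropy. Choosing [c] generic for the whole orbit of [w] keeps the product of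
    all translates nonzero at [w]. *)
Lemma discriminant w : V0 G w -> exists Q : mpoly.mpoly m C,
  ev Q (pi w) != 0 /\ forall v, ev Q (pi v) != 0 -> V0 G v.
Proof.
move=> w0.
have [|c hc] := @generic_form _ _ [seq w *m k *m g - w *m k | k <- G, g <- [seq g <- G | g != 1%:M]].
  apply/negP => /allpairsP[[k g] /= [kG]]; rewrite mem_filter => /andP[g1 gG] /esym/eqP.
  rewrite subr_eq0 => /eqP E; move/eqP: g1; apply.
  exact: (V0_act fG w0 kG) gG E.
pose p := \prod_(g <- undup G | g != 1%:M) lin (g *m c - c).
have evp u : ev p u = \prod_(g <- undup G | g != 1%:M) ((u *m g - u) *m c) 0 0.
  by rewrite ev_prod; apply: eq_bigr => g _; rewrite ev_lin mulmxBr mulmxBl mulmxA.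
have [Q hQ] := descends (prod_invariant fG p).
exists Q; split.
  rewrite -hQ ev_norm prodf_seq_neq0; apply/allP => k; rewrite mem_undup => kG /=.
  rewrite evp prodf_seq_neq0; apply/allP => g; rewrite mem_undup => gG /=.
  apply/implyP => g1; apply: hc; apply/allpairsP; exists (k, g); split => //=.
  by rewrite mem_filter g1.
move=> v; rewrite -hQ ev_norm prodf_seq_neq0 => /allP/(_ _ group1) /=.
rewrite evp mulmx1 prodf_seq_neq0 => /allP h g gG vg.
apply/eqP; apply: contraT => g1; have := h g; rewrite mem_undup => /(_ gG).
by rewrite g1 /= vg subrr mul0mx mxE eqxx.
Qed.

(** A coefficient of the monic polynomial whose roots are the [i]-th coordinates along the orbit of
    a point. Being invariant it factors through [pi], so each coordinate of [v] is integral over the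
    invariants. *)
Definition coef_poly (i : 'I_n) (k : nat) : mpoly.mpoly n C :=
  (\prod_(h <- undup G) ('X - (poly_act h (lin (delta_mx i 0)))%:P))`_k.

Lemma coef_poly_invariant i k : Defs.invariant G (coef_poly i k).
Proof.
move=> g gG; rewrite /coef_poly.
pose f : {rmorphism mpoly.mpoly n C -> mpoly.mpoly n C} :=
  mpoly.comp_mpoly (mat_forms g).
have fE p : f p = poly_act g p by [].
rewrite -fE -coef_map; congr ((polyseq _)`_ k).
transitivity (\prod_(h <- undup G) map_poly f ('X - (poly_act h (lin (delta_mx i 0)))%:P)).
  exact: rmorph_prod.
transitivity (\prod_(h <- undup G) ('X - (poly_act (g *m h) (lin (delta_mx i 0)))%:P)).
  apply: eq_bigr => h _; rewrite map_XsubC.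
  by rewrite fE poly_actM.
exact: (big_mull fG _ (fun h => 'X - (poly_act h (lin (delta_mx i 0)))%:P) gG).
Qed.

Lemma ev_coef_poly i k v : ev (coef_poly i k) v =
  (\prod_(h <- undup G) ('X - ((v *m h) 0 i)%:P))`_k.
Proof.
pose f : {rmorphism mpoly.mpoly n C -> C} := mpoly.meval (fun j => v 0 j).
have fE p : f p = ev p v by [].
rewrite /coef_poly -fE -coef_map; congr ((polyseq _)`_ k).
transitivity (\prod_(h <- undup G) map_poly f ('X - (poly_act h (lin (delta_mx i 0)))%:P)).
  exact: rmorph_prod.
apply: eq_bigr => h _; rewrite map_XsubC fE.
by congr (_ - _%:P); rewrite ev_act ev_lin -colE mxE.
Qed.

Lemma char_coefs (i : 'I_n) : exists Q : nat -> mpoly.mpoly m C, forall v T,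
  \prod_(h <- undup G) (T - (v *m h) 0 i) =
  T ^+ size (undup G) + \sum_(k < size (undup G)) ev (Q k) (pi v) * T ^+ k.
Proof.
have [Q hQ] := choice (fun k => descends (coef_poly_invariant i k)).
exists Q => v T; rewrite prod_XsubC_coef; congr (_ + _); apply: eq_bigr => k _.
by rewrite -hQ ev_coef_poly.
Qed.

End Generators.
End InvariantTools.

(** * Continuity and properness of the quotient map *)

Section QuotientMap.
Variable R : realType.
Local Notation C := (Cplx R).

Lemma differentiable_sum_seq (V : normedModType C) (I : Type) (s : seq I)
  (F : I -> V -> C) (x : V) :
  (forall i, differentiable (F i) x) -> differentiable (fun v => \sum_(i <- s) F i v) x.
Proof.
move=> dF; elim: s => [|i s IH].
  rewrite (_ : (fun v => _) = cst 0); first exact: differentiable_cst.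
  by apply/funext => v; rewrite big_nil.
rewrite (_ : (fun v => _) = F i + (fun v => \sum_(i <- s) F i v)); last first.
  by apply/funext => v; rewrite big_cons.
exact: (differentiableD (dF i) IH).
Qed.

Lemma differentiable_prod_seq (V : normedModType C) (I : Type) (s : seq I)
  (F : I -> V -> C) (x : V) :
  (forall i, differentiable (F i) x) -> differentiable (fun v => \prod_(i <- s) F i v) x.
Proof.
move=> dF; elim: s => [|i s IH].
  rewrite (_ : (fun v => _) = cst 1); first exact: differentiable_cst.
  by apply/funext => v; rewrite big_nil.
rewrite (_ : (fun v => _) = F i * (fun v => \prod_(i <- s) F i v)); last first.
  by apply/funext => v; rewrite big_cons.
exact: (differentiableM (dF i) IH).
Qed.

Lemma differentiable_ev n (Q : mpoly.mpoly n C) (v : 'rV[C]_n) :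
  differentiable (fun v => ev Q v) v.
Proof.
rewrite (_ : (fun v => _) = fun v : 'rV[C]_n => \sum_(mo <- mpoly.msupp Q)
   (mpoly.mcoeff mo Q * \prod_(i <- index_enum 'I_n) v 0 i ^+ mo i)); last first.
  by apply/funext => u; rewrite /ev mpoly.mevalE.
apply: differentiable_sum_seq => mo.
apply: differentiableM; first exact: differentiable_cst.
apply: differentiable_prod_seq => i.
elim: (mo i) => [|k IH].
  rewrite (_ : (fun v => _) = cst 1); first exact: differentiable_cst.
  by apply/funext => u; rewrite expr0.
rewrite (_ : (fun v => _) = (fun u : 'rV[C]_n => u 0 i) * (fun u : 'rV[C]_n => u 0 i ^+ k)); last first.
  by apply/funext => u; rewrite exprS.
by apply: differentiableM; [exact: differentiable_coord | exact: IH].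
Qed.

Lemma ev_cont n (Q : mpoly.mpoly n C) (v : 'rV[C]_n) (e : R) : 0 < e ->
  exists2 d : R, 0 < d & forall u, nr (u - v) < d -> nr (ev Q u - ev Q v) < e.
Proof.
move=> e0; have := differentiable_continuous (differentiable_ev Q v).
by move=> /continuous_nrP/(_ e e0).
Qed.

(** The inverse of [1] plus the sum of the inverse radii lies below every radius, and is positive
    even for an empty index type. *)
Lemma fin_min (T : finType) (P : T -> R -> Prop) :
  (forall k d d', P k d -> 0 < d' -> d' <= d -> P k d') ->
  (forall k, exists2 d : R, 0 < d & P k d) -> exists2 d : R, 0 < d & forall k, P k d.
Proof.
move=> mono h; have h' k : exists d : R, 0 < d /\ P k d.
  by have [d d0 Pd] := h k; exists d.
have [d hd] := choice h'.
pose S := 1 + \sum_k (d k)^-1.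
have Sk k : (d k)^-1 < S.
  rewrite /S (bigD1 k) //= addrCA ltrDl ltr_pwDl ?sumr_ge0 // => j _.
  by rewrite invr_ge0 ltW //; case: (hd j).
have S0 : 0 < S by rewrite ltr_pwDl // sumr_ge0 // => j _; rewrite invr_ge0 ltW //; case: (hd j).
exists S^-1 => [|k]; first by rewrite invr_gt0.
have [dk0 Pk] := hd k; apply: mono Pk _ _; rewrite ?invr_gt0 //.
by rewrite -[d k]invrK lef_pV2 ?posrE ?invr_gt0 // ltW.
Qed.

(** A bound for the roots of a monic polynomial: if [t > 1], all lower powers of [t] are at most
    [t ^+ (N - 1)], by which one divides. *)
Lemma root_bound (N : nat) (t b : R) : (0 < N)%N -> 0 <= t -> 0 <= b ->
  t ^+ N <= \sum_(k < N) b * t ^+ k -> t <= 1 + N%:R * b.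
Proof.
case: N => // N _ t0 b0 h.
have Nb : 0 <= N.+1%:R * b by rewrite mulr_ge0.
have [t1|t1] := leP t 1; first by apply: le_trans t1 _; rewrite lerDl.
have tp : 0 < t by apply: lt_trans t1.
suff : t <= N.+1%:R * b by move=> h'; apply: le_trans h' _; rewrite lerDr.
rewrite -(ler_pM2r (exprn_gt0 N tp)) -exprS; apply: le_trans h _.
apply: (@le_trans _ _ (\sum_(k < N.+1) b * t ^+ N)).
  apply: ler_sum => k _; apply: ler_wpM2l => //.
  by apply: ler_weXn2l; [exact: ltW | rewrite -ltnS].
by rewrite sumr_const card_ord -[X in X <= _]mulr_natl mulrA.
Qed.

Section Generators.
Variables (n m : nat) (G : seq 'M[C]_n) (sigma : m.-tuple (mpoly.mpoly n C)).
Hypothesis fG : finite_matrix_group G.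
Hypothesis gen : forall p, Defs.invariant G p ->
  exists Q : mpoly.mpoly m C, p = mpoly.comp_mpoly sigma Q.
Hypothesis inv : forall i, Defs.invariant G (tnth sigma i).
Local Notation pi := (quot_map sigma).
Local Notation N := (size (undup G)).

Lemma pi_cont (v : 'rV[C]_n) (e : R) : 0 < e ->
  exists2 d : R, 0 < d & forall u : 'rV[C]_n, nr (u - v) < d -> nr (pi u - pi v) < e.
Proof.
move=> e0.
have [||d d0 hd] := @fin_min 'I_m (fun i d => forall u : 'rV[C]_n, nr (u - v) < d ->
   nr (ev (tnth sigma i) u - ev (tnth sigma i) v) < e).
- by move=> k d d' h _ dd u ud; apply: h; apply: lt_le_trans dd.
- by move=> k; exact: ev_cont.
exists d => // u /hd h; apply: nr_lt_coord => // j.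
by rewrite !mxE; exact: h.
Qed.

Lemma N_gt0 : (0 < N)%N.
Proof. by have := group1 fG; case: (undup G). Qed.

Lemma coord_root (i : 'I_n) (Q : nat -> mpoly.mpoly m C) :
  (forall (v : 'rV[C]_n) T, \prod_(h <- undup G) (T - (v *m h) 0 i) =
     T ^+ N + \sum_(k < N) ev (Q k) (pi v) * T ^+ k) ->
  forall v : 'rV[C]_n, v 0 i ^+ N + \sum_(k < N) ev (Q k) (pi v) * v 0 i ^+ k = 0.
Proof.
move=> hQ v; rewrite -hQ (bigD1_seq _ (group1 fG)) ?undup_uniq //=.
by rewrite mulmx1 subrr mul0r.
Qed.

Lemma proper_coord (z0 : 'rV[C]_m) (i : 'I_n) : exists B, exists2 e : R, 0 < e &
  forall v : 'rV[C]_n, nr (pi v - z0) < e -> nr (v 0 i) <= B.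
Proof.
have [Q hQ] := char_coefs fG gen i.
have [||e e0 he] := @fin_min 'I_N (fun k d => forall z : 'rV[C]_m, nr (z - z0) < d ->
   nr (ev (Q k) z - ev (Q k) z0) < 1).
- by move=> k d d' h _ dd u ud; apply: h; apply: lt_le_trans dd.
- by move=> k; apply: ev_cont.
pose b := 1 + \sum_(k < N) nr (ev (Q k) z0).
have b0 : 0 <= b by rewrite addr_ge0 // sumr_ge0 // => k _; exact: nr_ge0.
exists (1 + N%:R * b), e => // v /he hv.
apply: root_bound => //; [exact: N_gt0 | exact: nr_ge0 |].
have := coord_root hQ v => /eqP; rewrite addr_eq0 => /eqP E.
rewrite -nrX E nrN; apply: le_trans (nr_sum _ _ _) _; apply: ler_sum => k _.
rewrite nrM nrX ler_wpM2r ?exprn_ge0 ?nr_ge0 //.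
rewrite -[ev (Q k) (pi v)](subrK (ev (Q k) z0)); apply: le_trans (nrD _ _) _.
rewrite lerD ?(ltW (hv k)) // (bigD1 k) //= lerDl sumr_ge0 // => j _; exact: nr_ge0.
Qed.

Lemma proper_map (z0 : 'rV[C]_m) : exists B, exists2 e : R, 0 < e &
  forall v : 'rV[C]_n, nr (pi v - z0) < e -> nr v <= B.
Proof.
have [B hB] := choice (fun i => proper_coord z0 i).
have [||e e0 he] := @fin_min 'I_n (fun i d => forall v : 'rV[C]_n, nr (pi v - z0) < d -> nr (v 0 i) <= B i).
- by move=> k d d' h _ dd u ud; apply: h; apply: lt_le_trans dd.
- by move=> k; exact: hB.
exists (\sum_i `|B i|), e => // v hv; apply: nr_le_coord => [|i].
  by apply: sumr_ge0.
apply: le_trans (he i v hv) _; apply: le_trans (ler_norm _) _.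
by rewrite (bigD1 i) //= lerDl sumr_ge0.
Qed.

(** At [v 0 i] the monic polynomial of the orbit of [v] vanishes, so the one of the orbit of [w]
    takes a value governed by the differences of coefficients, which are small when [pi v] is near
    [pi w]. A product of [N] factors below [kap ^+ N] has a factor below [kap]. *)
Lemma near_coord (w : 'rV[C]_n) (i : 'I_n) (kap : R) : 0 < kap ->
  exists2 e : R, 0 < e & forall v : 'rV[C]_n, nr (pi v - pi w) < e ->
    exists k : 'I_N, nr (v 0 i - (w *m nth 1%:M (undup G) k) 0 i) < kap.
Proof.
move=> kap0; have [Q hQ] := char_coefs fG gen i.
have [B [e1 e10 hB]] := proper_coord (pi w) i.
pose S := 1 + \sum_(k < N) `|B| ^+ k.
have S0 : 0 < S by rewrite ltr_pwDl // sumr_ge0 // => k _; rewrite exprn_ge0.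
have [||e2 e20 he] := @fin_min 'I_N (fun k d => forall z : 'rV[C]_m, nr (z - pi w) < d ->
   nr (ev (Q k) z - ev (Q k) (pi w)) < kap ^+ N / S).
- by move=> k d d' h _ dd u ud; apply: h; apply: lt_le_trans dd.
- by move=> k; apply: ev_cont; rewrite divr_gt0 // exprn_gt0.
exists (Num.min e1 e2); first by rewrite lt_min e10.
move=> v; rewrite lt_min => /andP[/hB vB /he vQ].
have vB' : nr (v 0 i) <= `|B| by apply: le_trans vB (ler_norm _).
have small : nr (\prod_(h <- undup G) (v 0 i - (w *m h) 0 i)) < kap ^+ N.
  rewrite hQ (_ : _ + _ = \sum_(k < N) (ev (Q k) (pi w) - ev (Q k) (pi v)) * v 0 i ^+ k); last first.
    have /eqP := coord_root hQ v; rewrite addr_eq0 => /eqP ->.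
    by rewrite addrC -sumrB; apply: eq_bigr => k _; rewrite mulrBl.
  apply: le_lt_trans (nr_sum _ _ _) _.
  apply: (@le_lt_trans _ _ (\sum_(k < N) kap ^+ N / S * `|B| ^+ k)).
    apply: ler_sum => k _; rewrite nrM nrX nrBC.
    apply: ler_pM; [exact: nr_ge0| by rewrite exprn_ge0 ?nr_ge0|exact: ltW (vQ k)|].
    by apply: lerXn2r; rewrite ?nnegrE ?nr_ge0.
  rewrite -mulr_sumr mulrAC ltr_pdivrMr // ltr_pM2l ?exprn_gt0 //.
  by rewrite /S ltrDr.
apply: contrapT => nh; move: small; rewrite ltNge => /negP; apply.
have big k : (k < N)%N -> kap <= nr (v 0 i - (w *m nth 1%:M (undup G) k) 0 i).
  by move=> kN; rewrite leNgt; apply/negP => h; apply: nh; exists (Ordinal kN).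
move: big; elim: (undup G) => [|h s IH] big; first by rewrite big_nil nr1 expr0.
rewrite big_cons nrM exprS; apply: ler_pM; rewrite ?exprn_ge0 ?(ltW kap0) //.
  exact: (big 0%N).
by apply: IH => k ks; exact: (big k.+1).
Qed.

(* Coordinatewise, [v] is close to a point of a finite grid containing the orbit
   of [w]; grid points outside the orbit have a different image under [pi]. *)
Lemma near_orbit (w : 'rV[C]_n) (eta : R) : 0 < eta ->
  exists2 e : R, 0 < e & forall v : 'rV[C]_n, nr (pi v - pi w) < e ->
    exists2 g, g \in G & nr (v - w *m g) < eta.
Proof.
move=> eta0.
pose u (s : {ffun 'I_n -> 'I_N}) : 'rV[C]_n :=
  \row_i (w *m nth 1%:M (undup G) (s i)) 0 i.
have [||e1 e10 he1] := @fin_min {ffun 'I_n -> 'I_N} (fun s d => forall v : 'rV[C]_n,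
   nr (v - u s) < d -> nr (pi v - pi w) < d -> exists2 g, g \in G & u s = w *m g).
- move=> k d d' h _ dd v h1 h2; apply: (h v); first exact: lt_le_trans dd.
  exact: lt_le_trans dd.
- move=> s; have [us|us] := eqVneq (pi (u s)) (pi w).
    have [g gG E] := separate_orbits fG gen (esym us).
    by exists 1 => // _ _ _; exists g.
  pose c := nr (pi (u s) - pi w).
  have c0 : 0 < c by rewrite nr_gt0 subr_eq0.
  have [d d0 hd] := pi_cont (u s) (divr_gt0 c0 (ltr0n R 2)).
  exists (Num.min d (c / 2)); first by rewrite lt_min d0 divr_gt0.
  move=> v; rewrite !lt_min => /andP[/hd h1 _] /andP[_ h2]; exfalso.
  have h3 : nr (pi (u s) - pi v) < c / 2 by rewrite nrBCv; exact: h1.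
  have := le_lt_trans (nr_triv (pi v) (pi (u s)) (pi w)) (ltrD h3 h2).
  by rewrite -splitr ltxx.
pose kap := Num.min eta e1.
have kap0 : 0 < kap by rewrite lt_min eta0.
have [||e2 e20 he2] := @fin_min 'I_n (fun i d => forall v : 'rV[C]_n, nr (pi v - pi w) < d ->
    exists k : 'I_N, nr (v 0 i - (w *m nth 1%:M (undup G) k) 0 i) < kap).
- by move=> k d d' h _ dd v hv; apply: h; apply: lt_le_trans dd.
- by move=> i; exact: near_coord.
exists (Num.min e1 e2); first by rewrite lt_min e10.
move=> v; rewrite lt_min => /andP[v1 v2].
have [s hs] := choice (fun i => he2 i v v2).
have vs : nr (v - u [ffun i => s i]) < kap.
  apply: nr_lt_coord => // i; move: (hs i).
  by congr (nr _ < _); rewrite !mxE ffunE.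
move: (vs); rewrite lt_min => /andP[v3 v4].
have [g gG E] := he1 _ v v4 v1.
by exists g => //; rewrite -E.
Qed.

End Generators.
End QuotientMap.

(** * The quotient map over free orbits *)

Section Etale.
Variable R : realType.
Local Notation C := (Cplx R).
Variables (n m : nat) (G : seq 'M[C]_n) (sigma : m.-tuple (mpoly.mpoly n C)).
Hypothesis fG : finite_matrix_group G.
Hypothesis gen : forall p, Defs.invariant G p ->
  exists Q : mpoly.mpoly m C, p = mpoly.comp_mpoly sigma Q.
Hypothesis inv : forall i, Defs.invariant G (tnth sigma i).
Local Notation pi := (quot_map sigma).

Definition little (w : 'rV[C]_n) (F : 'rV[C]_n -> C) := forall e : R, 0 < e ->
  exists2 d : R, 0 < d & forall v : 'rV[C]_n, nr (v - w) < d -> nr (F v) <= e * nr (v - w).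

Lemma littleD w F1 F2 : little w F1 -> little w F2 -> little w (fun v => F1 v + F2 v).
Proof.
move=> h1 h2 e e0; have [d1 d10 k1] := h1 _ (divr_gt0 e0 (ltr0n R 2)).
have [d2 d20 k2] := h2 _ (divr_gt0 e0 (ltr0n R 2)).
exists (Num.min d1 d2); first by rewrite lt_min d10.
move=> v; rewrite lt_min => /andP[/k1 q1 /k2 q2]; apply: le_trans (nrD _ _) _.
by apply: le_trans (lerD q1 q2) _; rewrite -mulrDl -splitr.
Qed.

Lemma little_sum w (I : eqType) (s : seq I) (F : I -> 'rV[C]_n -> C) :
  (forall i, i \in s -> little w (F i)) -> little w (fun v => \sum_(i <- s) F i v).
Proof.
elim: s => [|i s IH] h.
  move=> e e0; exists 1 => // v _; rewrite big_nil nr0 mulr_ge0 ?nr_ge0 //; exact: ltW.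
have h1 := h i (mem_head _ _).
have h2 := IH (fun j js => h j (mem_behead (s := i :: s) js)).
move=> e e0; have [d d0 hd] := littleD h1 h2 e0.
by exists d => // v /hd; rewrite big_cons.
Qed.

Lemma ev_square_factor k (X Y Z : mpoly.mpoly k C) v :
  ev (X * (Y * Y * Z)) v = ev Y v ^+ 2 * ev (X * Z) v.
Proof. by rewrite !evM expr2 mulrCA. Qed.

Lemma ev_bounded k (Q : mpoly.mpoly k C) (v : 'rV[C]_k) : exists2 M : R, 0 < M &
  exists2 d : R, 0 < d & forall u : 'rV[C]_k, nr (u - v) < d -> nr (ev Q u) <= M.
Proof.
have [d d0 hd] := ev_cont Q v ltr01; exists (nr (ev Q v) + 1); first by rewrite ltr_wpDl ?nr_ge0.
exists d => // u /hd h; rewrite -[ev Q u](subrK (ev Q v)) addrC.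
by apply: le_trans (nrD _ _) _; rewrite lerD2l ltW.
Qed.

(* The trace over [G] of a polynomial equal to [v_i - w_i] to first order at [w]
   and vanishing to second order at the other points of the orbit of [w]. *)
Lemma invariant_coordinate (w : 'rV[C]_n) (i : 'I_n) : V0 G w ->
  exists Q : mpoly.mpoly m C,
  little w (fun v => ev Q (pi v) - ev Q (pi w) - (v 0 i - w 0 i)).
Proof.
move=> w0; have G1 := group1 fG.
have [|c hc] := @generic_form _ _ [seq w - w *m g | g <- [seq g <- G | g != 1%:M]].
  apply/negP => /mapP[g]; rewrite mem_filter => /andP[g1 gG] /esym/eqP.
  rewrite subr_eq0 => /eqP E; move/eqP: g1; apply.
  by apply: w0 => //; rewrite -E.
pose kap g : C := ((w - w *m g) *m c) 0 0.
have kap0 g : g \in undup G -> g != 1%:M -> kap g != 0.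
  move=> gG g1; apply: hc; apply/mapP; exists g => //.
  by rewrite mem_filter g1 -mem_undup.
(* For [g] in the group other than the identity, the affine form [A g] is [1] at [w] and [0] at
   [w *m g]. The product [B] of their squares is thus [1] at [w] and vanishes to second order at the
   other orbit points. *)
pose A g : mpoly.mpoly n C := (kap g)^-1 *: (lin c - mpoly.mpolyC n ((w *m g *m c) 0 0)).
have evA g u : ev (A g) u = (kap g)^-1 * ((u - w *m g) *m c) 0 0.
  by rewrite evZ evB ev_lin ev_C mulmxBl !mxE.
pose X : mpoly.mpoly n C := lin (delta_mx i 0) - mpoly.mpolyC n (w 0 i).
have evX u : ev X u = u 0 i - w 0 i by rewrite evB ev_lin ev_C -colE mxE.
pose B := \prod_(g <- undup G | g != 1%:M) (A g * A g).
pose p := X * B.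
have [Q hQ] := descends gen (sum_invariant fG p).
exists Q.
have evp u : ev p u = (u 0 i - w 0 i) * ev B u by rewrite evM evX.
have B1 : ev B w = 1.
  rewrite ev_prod big1_seq // => g /andP[g1 gG]; rewrite evM evA -/(kap g).
  by rewrite mulVf ?kap0 // mulr1.
have term1 : little w (fun v => ev p (v *m 1%:M) - (v 0 i - w 0 i)).
  move=> e e0; have [d d0 hd] := ev_cont B w e0; exists d => // v /hd h.
  rewrite mulmx1 evp -[X in nr (_ - X)]mulr1 -mulrBr nrM mulrC -B1.
  apply: ler_pM; rewrite ?nr_ge0 ?(ltW h) //.
  by have := nr_coord (v - w) i; rewrite !mxE.
have termk k : k \in undup G -> k != 1%:M -> little w (fun v => ev p (v *m k)).
  move=> kG k1.
  pose r := X * \prod_(g <- rem k (undup G) | g != 1%:M) (A g * A g).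
  (* The factor belonging to [k] is split off: for [v] near [w], its square is quadratic in [v - w],
     and the remaining factor [r] is bounded. *)
  have E v : ev p (v *m k) = (ev (A k) (v *m k)) ^+ 2 * ev (poly_act k r) v.
    have Bk : B = A k * A k * \prod_(g <- rem k (undup G) | g != 1%:M) (A g * A g).
      by rewrite /B (big_rem k) //= k1.
    by rewrite ev_act /p /r Bk ev_square_factor.
  have [M M0 [d d0 hd]] := ev_bounded (poly_act k r) w.
  have [K K0 hK] := nr_mulmx (k *m c).
  have Ak v : nr (ev (A k) (v *m k)) <= nr (kap k)^-1 * K * nr (v - w).
    rewrite evA nrM -mulrA ler_wpM2l ?nr_ge0 // -mulmxBl -mulmxA.
    exact: le_trans (nr_coord _ _) (hK _).
  pose L := (nr (kap k)^-1 * K) ^+ 2 * M + 1.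
  have L0 : 0 < L by rewrite ltr_wpDl // mulr_ge0 ?exprn_ge0 ?mulr_ge0 ?nr_ge0 // ltW.
  move=> e e0; exists (Num.min d (e / L)); first by rewrite lt_min d0 divr_gt0.
  move=> v; rewrite lt_min => /andP[/hd q1]; rewrite ltr_pdivlMr // => q2.
  rewrite E nrM nrX.
  have q3 : nr (ev (A k) (v *m k)) ^+ 2 <= (nr (kap k)^-1 * K * nr (v - w)) ^+ 2.
    by apply: lerXn2r; rewrite ?nnegrE ?mulr_ge0 ?nr_ge0 // ltW.
  apply: le_trans (ler_pM _ _ q3 q1) _; rewrite ?exprn_ge0 ?nr_ge0 //.
  have -> : (nr (kap k)^-1 * K * nr (v - w)) ^+ 2 * M = (L - 1) * nr (v - w) * nr (v - w).
    by rewrite /L; ring.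
  apply: ler_wpM2r; rewrite ?nr_ge0 //; apply: le_trans (ltW q2).
  by rewrite mulrC ler_wpM2l ?nr_ge0 // gerBl.
pose D k v := ev p (v *m k) - (if k == 1%:M then v 0 i - w 0 i else 0).
have lD : little w (fun v => \sum_(k <- undup G) D k v).
  apply: little_sum => k kG; have [k1|k1] := eqVneq k 1%:M.
    by move=> e e0; have [d d0 hd] := term1 e e0; exists d => // v /hd; rewrite /D k1 eqxx.
  move=> e e0; have [d d0 hd] := termk k kG k1 e e0; exists d => // v /hd.
  by rewrite /D (negPf k1) subr0.
have sD v : \sum_(k <- undup G) D k v = ev Q (pi v) - (v 0 i - w 0 i).
  rewrite -hQ ev_sum sumrB; congr (_ - _).
    by apply: eq_bigr => k _; rewrite ev_act.
  rewrite (bigD1_seq _ G1) ?undup_uniq //= eqxx big1 ?addr0 // => k /negPf -> //.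
(* Read off from the first-order estimate at [v = w]. *)
have Qw : ev Q (pi w) = 0.
  have [d d0 hd] := lD 1 ltr01; have := hd w; rewrite subrr nr0 mulr0 sD subrr subr0.
  by move=> /(_ d0); rewrite le_eqVlt ltNge nr_ge0 orbF nr_eq0 => /eqP.
move=> e e0; have [d d0 hd] := lD e e0; exists d => // v /hd.
by rewrite sD Qw subr0.
Qed.

Lemma uniform_mulmx (s : seq 'M[C]_n) : exists2 K : R, 1 <= K &
  forall g, g \in s -> forall v : 'rV[C]_n, nr (v *m g) <= K * nr v.
Proof.
elim: s => [|g s [K K1 hK]]; first by exists 1.
have [L L0 hL] := nr_mulmx g.
exists (K + L) => [|h]; first by apply: le_trans K1 _; rewrite lerDl ltW.
rewrite inE => /predU1P[->|hs] v.
  by apply: le_trans (hL v) _; rewrite ler_wpM2r ?nr_ge0 // lerDr (le_trans ler01).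
by apply: le_trans (hK _ hs v) _; rewrite ler_wpM2r ?nr_ge0 // lerDl ltW.
Qed.

Lemma orbit_gap (w : 'rV[C]_n) : V0 G w -> exists2 c : R, 0 < c &
  forall g, g \in G -> nr (w - w *m g) < c -> g = 1%:M.
Proof.
move=> w0.
have : forall s : seq 'M[C]_n, {subset s <= G} -> exists2 c : R, 0 < c &
  forall g, g \in s -> nr (w - w *m g) < c -> g = 1%:M.
  elim=> [|g s IH] sG; first by exists 1.
  have [c c0 hc] := IH (fun x xs => sG x (mem_behead (s := g :: s) xs)).
  have [g1|g1] := eqVneq g 1%:M.
    by exists c => // h; rewrite inE => /predU1P[->//|]; exact: hc.
  have d0 : 0 < nr (w - w *m g).
    rewrite nr_gt0 subr_eq0; apply: contra g1 => /eqP E; apply/eqP.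
    by apply: w0 => //; apply: sG; exact: mem_head.
  exists (Num.min c (nr (w - w *m g))); first by rewrite lt_min c0.
  move=> h; rewrite inE lt_min => /predU1P[->|hs] /andP[h1 h2]; last exact: hc.
  by rewrite ltxx in h2.
by move=> /(_ G (fun x => id)).
Qed.

(** [S] selects the preimage near [w]: a translate of any preimage lies there by [near_orbit], and
    only one does, since nearby points of one orbit differ by the identity. Continuity is stated
    along values of [pi], as [S] is controlled only on its image. *)
Lemma local_section (w : 'rV[C]_n) : V0 G w -> exists2 e : R, 0 < e &
  exists S : 'rV[C]_m -> 'rV[C]_n, [/\ S (pi w) = w,
   forall v, nr (pi v - pi w) < e -> pi (S (pi v)) = pi v &
   forall v1, nr (pi v1 - pi w) < e -> forall k : R, 0 < k ->
     exists2 d : R, 0 < d & forall v2, nr (pi v2 - pi w) < e ->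
       nr (pi v2 - pi v1) < d -> nr (S (pi v2) - S (pi v1)) < k].
Proof.
move=> w0; have [c c0 hc] := orbit_gap w0; have [K K1 hK] := uniform_mulmx G.
have K0 : 0 < K by apply: lt_le_trans K1.
(* In [rig], [w - w *m g] is a sum of two terms below [r] and one of at most [K * r]. *)
pose r := c / (2 + K).
have r0 : 0 < r by rewrite divr_gt0 // addr_gt0.
have rc : (2 + K) * r = c by rewrite /r mulrC divfK // gt_eqF // addr_gt0.
have rK : 0 < r / K by rewrite divr_gt0.
have [e e0 he] := near_orbit fG gen w rK.
pose P z v := pi v = z /\ nr (v - w) < r.
pose S z := xget w [set v | P z v].
have rig v1 v2 g : nr (v1 - w) < r -> nr (v2 - w) < r -> g \in G ->
    nr (v2 - v1 *m g) < r -> g = 1%:M.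
  move=> h1 h2 gG h3; apply: hc => //.
  have h4 : nr ((v1 - w) *m g) <= K * r.
    by apply: le_trans (hK _ gG _) _; rewrite ler_wpM2l ?ltW.
  have -> : w - w *m g = (w - v2) + (v2 - v1 *m g) + (v1 - w) *m g.
    rewrite mulmxBl; move: (w *m g) (v1 *m g) => a b.
    by apply/rowP => j; rewrite !mxE; ring.
  apply: le_lt_trans (nrDv _ _) _; apply: le_lt_trans (lerD (nrDv _ _) (lexx _)) _.
  rewrite -rc mulrDl mulr2n mulrDl mul1r.
  by rewrite ltr_leD // ltrD // nrBCv.
have Sex v : nr (pi v - pi w) < e -> P (pi v) (S (pi v)).
  move=> /he[g gG hg]; apply: (@xgetPex _ w [set u | P (pi v) u]).
  have [h [hG gh hg1]] := group_inv' fG gG.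
  exists (v *m h); split; first exact: (quot_act inv).
  have -> : v *m h - w = (v - w *m g) *m h by rewrite mulmxBl -mulmxA gh mulmx1.
  by apply: le_lt_trans (hK _ hG _) _; rewrite mulrC -ltr_pdivlMr.
have Sw : S (pi w) = w.
  have [h1 h2] : P (pi w) (S (pi w)) by apply: Sex; rewrite subrr nr0.
  have [g gG E] := separate_orbits fG gen (esym h1).
  suff g1 : g = 1%:M by rewrite E g1 mulmx1.
  by apply: (rig w (S (pi w))) => //; rewrite ?subrr ?nr0 // -E subrr nr0.
exists e => //; exists S; split => // [v /Sex[]//|v1 h1 k k0].
have [E1 n1] := Sex v1 h1.
have mk : 0 < Num.min k r by rewrite lt_min k0.
have [d d0 hd] := near_orbit fG gen (S (pi v1)) mk.
exists d => // v2 h2 h12; have [E2 n2] := Sex v2 h2.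
have [|g gG] := hd (S (pi v2)); first by rewrite E1 E2.
rewrite lt_min => /andP[hk hr].
have g1 := rig _ _ _ n1 n2 gG hr.
by move: hk; rewrite g1 mulmx1.
Qed.

End Etale.

(** * Paths and lifting *)

Section Paths.
Variable R : realType.
Local Notation C := (Cplx R).

(** Paths and homotopies are total functions, extended from the unit interval by [clamp], so that
    gluing meets no domain conditions. *)
Definition contR (V : normedModType C) (u : R -> V) := forall t (e : R), 0 < e ->
  exists2 d : R, 0 < d & forall s, `|s - t| < d -> nr (u s - u t) < e.

Definition contR2 (V : normedModType C) (h : R -> R -> V) := forall s t (e : R), 0 < e ->
  exists2 d : R, 0 < d & forall s' t', `|s' - s| < d -> `|t' - t| < d ->
    nr (h s' t' - h s t) < e.

Definition lipR (f : R -> R) := exists2 K : R, 0 < K &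
  forall s t, `|f s - f t| <= K * `|s - t|.

Definition clamp (a b t : R) := Num.max a (Num.min b t).

Lemma clamp_in a b t : a <= b -> a <= clamp a b t <= b.
Proof. by move=> ab; rewrite le_max lexx /= ge_max ab ge_min lexx. Qed.

Lemma clamp_id a b t : a <= t <= b -> clamp a b t = t.
Proof. by move=> /andP[ta tb]; rewrite /clamp (min_idPr tb) (max_idPr ta). Qed.

Lemma clamp_le a b t : a <= b -> t <= a -> clamp a b t = a.
Proof.
move=> ab ta; rewrite /clamp; apply/max_idPl.
by rewrite ge_min ta orbT.
Qed.

Lemma clamp_ge a b t : a <= b -> b <= t -> clamp a b t = b.
Proof. by move=> ab tb; rewrite /clamp (min_idPl tb) (max_idPr ab). Qed.

Lemma clampK a b t : a <= b -> clamp a b (clamp a b t) = clamp a b t.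
Proof. by move=> ab; rewrite clamp_id // clamp_in. Qed.

Lemma lip_clamp a b : a <= b -> lipR (clamp a b).
Proof.
move=> ab; exists 1 => // s t; rewrite mul1r.
wlog st : s t / t <= s.
  move=> h; have [st|st] := leP t s; first exact: h.
  by rewrite distrC [leRHS]distrC; apply: h; exact: ltW.
have cst : clamp a b t <= clamp a b s.
  by rewrite /clamp ge_max le_max lexx /= le_max; apply/orP; right; rewrite le_min !ge_min lexx st orbT.
rewrite !ger0_norm ?subr_ge0 //.
rewrite lerBlDr /clamp ge_max; apply/andP; split.
  rewrite -[X in X <= _]add0r lerD ?subr_ge0 //= le_max lexx //.
have [bt|bt] := leP b t.
  rewrite (min_idPl (le_trans bt st)) -[X in X <= _]add0r lerD ?subr_ge0 //.
  by rewrite le_max lexx orbT.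
rewrite ge_min; apply/orP; right; rewrite -lerBlDl subKr le_max lexx orbT //.
Qed.

Lemma lip_affine a b : lipR (fun t => a + b * t).
Proof.
exists (`|b| + 1) => [|s t]; first by rewrite ltr_pwDr.
rewrite (_ : _ - _ = b * (s - t)); last by ring.
by rewrite normrM ler_wpM2r // lerDl.
Qed.

Lemma lip_cst a : lipR (fun=> a).
Proof. by exists 1 => // s t; rewrite subrr normr0 mul1r. Qed.

Section Closure.
Variable V : normedModType C.

Lemma contR_lip (u : R -> V) f : contR u -> lipR f -> contR (fun t => u (f t)).
Proof.
move=> cu [K K0 hK] t e e0; have [d d0 hd] := cu (f t) e e0.
exists (d / K) => [|s]; first exact: divr_gt0.
by rewrite ltr_pdivlMr // mulrC => st; apply: hd; apply: le_lt_trans st.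
Qed.

Lemma contR2_lip (h : R -> R -> V) f g : contR2 h -> lipR f -> lipR g ->
  contR2 (fun s t => h (f s) (g t)).
Proof.
move=> ch [K K0 hK] [L L0 hL] s t e e0; have [d d0 hd] := ch (f s) (g t) e e0.
exists (Num.min (d / K) (d / L)); first by rewrite lt_min !divr_gt0.
move=> s' t'; rewrite !lt_min !ltr_pdivlMr // => /andP[h1 _] /andP[_ h2].
apply: hd; first by apply: le_lt_trans (hK _ _) _; rewrite mulrC.
by apply: le_lt_trans (hL _ _) _; rewrite mulrC.
Qed.

Lemma contR2_slice (h : R -> R -> V) s : contR2 h -> contR (h s).
Proof.
move=> ch t e e0; have [d d0 hd] := ch s t e e0; exists d => // t' tt.
by apply: hd => //; rewrite subrr normr0.
Qed.

Lemma contR2_swap (h : R -> R -> V) : contR2 h -> contR2 (fun s t => h t s).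
Proof.
move=> ch s t e e0; have [d d0 hd] := ch t s e e0; exists d => // s' t' h1 h2.
exact: hd.
Qed.

Lemma contR2_slice' (h : R -> R -> V) t : contR2 h -> contR (h^~ t).
Proof. by move=> /contR2_swap /(contR2_slice t). Qed.

Lemma contR2D (h k : R -> R -> V) : contR2 h -> contR2 k ->
  contR2 (fun s t => h s t + k s t).
Proof.
move=> ch ck s t e e0; have e2 : 0 < e / 2 by rewrite divr_gt0.
have [d d0 hd] := ch s t _ e2; have [d' d0' hd'] := ck s t _ e2.
exists (Num.min d d'); first by rewrite lt_min d0.
move=> s' t'; rewrite !lt_min => /andP[h1 h2] /andP[h3 h4].
rewrite opprD addrACA; apply: le_lt_trans (nrD _ _) _.
by rewrite [e]splitr ltrD ?hd ?hd'.
Qed.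

Lemma contR2N (h : R -> R -> V) : contR2 h -> contR2 (fun s t => - h s t).
Proof.
move=> ch s t e e0; have [d d0 hd] := ch s t _ e0; exists d => // s' t' h1 h2.
by rewrite -opprD nrN; exact: hd.
Qed.

Lemma contR2_of (u : R -> V) : contR u -> contR2 (fun _ t => u t).
Proof.
move=> cu s t e e0; have [d d0 hd] := cu t e e0.
by exists d => // s' t' _; exact: hd.
Qed.

Lemma contRD (u v : R -> V) : contR u -> contR v -> contR (fun t => u t + v t).
Proof.
move=> cu cv; exact: (contR2_slice 0 (contR2D (contR2_of cu) (contR2_of cv))).
Qed.

Lemma contR_cst (v : V) : contR (fun=> v).
Proof. by move=> t e e0; exists 1 => // s _; rewrite subrr nr0. Qed.

End Closure.

Lemma contR_mulmx p k (A : 'M[C]_(p, k)) (u : R -> 'rV[C]_p) :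
  contR u -> contR (fun t => u t *m A).
Proof.
have [K K0 hK] := nr_mulmx A.
move=> cu t e e0; have [d d0 hd] := cu t _ (divr_gt0 e0 K0).
exists d => // s /hd; rewrite -mulmxBl ltr_pdivlMr // mulrC.
by apply: le_lt_trans.
Qed.

Lemma contR2_mulmx p k (A : 'M[C]_(p, k)) (h : R -> R -> 'rV[C]_p) :
  contR2 h -> contR2 (fun s t => h s t *m A).
Proof.
have [K K0 hK] := nr_mulmx A.
move=> cu s t e e0; have [d d0 hd] := cu s t _ (divr_gt0 e0 K0).
exists d => // s' t' h1 h2; rewrite -mulmxBl; apply: le_lt_trans (hK _) _.
by rewrite mulrC -ltr_pdivlMr //; exact: hd.
Qed.

Lemma contR_comp p k (f : 'rV[C]_p -> 'rV[C]_k) (u : R -> 'rV[C]_p) :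
  contR u -> (forall t, {for u t, continuous f}) -> contR (fun t => f (u t)).
Proof.
move=> cu cf t e e0; have [d d0 hd] := (iffLR (continuous_nrP f (u t))) (cf t) e e0.
by have [d' d0' hd'] := cu t d d0; exists d' => // s /hd' /hd.
Qed.

Section Within.
Variable k : nat.

Lemma clamp01_in t : (0 : R) <= clamp 0 1 t <= 1.
Proof. exact: clamp_in ler01. Qed.

Lemma within_contR (u : R -> 'rV[C]_k) :
  {within @unit_interval R, continuous u} -> contR (fun t => u (clamp 0 1 t)).
Proof.
move=> /subspace_continuousP cu t e e0.
have [d d0 hd] : exists2 d : R, 0 < d & forall s, `|s - clamp 0 1 t| < d ->
    0 <= s <= 1 -> nr (u s - u (clamp 0 1 t)) < e.
  have /cu h : @unit_interval R (clamp 0 1 t).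
    by rewrite /unit_interval /= in_itv /= clamp01_in.
  have : nbhs (u (clamp 0 1 t)) [set v | nr (v - u (clamp 0 1 t)) < e].
    by apply/nbhs_nrP; exists e.
  move=> /h; rewrite /= /within /= => /nbhs_ballP[d /= d0 hd].
  exists d => // s sd s01; apply: hd; last by rewrite /unit_interval /= in_itv.
  by rewrite -ball_normE /ball_ /= distrC.
have [K K0 hK] := lip_clamp (@ler01 R).
exists (d / K) => [|s]; first exact: divr_gt0.
rewrite ltr_pdivlMr // mulrC => st; apply: hd; last exact: clamp01_in.
exact: le_lt_trans st.
Qed.

Lemma contR_within (u : R -> 'rV[C]_k) :
  contR u -> {within @unit_interval R, continuous u}.
Proof.
move=> cu; apply: continuous_subspaceT => t P /nbhs_nrP[e e0 eP].
have [d d0 hd] := cu t e e0; apply/nbhs_ballP; exists d => // s.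
by rewrite -ball_normE /ball_ /= distrC => /hd /eP.
Qed.

Lemma within_contR2 (H : R * R -> 'rV[C]_k) :
  {within @unit_interval R `*` @unit_interval R, continuous H} ->
  contR2 (fun s t => H (clamp 0 1 s, clamp 0 1 t)).
Proof.
move=> /subspace_continuousP cH s t e e0.
pose x := (clamp 0 1 s, clamp 0 1 t).
have [d d0 hd] : exists2 d : R, 0 < d & forall s' t', `|s' - x.1| < d -> `|t' - x.2| < d ->
    0 <= s' <= 1 -> 0 <= t' <= 1 -> nr (H (s', t') - H x) < e.
  have /cH h : (@unit_interval R `*` @unit_interval R) x.
    by rewrite /unit_interval; split; rewrite /= in_itv /= clamp01_in.
  have : nbhs (H x) [set v | nr (v - H x) < e].
    by apply/nbhs_nrP; exists e.
  move=> /h; rewrite /= /within /= => /nbhs_ballP[d /= d0 hd].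
  exists d => // s' t' h1 h2 s01 t01; apply: hd; last by split; rewrite /unit_interval /= in_itv.
  by split; rewrite -ball_normE /ball_ /= distrC.
have [K K0 hK] := lip_clamp (@ler01 R).
exists (d / K) => [|s' t']; first exact: divr_gt0.
rewrite !ltr_pdivlMr // ![_ * K]mulrC => h1 h2; apply: hd; last exact: clamp01_in.
- exact: le_lt_trans (hK _ _) h1.
- exact: le_lt_trans (hK _ _) h2.
- exact: clamp01_in.
Qed.

Lemma contR2_within (h : R -> R -> 'rV[C]_k) : contR2 h ->
  {within @unit_interval R `*` @unit_interval R, continuous (fun st : R * R => h st.1 st.2)}.
Proof.
move=> ch; apply: continuous_subspaceT => -[s t] P /nbhs_nrP[e e0 eP].
have [d d0 hd] := ch s t e e0; apply/nbhs_ballP; exists d => // -[s' t'] [/=].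
rewrite -!ball_normE /ball_ /= => h1 h2; apply: eP; apply: hd; rewrite distrC //.
Qed.

End Within.
End Paths.

(** * Uniqueness of lifts and homotopy lifting *)

Section Lifting.
Variable R : realType.
Local Notation C := (Cplx R).
Variables (n m : nat) (G : seq 'M[C]_n) (sigma : m.-tuple (mpoly.mpoly n C)).
Hypothesis fG : finite_matrix_group G.
Hypothesis gen : forall p, Defs.invariant G p ->
  exists Q : mpoly.mpoly m C, p = mpoly.comp_mpoly sigma Q.
Hypothesis inv : forall i, Defs.invariant G (tnth sigma i).
Local Notation pi := (quot_map sigma).

Lemma Z0_V0 v : Z0 G sigma (pi v) -> V0 G v.
Proof. by case=> w w0 /(V0_fiber fG gen w0). Qed.

(** Close to a common value [w] the two lifts differ by a group element that hardly moves [w], hence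
    by the identity; so coincidence is open along the way from [a] to [t], and by continuity it is
    closed. *)
Lemma unique_lift (u1 u2 : R -> 'rV[C]_n) (a : R) : contR u1 -> contR u2 ->
  (forall t, V0 G (u1 t)) -> (forall t, pi (u1 t) = pi (u2 t)) ->
  u1 a = u2 a -> forall t, u1 t = u2 t.
Proof.
move=> c1 c2 v1 E Ea t.
pose tau s := a + (t - a) * s.
have c1' : contR (fun s => u1 (tau s)) := contR_lip c1 (lip_affine a (t - a)).
have c2' : contR (fun s => u2 (tau s)) := contR_lip c2 (lip_affine a (t - a)).
suff : u1 (tau 1) = u2 (tau 1) by rewrite /tau mulr1 addrC subrK.
apply: (@real_induction _ (fun s => u1 (tau s) = u2 (tau s))).
- by rewrite /tau mulr0 addr0.
- move=> s _ Es; pose w := u1 (tau s).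
  have [c c0 hc] := orbit_gap (v1 (tau s)); have [K K1 hK] := uniform_mulmx G.
  have K2 : 0 < 1 + K by rewrite addr_gt0 // (lt_le_trans _ K1).
  (* [w - w *m g] is bounded by the deviation of [u2] plus [K] times that of [u1]. *)
  have e0 : 0 < c / (1 + K) by rewrite divr_gt0.
  have [d1 d10 h1] := c1' s _ e0; have [d2 d20 h2] := c2' s _ e0.
  exists (Num.min d1 d2); first by rewrite lt_min d10.
  move=> s'; rewrite lt_min => /andP[/h1 q1 /h2 q2].
  have [g gG Eg] := separate_orbits fG gen (E (tau s')).
  suff g1 : g = 1%:M by rewrite Eg g1 mulmx1.
  apply: hc => //; rewrite -/w in q1 *; rewrite -Es -/w in q2.
  have -> : w - w *m g = (w - u2 (tau s')) + (u1 (tau s') - w) *m g.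
    by rewrite mulmxBl -Eg addrA subrK.
  apply: le_lt_trans (nrDv _ _) _; rewrite nrBCv.
  apply: lt_le_trans (ltr_leD q2 (le_trans (hK _ gG _) (ler_wpM2l (le_trans ler01 K1) (ltW q1)))) _.
  by rewrite -[X in X + _]mul1r -mulrDl mulrC divfK // gt_eqF.
- move=> s /andP[s0 _] hs; apply/eqP; rewrite -subr_eq0 -nr_eq0 eq_le nr_ge0 andbT.
  apply/ler_addgt0Pl => e e0; rewrite addr0.
  have e2 : 0 < e / 2 by rewrite divr_gt0.
  have [d1 d10 h1] := c1' s _ e2; have [d2 d20 h2] := c2' s _ e2.
  pose d := Num.min d1 d2; have d0 : 0 < d by rewrite lt_min d10.
  pose s' := Num.max 0 (s - d / 2).
  have ss : s' < s by rewrite gt_max s0 /= ltrBlDr ltrDl divr_gt0.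
  have s'0 : 0 <= s' by rewrite le_max lexx.
  have sd : `|s' - s| < d.
    rewrite ler0_norm ?subr_le0 ?(ltW ss) // opprB ltrBlDr -ltrBlDl.
    by rewrite lt_max; apply/orP; right; rewrite ltrD2l ltrN2 ltr_pdivrMr // ltr_pMr // ltr1n.
  have /andP[sd1 sd2] : (`|s' - s| < d1) && (`|s' - s| < d2) by rewrite -lt_min.
  have q1 := h1 _ sd1; have q2 := h2 _ sd2.
  have Es : u1 (tau s') = u2 (tau s') by apply: hs; rewrite s'0.
  apply: le_trans (nr_triv (u1 (tau s')) _ _) _; rewrite nrBCv {2}Es.
  by rewrite [e]splitr lerD // ltW.
Qed.

Definition liftable (H : R -> R -> 'rV[C]_m) (a b c d : R) :=
  exists2 h : R -> R -> 'rV[C]_n, contR2 h &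
    forall s t, a <= s <= b -> c <= t <= d -> pi (h s t) = H s t.

(** On the common edge the two lifts differ by one fixed [g], by uniqueness; translating the second
    by [g] makes them agree there. *)
Lemma liftable_hglue H a e b c d : (forall s t, Z0 G sigma (H s t)) ->
  a <= e -> e <= b -> c <= d -> liftable H a e c d -> liftable H e b c d ->
  liftable H a b c d.
Proof.
move=> HZ ae eb cd [h1 ch1 E1] [h2 ch2 E2].
have cdl := lip_clamp cd.
pose u1 t := h1 e (clamp c d t); pose u2 t := h2 e (clamp c d t).
have Eu1 t : pi (u1 t) = H e (clamp c d t).
  by apply: E1; rewrite ?clamp_in ?lexx ?ae.
have Eu2 t : pi (u2 t) = H e (clamp c d t).
  by apply: E2; rewrite ?clamp_in ?lexx ?eb.
have cu1 : contR u1 := contR_lip (contR2_slice e ch1) cdl.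
have cu2 : contR u2 := contR_lip (contR2_slice e ch2) cdl.
have [g gG Eg] : exists2 g, g \in G & u1 c = u2 c *m g.
  by apply: (separate_orbits fG gen); rewrite Eu1 Eu2.
have Eu t : u1 t = u2 t *m g.
  apply: (@unique_lift u1 (fun t => u2 t *m g) c cu1 (contR_mulmx g cu2)) => // s.
    by apply: Z0_V0; rewrite Eu1.
  by rewrite (quot_act inv) // Eu1 Eu2.
(* Sum of the two lifts minus their common edge value: on either side of [e] one clamp is stuck at
   [e] and that summand cancels, so continuity needs no case distinction. *)
exists (fun s t => h1 (clamp a e s) (clamp c d t) + h2 (clamp e b s) (clamp c d t) *m g
          - h1 e (clamp c d t)).
  apply: contR2D; last first.
    apply: contR2N; exact: (contR2_lip ch1 (lip_cst e) cdl).
  apply: contR2D; first exact: (contR2_lip ch1 (lip_clamp ae) cdl).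
  apply: contR2_mulmx; exact: (contR2_lip ch2 (lip_clamp eb) cdl).
move=> s t /andP[sa sb] tcd.
have [se|se] := leP s e.
  rewrite (clamp_le eb se) -/(u2 t) -Eu -/(u1 t) addrK.
  by rewrite !clamp_id ?sa ?se // E1 // sa se.
rewrite (clamp_ge ae (ltW se)) -/(u1 t) addrC addrA addNr add0r.
rewrite (quot_act inv) // !clamp_id ?sb ?(ltW se) // E2 // sb ltW //.
Qed.

Lemma liftable_swap H a b c d : liftable H a b c d -> liftable (fun s t => H t s) c d a b.
Proof.
move=> [h ch Eh]; exists (fun s t => h t s); first exact: contR2_swap.
by move=> s t hs ht; exact: Eh.
Qed.

Lemma liftable_vglue H a b c e d : (forall s t, Z0 G sigma (H s t)) ->
  a <= b -> c <= e -> e <= d -> liftable H a b c e -> liftable H a b e d ->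
  liftable H a b c d.
Proof.
move=> HZ ab ce ed /liftable_swap l1 /liftable_swap l2.
apply: (@liftable_swap (fun s t => H t s)).
by apply: (liftable_hglue _ ce ed ab l1 l2) => s t; exact: HZ.
Qed.

(** A small rectangle is mapped into the domain of a local section and lifted by it; bisection glues
    the pieces. *)
Lemma lift_square (H : R -> R -> 'rV[C]_m) : contR2 H ->
  (forall s t, Z0 G sigma (H s t)) -> liftable H 0 1 0 1.
Proof.
move=> cH HZ; apply: rect_ind => //.
- move=> a b c d _ ab _ _ cd _ l1 l2 l3 l4.
  have [g1 g2 _ _] := half_bounds ab; have [k1 k2 _ _] := half_bounds cd.
  apply: (liftable_vglue HZ ab k1 k2).
    exact: (liftable_hglue HZ g1 g2 k1 l1 l2).
  exact: (liftable_hglue HZ g1 g2 k2 l3 l4).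
- move=> p q _ _; have [w w0 Ew] := HZ p q.
  have [e e0 [S [Sw SE Sc]]] := local_section fG gen inv w0.
  have [r r0 hr] := cH p q e e0.
  exists r => // a b c d _ /andP[ap pb] _ _ /andP[cq qd] _ abr cdr.
  have ab := le_trans ap pb; have cd := le_trans cq qd.
  have ball s t : a <= s <= b -> c <= t <= d -> nr (H s t - pi w) < e.
    move=> /andP[s1 s2] /andP[t1 t2]; rewrite Ew; apply: hr.
      by apply: le_lt_trans abr; rewrite ler_norml; lra.
    by apply: le_lt_trans cdr; rewrite ler_norml; lra.
  exists (fun s t => S (H (clamp a b s) (clamp c d t))).
    move=> s t k k0.
    have cHc := contR2_lip cH (lip_clamp ab) (lip_clamp cd).
    have in0 s' t' : nr (H (clamp a b s') (clamp c d t') - pi w) < e.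
      by apply: ball; rewrite clamp_in.
    have [v _ Ev] := HZ (clamp a b s) (clamp c d t).
    have [|x x0 hx] := Sc v _ k k0; first by rewrite Ev; exact: in0.
    have [y y0 hy] := cHc s t x x0.
    exists y => // s' t' h1 h2; rewrite -Ev.
    have [v' _ Ev'] := HZ (clamp a b s') (clamp c d t').
    rewrite -Ev'; apply: hx; rewrite Ev'; first exact: in0.
    by rewrite Ev; exact: hy.
  move=> s t hs ht; rewrite !clamp_id //; have [v _ Ev] := HZ s t.
  by rewrite -Ev SE // Ev; exact: ball.
Qed.

(* Homotopy lifting: the lift of [H] starting at [v0] is constant on the sides
   [t = 0] and [t = 1], so its left edge is closed if its right edge is. *)
Lemma homotopy_closed (H : R -> R -> 'rV[C]_m) (l d : R -> 'rV[C]_n) (v0 : 'rV[C]_n) :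
  contR2 H -> (forall s t, Z0 G sigma (H s t)) -> contR l -> contR d ->
  (forall t, pi (l t) = H 0 t) -> (forall t, pi (d t) = H 1 t) ->
  (forall s, H s 0 = pi v0) -> (forall s, H s 1 = pi v0) ->
  l 0 = v0 -> d 0 = v0 -> d 1 = v0 -> l 1 = v0.
Proof.
move=> cH HZ cl cd El Ed H0 H1 l0 d0 d1.
have [h ch Eh] := lift_square cH HZ.
pose h' s t := h (clamp 0 1 s) (clamp 0 1 t).
have c01 := lip_clamp (@ler01 R).
have ch' : contR2 h' := contR2_lip ch c01 c01.
have Eh' s t : pi (h' s t) = H (clamp 0 1 s) (clamp 0 1 t) by apply: Eh; exact: clamp01_in.
have V s t : V0 G (h' s t) by apply: Z0_V0; rewrite Eh'.
have c0 : clamp 0 1 0 = 0 :> R by rewrite clamp_id // lexx ler01.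
have c1 : clamp 0 1 1 = 1 :> R by rewrite clamp_id // lexx ler01.
have [g gG Eg] : exists2 g, g \in G & v0 = h' 0 0 *m g.
  by apply: (separate_orbits fG gen); rewrite Eh' c0 H0.
pose k s t := h' s t *m g.
have ck : contR2 k := contR2_mulmx g ch'.
have Vk s t : V0 G (k s t) by exact: V0_act.
have Ek s t : pi (k s t) = H (clamp 0 1 s) (clamp 0 1 t) by rewrite (quot_act inv).
have bot s : k s 0 = v0.
  rewrite (@unique_lift (k^~ 0) (fun=> v0) 0 (contR2_slice' 0 ck) (contR_cst v0)) //.
  by move=> t; rewrite Ek c0 H0.
have right t : k 1 (clamp 0 1 t) = d (clamp 0 1 t).
  apply: (@unique_lift (fun t => k 1 (clamp 0 1 t)) (fun t => d (clamp 0 1 t)) 0).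
  - exact: (contR_lip (contR2_slice 1 ck) c01).
  - exact: (contR_lip cd c01).
  - by move=> u; exact: Vk.
  - by move=> u; rewrite Ek Ed c1 clampK.
  - by rewrite c0 bot d0.
have left t : k 0 (clamp 0 1 t) = l (clamp 0 1 t).
  apply: (@unique_lift (fun t => k 0 (clamp 0 1 t)) (fun t => l (clamp 0 1 t)) 0).
  - exact: (contR_lip (contR2_slice 0 ck) c01).
  - exact: (contR_lip cl c01).
  - by move=> u; exact: Vk.
  - by move=> u; rewrite Ek El c0 clampK.
  - by rewrite c0 bot l0.
have top s : k s 1 = v0.
  rewrite (@unique_lift (k^~ 1) (fun=> v0) 1 (contR2_slice' 1 ck) (contR_cst v0)) //.
    by move=> t; rewrite Ek c1 H1.
  by have := right 1; rewrite c1 d1.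
by have := left 1; rewrite c1 top.
Qed.

End Lifting.

(** * Paths given together with their lifts *)

Section LiftedPaths.
Variable R : realType.
Local Notation C := (Cplx R).

Lemma hasd_row p n (g : 'rV[C]_p -> 'rV[C]_n) (x : 'rV[C]_p) :
  (forall i, differentiable (fun y => g y 0 i : C) x) -> exists A, hasd g x A.
Proof.
move=> dg.
pose A : 'M[C]_(p, n) := \matrix_(j, i) ('d (fun y => g y 0 i : C) x (delta_mx 0 j)).
exists A => e e0.
have [||d d0 hd] := @fin_min _ 'I_n (fun i d => forall h : 'rV[C]_p, nr h < d ->
   nr (g (x + h) 0 i - g x 0 i - 'd (fun y => g y 0 i : C) x h) <= e * nr h).
- by move=> k d d' h _ dd v hv; apply: h; apply: lt_le_trans dd.
- by move=> i; have [d d0 hd] := differentiable_nr (dg i) e0; exists d.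
exists d => // h hh; apply: nr_le_coord => [|i]; first by rewrite mulr_ge0 ?nr_ge0 // ltW.
move: (hd i h hh); rewrite linear_mulmx.
congr (nr _ <= _); rewrite !mxE; congr (_ - _).
by apply: eq_bigr => j _; rewrite mxE.
Qed.

(** Stands in for the inverse function theorem: [E] is [F] read in coordinates tangent to the
    identity at [F x], so [F] has the same derivative as [E]. *)
Lemma differentiable_of_coordinates p n (F E : 'rV[C]_p -> 'rV[C]_n) (x : 'rV[C]_p) A :
  hasd E x A ->
  (forall e : R, 0 < e -> exists2 d : R, 0 < d & forall h : 'rV[C]_p, nr h < d ->
     nr (E (x + h) - E x - (F (x + h) - F x)) <= e * nr (F (x + h) - F x)) ->
  differentiable F x.
Proof.
move=> hA hE; have [K K0 hK] := nr_mulmx A.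
have h2 : 0 < 2^-1 :> R by rewrite invr_gt0.
(* Tolerance [1/2] allows absorption: the increment [u] of [F] satisfies
   [nr u <= (K + 1) * nr h + 2^-1 * nr u], whence the Lipschitz constant [L]. *)
have [d1 d10 q1] := hA 1 ltr01; have [d2 d20 q2] := hE _ h2.
pose L := 2 * (K + 1).
have L0 : 0 < L by rewrite mulr_gt0 // addr_gt0.
have lip h : nr h < d1 -> nr h < d2 -> nr (F (x + h) - F x) <= L * nr h.
  move=> /q1 k1 /q2 k2; have k3 := hK h.
  have k4 : nr (E (x + h) - E x) <= (K + 1) * nr h.
    rewrite -[_ - _](subrK (h *m A)); apply: le_trans (nrDv _ _) _.
    by rewrite mulrDl addrC; exact: lerD.
  set u := F (x + h) - F x in k2 *.
  have k5 : nr u <= nr (E (x + h) - E x) + nr (E (x + h) - E x - u).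
    by apply: le_trans (nrBv _ _); rewrite subKr.
  have k6 := le_trans k5 (lerD k4 k2).
  rewrite /L -mulrA -ler_pdivrMl //.
  by move: k6; rewrite -lerBlDr -{1}[nr u]mul1r -mulrBl (_ : 1 - 2^-1 = 2^-1) //; field.
apply: (@differentiable_mulmx _ _ _ _ A) => e e0.
have [d3 d30 q3] := hA _ (divr_gt0 e0 (ltr0n R 2)).
have [d4 d40 q4] := hE _ (divr_gt0 (divr_gt0 e0 (ltr0n R 2)) L0).
exists (Num.min (Num.min d1 d2) (Num.min d3 d4)); first by rewrite !lt_min d10 d20 d30.
move=> h; rewrite !lt_min => /andP[/andP[h1 h2'] /andP[/q3 k3 /q4 k4]].
rewrite (_ : _ - h *m A = (E (x + h) - E x - h *m A) - (E (x + h) - E x - (F (x + h) - F x))); last first.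
  by move: (h *m A) => B; apply/rowP => i; rewrite !mxE; ring.
apply: le_trans (nrBv _ _) _; rewrite [e in leRHS]splitr mulrDl; apply: lerD => //.
apply: le_trans k4 _; apply: (@le_trans _ _ (e / 2 / L * (L * nr h))).
  by rewrite ler_wpM2l ?lip // !divr_ge0 ?(ltW e0) ?(ltW L0).
by rewrite mulrA divfK // gt_eqF.
Qed.

Variables (n m p : nat) (G : seq 'M[C]_n) (sigma : m.-tuple (mpoly.mpoly n C)).
Hypothesis fG : finite_matrix_group G.
Hypothesis gen : forall p, Defs.invariant G p ->
  exists Q : mpoly.mpoly m C, p = mpoly.comp_mpoly sigma Q.
Hypothesis inv : forall i, Defs.invariant G (tnth sigma i).
Local Notation pi := (quot_map sigma).
Variables (U1 : set 'rV[C]_p) (f : 'rV[C]_p -> 'rV[C]_m).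
Hypothesis oU1 : forall x, U1 x -> exists2 e : R, 0 < e &
  forall y : 'rV[C]_p, nr (y - x) < e -> U1 y.
Hypothesis df : forall x, U1 x -> differentiable f x.
Hypothesis fZ : forall x, U1 x -> Z0 G sigma (f x).

(** Stationarity outside [[0, 1]] makes concatenation a sum of rescaled paths minus the common
    point. *)
Definition lifted_path a u b v := exists (gamma : R -> 'rV[C]_p) (delta : R -> 'rV[C]_n),
  [/\ contR gamma, contR delta, forall t, U1 (gamma t),
      forall t, pi (delta t) = f (gamma t) &
      (forall t, t <= 0 -> gamma t = a /\ delta t = u) /\
      (forall t, 1 <= t -> gamma t = b /\ delta t = v)].

Lemma lifted_path_end a u b v : lifted_path a u b v -> U1 b /\ pi v = f b.
Proof.
move=> [g [d [_ _ hU hE [_ h1]]]]; have [<- <-] := h1 1 (lexx _).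
by split.
Qed.

Lemma lifted_path_refl a u : U1 a -> pi u = f a -> lifted_path a u a u.
Proof.
move=> Ua E; exists (fun=> a), (fun=> u); split => //; exact: contR_cst.
Qed.

Lemma contR_cat k (u v : R -> 'rV[C]_k) (b : 'rV[C]_k) : contR u -> contR v ->
  contR (fun t => u (0 + 2 * t) + v (-1 + 2 * t) - b).
Proof.
move=> cu cv; apply: contRD; last exact: contR_cst.
by apply: contRD; [exact: (contR_lip cu (lip_affine 0 2)) | exact: (contR_lip cv (lip_affine (-1) 2))].
Qed.

Lemma lifted_path_cat a u b v c w : lifted_path a u b v -> lifted_path b v c w ->
  lifted_path a u c w.
Proof.
move=> [g1 [d1 [cg1 cd1 U1g E1 [s1 e1]]]] [g2 [d2 [cg2 cd2 U2g E2 [s2 e2]]]].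
pose g t := g1 (0 + 2 * t) + g2 (-1 + 2 * t) - b.
pose d t := d1 (0 + 2 * t) + d2 (-1 + 2 * t) - v.
have lo t : t <= 2^-1 -> g t = g1 (0 + 2 * t) /\ d t = d1 (0 + 2 * t).
  move=> ht; have [|gb dv] := s2 (-1 + 2 * t); first lra.
  by rewrite /g /d gb dv !addrK.
have hi t : 2^-1 <= t -> g t = g2 (-1 + 2 * t) /\ d t = d2 (-1 + 2 * t).
  move=> ht; have [|gb dv] := e1 (0 + 2 * t); first lra.
  by rewrite /g /d gb dv !(addrC b) !(addrC v) !addrK.
exists g, d; split.
- exact: contR_cat.
- exact: contR_cat.
- by move=> t; have [/lo[-> _]|/ltW/hi[-> _]] := leP t 2^-1.
- by move=> t; have [/lo[-> ->]|/ltW/hi[-> ->]] := leP t 2^-1.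
- split=> t ht.
    have [|-> ->] := lo t; first lra.
    by apply: s1; lra.
  have [|-> ->] := hi t; first lra.
  by apply: e2; lra.
Qed.

Lemma lifted_path_rev a u b v : lifted_path a u b v -> lifted_path b v a u.
Proof.
move=> [g [d [cg cd hU hE [s e]]]].
exists (fun t => g (1 + -1 * t)), (fun t => d (1 + -1 * t)); split.
- exact: (contR_lip cg (lip_affine 1 (-1))).
- exact: (contR_lip cd (lip_affine 1 (-1))).
- by move=> t; exact: hU.
- by move=> t; exact: hE.
- by split=> t ht; [apply: e | apply: s]; lra.
Qed.

Lemma lifted_path_act a u b v g : g \in G -> lifted_path a u b v ->
  lifted_path a (u *m g) b (v *m g).
Proof.
move=> gG [ga [d [cg cd hU hE [s e]]]].
exists ga, (fun t => d t *m g); split => //.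
- exact: contR_mulmx.
- by move=> t; rewrite (quot_act inv).
- by split=> t ht; [have [-> ->] := s t ht | have [-> ->] := e t ht].
Qed.

(** Straight segments stay in a small ball around [x], where [f] followed by a local section lifts
    them. *)
Lemma local_lift x : U1 x -> exists2 r : R, 0 < r & exists S : 'rV[C]_m -> 'rV[C]_n,
  [/\ forall y : 'rV[C]_p, nr (y - x) < r -> U1 y,
   forall y y' : 'rV[C]_p, nr (y - x) < r -> nr (y' - x) < r ->
     lifted_path y (S (f y)) y' (S (f y')) &
   forall k : R, 0 < k -> exists2 d : R, 0 < d &
     forall y : 'rV[C]_p, nr (y - x) < d -> nr (S (f y) - S (f x)) < k].
Proof.
move=> Ux; have [w w0 Ew] := fZ Ux.
have [e e0 [S [Sw SE Sc]]] := local_section fG gen inv w0.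
have cf y : U1 y -> {for y, continuous f} by move=> /df /differentiable_continuous.
have [r1 r10 h1] := oU1 Ux.
have [r2 r20 h2] := (iffLR (continuous_nrP f x)) (cf x Ux) e e0.
pose r := Num.min r1 r2.
have inU (y : 'rV[C]_p) : nr (y - x) < r -> U1 y.
  by rewrite lt_min => /andP[/h1].
have inB (y : 'rV[C]_p) : nr (y - x) < r -> nr (f y - pi w) < e.
  by rewrite lt_min Ew => /andP[_ /h2].
have r0 : 0 < r by rewrite lt_min r10.
exists r => //; exists S; split => // [y y' yr yr'|k k0].
- pose seg t : 'rV[C]_p := y + (((clamp 0 1 t)%:C)%C : C) *: (y' - y).
  have segr t : nr (seg t - x) < r.
    have /andP[t0 t1] := clamp01_in t; set u := clamp 0 1 t in t0 t1 *.
    have -> : seg t - x = (((1 - u)%:C)%C : C) *: (y - x) + ((u%:C)%C : C) *: (y' - x).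
      by apply/rowP => j; rewrite !mxE rmorphB rmorph1 /=; ring.
    apply: le_lt_trans (nrDv _ _) _; rewrite !nrZ !nr_real (ger0_norm t0) ger0_norm ?subr_ge0 //.
    have q0 : 0 <= 1 - u by rewrite subr_ge0.
    move: yr yr'; move: (nr (y - x)) (nr (y' - x)) => A B Ar Br.
    apply: (@le_lt_trans _ _ ((1 - u) * Num.max A B + u * Num.max A B)).
      by rewrite lerD // ler_wpM2l // le_max lexx ?orbT.
    by rewrite -mulrDl subrK mul1r gt_max Ar.
  have cseg : contR seg.
    have cl : contR (fun s => y + ((s%:C)%C : C) *: (y' - y)).
      move=> t k k0; exists (k / (nr (y' - y) + 1)) => [|s].
        by rewrite divr_gt0 // ltr_wpDl ?nr_ge0.
      rewrite ltr_pdivlMr ?ltr_wpDl ?nr_ge0 // => ks.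
      rewrite opprD addrACA subrr add0r -scalerBl -rmorphB nrZ nr_real.
      apply: le_lt_trans ks; rewrite ler_wpM2l // lerDl //.
    exact: (contR_lip cl (lip_clamp (@ler01 R))).
  have cfs : contR (fun t => f (seg t)).
    by apply: contR_comp cseg _ => t; apply: cf; exact: inU.
  have rg t : exists2 v, V0 G v & pi v = f (seg t) by apply: fZ; exact: inU.
  exists seg, (fun t => S (f (seg t))); split => //.
  + move=> t k k0; have [v _ Ev] := rg t.
    have [|d d0 hd] := Sc v _ k k0; first by rewrite Ev; exact: inB.
    have [d' d0' hd'] := cfs t d d0; exists d' => // s /hd' hs.
    have [v' _ Ev'] := rg s.
    have q1 : nr (pi v' - pi w) < e by rewrite Ev'; exact: inB.
    have q2 : nr (pi v' - pi v) < d by rewrite Ev' Ev.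
    by have := hd v' q1 q2; rewrite Ev Ev'.
  + by move=> t; apply: inU.
  + by move=> t; have [v _ Ev] := rg t; rewrite -Ev SE // Ev; exact: inB.
  + split=> t ht; rewrite /seg.
      by rewrite clamp_le // rmorph0 scale0r addr0.
    by rewrite clamp_ge // rmorph1 scale1r [y + _]addrC subrK.
- have [v _ Ev] := fZ Ux.
  have [|d d0 hd] := Sc v _ k k0; first by rewrite Ev Ew subrr nr0.
  have [d' d0' hd'] := (iffLR (continuous_nrP f x)) (cf x Ux) d d0.
  exists (Num.min d' r); first by rewrite lt_min d0'.
  move=> y; rewrite lt_min => /andP[/hd' hy yr].
  have [v' _ Ev'] := fZ (inU y yr).
  have q1 : nr (pi v' - pi w) < e by rewrite Ev'; exact: inB.
  have q2 : nr (pi v' - pi v) < d by rewrite Ev' Ev.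
  by have := hd v' q1 q2; rewrite Ev Ev'.
Qed.

Variables (x0 : 'rV[C]_p) (v0 : 'rV[C]_n).
Hypotheses (Ux0 : U1 x0) (Ev0 : pi v0 = f x0).

Lemma V0_base : V0 G v0.
Proof. by apply: (Z0_V0 fG gen); rewrite Ev0; exact: fZ. Qed.

(** Being symmetric in [y] and [y'], this makes both the reachable set and its complement open. *)
Lemma reach_open x : U1 x -> exists2 r : R, 0 < r & forall y y' : 'rV[C]_p,
  nr (y - x) < r -> nr (y' - x) < r ->
  (exists v, lifted_path x0 v0 y v) -> exists v, lifted_path x0 v0 y' v.
Proof.
move=> Ux; have [r r0 [S [inU pS _]]] := local_lift Ux; exists r => // y y' yr yr' [v hv].
have [_ Ev] := lifted_path_end hv.
have [_ Ey] := lifted_path_end (pS _ _ yr yr).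
have [g gG Eg] := separate_orbits fG gen (etrans Ey (esym Ev)).
exists (S (f y') *m g); apply: (lifted_path_cat hv); rewrite Eg.
by apply: lifted_path_act => //; exact: pS.
Qed.

Hypothesis loops : forall gamma : R -> 'rV[C]_p, loop_in U1 x0 gamma ->
  exists delta : R -> 'rV[C]_n, loop_in (V0 G) v0 delta /\
    loop_homotopic (Z0 G sigma) (f x0) (f \o gamma) (pi \o delta).

(** With [v2 = v1 *m g] and [h] inverse to [g], the first path followed by the reversed second one,
    translated by [h], is a loop whose lift runs from [v0] to [v0 *m h]. The hypothesis on loops and
    homotopy lifting close this lift, and freeness at [v0] gives [h = 1]. *)
Lemma reach_unique x v1 v2 : lifted_path x0 v0 x v1 -> lifted_path x0 v0 x v2 -> v1 = v2.
Proof.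
move=> l1 l2; have [Ux E1] := lifted_path_end l1; have [_ E2] := lifted_path_end l2.
have [g gG Eg] := separate_orbits fG gen (etrans E1 (esym E2)).
have [h [hG gh hg]] := group_inv' fG gG.
have := lifted_path_act hG (lifted_path_rev l2).
rewrite Eg -mulmxA gh mulmx1 => /(lifted_path_cat l1).
move=> [ga [d [cga cd hU hE [s e]]]].
have lga : loop_in U1 x0 ga.
  split; first exact: contR_within.
  - by move=> _ [t _ <-].
  - by case: (s 0 (lexx _)).
  - by case: (e 1 (lexx _)).
have [d' [[cd' imd' d'0 d'1] [H [cH imH H01 Hs]]]] := loops lga.
have u01 t : @unit_interval R (clamp 0 1 t).
  by rewrite /unit_interval /= in_itv /= clamp01_in.
have u0 : @unit_interval R 0 by rewrite /unit_interval /= in_itv /= lexx ler01.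
have u1 : @unit_interval R 1 by rewrite /unit_interval /= in_itv /= lexx ler01.
have c0 : clamp 0 1 0 = 0 :> R by rewrite clamp_id // lexx ler01.
have c1 : clamp 0 1 1 = 1 :> R by rewrite clamp_id // lexx ler01.
have c01 := lip_clamp (@ler01 R).
have fin : d (clamp 0 1 1) = v0.
  apply: (homotopy_closed fG gen inv (H := fun s t => H (clamp 0 1 s, clamp 0 1 t))
     (l := fun t => d (clamp 0 1 t)) (d := fun t => d' (clamp 0 1 t))).
  - exact: within_contR2.
  - by move=> a b; apply: imH; exists (clamp 0 1 a, clamp 0 1 b); [split; exact: u01|].
  - exact: (contR_lip cd c01).
  - exact: within_contR.
  - by move=> t; rewrite c0 (H01 _ (u01 t)).1 hE.
  - by move=> t; rewrite c1 (H01 _ (u01 t)).2.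
  - by move=> a; rewrite c0 (Hs _ (u01 a)).1 Ev0.
  - by move=> a; rewrite c1 (Hs _ (u01 a)).2 Ev0.
  - by rewrite c0; case: (s 0 (lexx _)).
  - by rewrite c0.
  - by rewrite c1.
have [_ E3] := e 1 (lexx _); rewrite c1 E3 in fin.
have h1 : h = 1%:M by apply: V0_base.
by move: gh; rewrite h1 mulmx1 => ->; rewrite mulmx1.
Qed.

(** By uniqueness of endpoints [F] is, near [x], a translated local section composed with [f], hence
    continuous at [x]. The invariants that serve as coordinates at [F x] then turn differentiability
    of [f] into that of [F]. *)
Lemma lift_on_complement : (forall x, U1 x -> exists v, lifted_path x0 v0 x v) ->
  exists F : 'rV[C]_p -> 'rV[C]_n, (forall x, U1 x -> pi (F x) = f x) /\
    (forall x, U1 x -> differentiable F x).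
Proof.
move=> reach; pose F x := xget 0 [set v | lifted_path x0 v0 x v].
have FP x : U1 x -> lifted_path x0 v0 x (F x).
  by move=> /reach[v hv]; apply: (@xgetPex _ 0 [set v | lifted_path x0 v0 x v]); exists v.
have FE x : U1 x -> pi (F x) = f x by move=> /FP /lifted_path_end[].
exists F; split => // x Ux.
have [r r0 [S [inU pS cS]]] := local_lift Ux.
have [K K1 hK] := uniform_mulmx G.
have xr : nr (x - x) < r by rewrite subrr nr0.
have [_ Ex] := lifted_path_end (pS _ _ xr xr).
have [g gG Eg] := separate_orbits fG gen (etrans Ex (esym (FE x Ux))).
have FS (y : 'rV[C]_p) : nr (y - x) < r -> F y = S (f y) *m g.
  move=> yr; apply: (reach_unique (FP y (inU y yr))).
  apply: (lifted_path_cat (FP x Ux)); rewrite Eg.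
  by apply: lifted_path_act => //; exact: pS.
have VF : V0 G (F x) by apply: (Z0_V0 fG gen); rewrite FE //; exact: fZ.
have [Q hQ] := choice (fun i => invariant_coordinate fG gen i VF).
pose E (y : 'rV[C]_p) : 'rV[C]_n := \row_i ev (Q i) (f y).
have [A hA] : exists A, hasd E x A.
  apply: hasd_row => i.
  have -> : (fun y => E y 0 i : C) = (fun z => ev (Q i) z) \o f.
    by apply/funext => y; rewrite /= mxE.
  apply: differentiable_comp; [exact: df | exact: differentiable_ev].
apply: (differentiable_of_coordinates hA) => e e0.
have [||d d0 hd] := @fin_min _ 'I_n (fun i d => forall v : 'rV[C]_n, nr (v - F x) < d ->
   nr (ev (Q i) (pi v) - ev (Q i) (pi (F x)) - (v 0 i - F x 0 i)) <= e * nr (v - F x)).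
- by move=> k d d' h _ dd v hv; apply: h; apply: lt_le_trans dd.
- by move=> i; exact: hQ.
have K0 : 0 < K by apply: lt_le_trans K1.
have [d2 d20 hd2] := cS _ (divr_gt0 d0 K0).
exists (Num.min r d2); first by rewrite lt_min r0.
move=> h; rewrite lt_min => /andP[hr hd2'].
have xh : x + h - x = h by rewrite addrAC subrr add0r.
have xhr : nr (x + h - x) < r by rewrite xh.
have Fd : nr (F (x + h) - F x) < d.
  rewrite (FS _ xhr) (FS _ xr) -mulmxBl; apply: le_lt_trans (hK _ gG _) _.
  by rewrite mulrC -ltr_pdivlMr //; apply: hd2; rewrite xh.
apply: nr_le_coord => [|i]; first by rewrite mulr_ge0 ?nr_ge0 // ltW.
move: (hd i _ Fd); rewrite !FE //; last exact: inU.
by congr (nr _ <= _); rewrite !mxE.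
Qed.

End LiftedPaths.

(** * The lifting criterion *)

Section Main.
Variable R : realType.
Local Notation C := (Cplx R).

Lemma loop_condition_of_lift (n m p : nat)
    (G : seq 'M[C]_n) (sigma : m.-tuple (mpoly.mpoly n C))
    (U : set 'rV[C]_p) (f : 'rV[C]_p -> 'rV[C]_m) x0 v0 (F : 'rV[C]_p -> 'rV[C]_n) gamma :
  finite_matrix_group G ->
  (forall p, Defs.invariant G p ->
    exists Q : mpoly.mpoly m C, p = mpoly.comp_mpoly sigma Q) ->
  (forall i, Defs.invariant G (tnth sigma i)) ->
  holomorphic_on U F -> (forall x, U x -> quot_map sigma (F x) = f x) ->
  U x0 -> quot_map sigma v0 = f x0 ->
  loop_in (U `&` f @^-1` Z0 G sigma) x0 gamma ->
  exists delta : R -> 'rV[C]_n, loop_in (V0 G) v0 delta /\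
    loop_homotopic (Z0 G sigma) (f x0) (f \o gamma) (quot_map sigma \o delta).
Proof.
move=> fG gen inv hF FE Ux0 Ev0 [cga imga ga0 ga1].
have [g gG Eg] := separate_orbits fG gen (etrans (FE _ Ux0) (esym Ev0)).
pose ga t := gamma (clamp 0 1 t).
have c0 : clamp 0 1 0 = 0 :> R by rewrite clamp_id // lexx ler01.
have c1 : clamp 0 1 1 = 1 :> R by rewrite clamp_id // lexx ler01.
have cl t : unit_interval t -> clamp 0 1 t = t.
  by rewrite /unit_interval /= in_itv /= => ht; rewrite clamp_id.
have in_ga t : U (ga t) /\ Z0 G sigma (f (ga t)).
  have [] : (U `&` f @^-1` Z0 G sigma) (ga t); last by split.
  apply: imga; exists (clamp 0 1 t) => //.
  by rewrite /unit_interval /= in_itv /= clamp01_in.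
have cF : contR (fun t => F (ga t)).
  apply: (contR_comp (within_contR cga)) => t.
  by apply: differentiable_continuous; apply: hF; exact: (in_ga t).1.
pose delta t := F (ga t) *m g.
have Ed t : quot_map sigma (delta t) = f (ga t).
  by rewrite (quot_act inv) // FE //; exact: (in_ga t).1.
have cd : contR delta := contR_mulmx g cF.
(* Continuity of [f] along the loop is inherited from [delta] through [pi]. *)
have cfg : contR (fun t => f (ga t)).
  move=> t e e0; have [d d0 hd] := pi_cont sigma (delta t) e0.
  have [d' d0' hd'] := cd t d d0; exists d' => // s /hd' /hd.
  by rewrite !Ed.
exists delta; split.
  split.
  - exact: contR_within.
  - by move=> _ [t _ <-]; apply: (Z0_V0 fG gen); rewrite Ed; exact: (in_ga t).2.
  - by rewrite /delta /ga c0 ga0.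
  - by rewrite /delta /ga c1 ga1.
exists (fun st => f (ga st.2)); split.
- exact: (contR2_within (contR2_of cfg)).
- by move=> _ [[s t] _ <-]; exact: (in_ga t).2.
- by move=> t ht; rewrite /= Ed /ga cl.
- by move=> s _; rewrite /= /ga c0 c1 ga0 ga1.
Qed.

Lemma lift_of_loop_condition (n m p : nat)
    (G : seq 'M[C]_n) (sigma : m.-tuple (mpoly.mpoly n C))
    (U : set 'rV[C]_p) (f : 'rV[C]_p -> 'rV[C]_m) x0 v0 :
  finite_matrix_group G ->
  (forall p, Defs.invariant G p ->
    exists Q : mpoly.mpoly m C, p = mpoly.comp_mpoly sigma Q) ->
  (forall i, Defs.invariant G (tnth sigma i)) ->
  open U -> connected U -> holomorphic_on U f -> f @` U `<=` Zquot sigma ->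
  U x0 -> Z0 G sigma (f x0) -> quot_map sigma v0 = f x0 ->
  (forall gamma : R -> 'rV[C]_p,
    loop_in (U `&` f @^-1` Z0 G sigma) x0 gamma ->
    exists delta : R -> 'rV[C]_n, loop_in (V0 G) v0 delta /\
      loop_homotopic (Z0 G sigma) (f x0) (f \o gamma) (quot_map sigma \o delta)) ->
  exists F : 'rV[C]_p -> 'rV[C]_n,
    holomorphic_on U F /\ (forall x, U x -> quot_map sigma (F x) = f x).
Proof.
move=> fG gen inv oU cU hf fZq Ux0 fx0 Ev0 loops.
have v00 : V0 G v0 by apply: (Z0_V0 fG gen); rewrite Ev0.
have [Q [Qv0 QV]] := discriminant fG gen v00.
pose phi x := ev Q (f x).
have dphi x : U x -> differentiable phi x.
  move=> Ux; apply: (@differentiable_comp _ _ _ _ f (fun z => ev Q z)); first exact: hf.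
  exact: differentiable_ev.
have px0 : phi x0 != 0 by rewrite /phi -Ev0.
pose U1 : set 'rV[C]_p := [set x | U x /\ phi x != 0].
have U1x0 : U1 x0 by split.
have fZ x : U1 x -> Z0 G sigma (f x).
  move=> [Ux]; have [v _ Ev] : Zquot sigma (f x) by apply: fZq; exists x.
  by rewrite /phi -Ev => /QV v1; exists v.
have oU1 x : U1 x -> exists2 e : R, 0 < e &
    forall y : 'rV[C]_p, nr (y - x) < e -> U1 y.
  move=> [Ux px]; have [r r0 hr] := (iffLR (open_nrP U)) oU x Ux.
  have pp : 0 < nr (phi x) by rewrite nr_gt0.
  have [d d0 hd] := (iffLR (continuous_nrP phi x)) (differentiable_continuous (dphi x Ux)) _ pp.
  exists (Num.min r d); first by rewrite lt_min r0.
  move=> y; rewrite lt_min => /andP[/hr Uy /hd h]; split; first exact: Uy.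
  by apply/eqP => py; move: h; rewrite py sub0r nrN ltxx.
have df x : U1 x -> differentiable f x by move=> [/hf].
have loops1 gamma : loop_in U1 x0 gamma -> exists delta : R -> 'rV[C]_n,
    loop_in (V0 G) v0 delta /\
    loop_homotopic (Z0 G sigma) (f x0) (f \o gamma) (quot_map sigma \o delta).
  move=> [c im g0 g1]; apply: loops; split => //.
  by move=> y /im hy; split; [case: hy | exact: fZ].
have reach x : U1 x -> exists v, lifted_path sigma U1 f x0 v0 x v.
  move=> [Ux px].
  have R0 := lifted_path_refl (sigma := sigma) (f := f) U1x0 Ev0.
  pose W := [set x | U1 x /\ exists v, lifted_path sigma U1 f x0 v0 x v].
  suff : W x by case.
  (* The reachable points are clopen in [{phi <> 0}], hence everything there is reachable. *)
  apply: (@complement_clopen _ p U W phi x0 oU cU dphi _ _ _ _ x Ux px).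
  - by move=> y [[]].
  - by split => //; exists v0.
  - move=> y [Uy hy]; have [r r0 hr] := reach_open fG gen inv oU1 df fZ x0 v0 Uy.
    have yr : nr (y - y) < r by rewrite subrr nr0.
    have [e e0 he] := oU1 y Uy.
    exists (Num.min r e); first by rewrite lt_min r0.
    move=> z; rewrite lt_min => /andP[zr /he Uz]; split => //; exact: hr hy.
  - move=> y Uy py nWy.
    have U1y : U1 y by split.
    have [r r0 hr] := reach_open fG gen inv oU1 df fZ x0 v0 U1y.
    have yr : nr (y - y) < r by rewrite subrr nr0.
    exists r => // z zr [_ hz]; apply: nWy; split => //; exact: hr hz.
have [g [gE dg]] := lift_on_complement fG gen inv oU1 df fZ U1x0 Ev0 loops1 reach.
have dns := identity_dense oU cU dphi Ux0 px0.
have cf x : U x -> {for x, continuous f} by move=> /hf /differentiable_continuous.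
have [F [dF Fg]] : exists F, (forall x, U x -> differentiable F x) /\
    (forall x, U x -> phi x != 0 -> F x = g x).
  apply: (@riemann_extension _ p n U phi g oU dphi dns) => x Ux.
    by move=> px; apply: dg.
  have [B [e e0 hB]] := proper_map fG gen (f x).
  have [d d0 hd] := (iffLR (continuous_nrP f x)) (cf x Ux) e e0.
  by exists B, d => // y Uy py /hd hy; apply: hB; rewrite gE.
(* A discrepancy at [x] would be less than the sum of two halves of itself: compare at a nearby [y]
   with [phi y != 0], where [F] does lift [f]. *)
exists F; split => // x Ux; apply/eqP; apply: contraT => ne.
have c0 : 0 < nr (quot_map sigma (F x) - f x) by rewrite nr_gt0 subr_eq0.
have c2 := divr_gt0 c0 (ltr0n R 2).
have [d1 d10 h1] := pi_cont sigma (F x) c2.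
have [d2 d20 h2] := (iffLR (continuous_nrP F x)) (differentiable_continuous (dF x Ux)) _ d10.
have [d3 d30 h3] := (iffLR (continuous_nrP f x)) (cf x Ux) _ c2.
have d0 : 0 < Num.min d2 d3 by rewrite lt_min d20.
have [y [Uy + py]] := dns x _ Ux d0.
rewrite lt_min => /andP[/h2/h1 q1 /h3 q2].
have E : quot_map sigma (F y) = f y by rewrite Fg // gE.
have q3 : nr (quot_map sigma (F x) - f y) < nr (quot_map sigma (F x) - f x) / 2.
  by rewrite nrBCv -E.
have := le_lt_trans (nr_triv (f y) _ _) (ltrD q3 q2).
by rewrite -splitr ltxx.
Qed.

End Main.

Theorem theorem4p4 (R : realType) (n m p : nat)
    (G : seq 'M[Cplx R]_n) (sigma : m.-tuple (mpoly.mpoly n (Cplx R)))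
    (U : set 'rV[Cplx R]_p) (f : 'rV[Cplx R]_p -> 'rV[Cplx R]_m)
    (x0 : 'rV[Cplx R]_p) (v0 : 'rV[Cplx R]_n) :
  finite_matrix_group G ->
  minimal_homogeneous_generators G sigma ->
  open U -> connected U ->
  holomorphic_on U f ->
  f @` U `<=` Zquot sigma ->
  U x0 -> Z0 G sigma (f x0) ->
  quot_map sigma v0 = f x0 ->
  (exists F : 'rV[Cplx R]_p -> 'rV[Cplx R]_n,
      holomorphic_on U F /\ (forall x, U x -> quot_map sigma (F x) = f x))
  <->
  (forall gamma : R -> 'rV[Cplx R]_p,
      loop_in (U `&` f @^-1` Z0 G sigma) x0 gamma ->
      exists delta : R -> 'rV[Cplx R]_n,
        loop_in (V0 G) v0 delta /\
        loop_homotopic (Z0 G sigma) (f x0)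
          (f \o gamma) (quot_map sigma \o delta)).
Proof.
move=> fG [_ inv gen' _] oU cU hf fZq Ux0 fx0 Ev0.
have gen q : Defs.invariant G q ->
    exists Q : mpoly.mpoly m (Cplx R), q = mpoly.comp_mpoly sigma Q.
  by move=> /gen'[Q [_ ->]]; exists Q.
split=> [[F [hF FE]] gamma hgamma|loops].
  exact: (loop_condition_of_lift fG gen inv hF FE Ux0 Ev0 hgamma).
exact: (lift_of_loop_condition fG gen inv oU cU hf fZq Ux0 fx0 Ev0 loops).
Qed.
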